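(* Let $y_0\in(0,\pi)$, let $f\colon\mathbb R\to(0,+\infty)$ be a continuous (nowhere vanishing) function, and let $$\omega=\{(x,y)\in\mathbb R\times(0,\pi):\ |y-y_0|>f(x)\}.$$ Then the Grushin equation on $\Omega=\mathbb R\times(0,\pi)$ with control region $\omega$ is never null-controllable, i.e. for every $T>0$ it is not null-controllable in time $T$.
   Context: Let $\Omega=\mathbb R\times(0,\pi)$, let $\omega\subset\Omega$ and $T>0$. The (controlled) Grushin equation on $\Omega$ with control region $\omega$ is $$\begin{cases}(\partial_t-\partial_x^2-x^2\partial_y^2)g(t,x,y)=\mathbf 1_\omega u(t,x,y), & t\in[0,T],\ (x,y)\in\Omega,\\ g(t,x,y)=0, & t\in[0,T],\ (x,y)\in\partial\Omega,\\ g(0,x,y)=g_0(x,y), & (x,y)\in\Omega,\end{cases}$$ with initial data $g_0\in L^2(\Omega)$ and control $u\in L^2((0,T)\times\Omega)$. Put $(g,h):=\int_\Omega(\partial_xg\,\partial_xh+x^2\partial_yg\,\partial_yh)\,dx\,dy$ for $g,h\in C_0^\infty(\Omega)$ and let $V(\Omega)$ be the completion of $C_0^\infty(\Omega)$ for the norm $(\cdot,\cdot)^{1/2}$. Solutions are the weak solutions $g\in C([0,T];L^2(\Omega))\cap L^2(0,T;V(\Omega))$, i.e. $g(0)=g_0$ and $\frac{d}{dt}\langle g(t),\varphi\rangle_{L^2(\Omega)}+(g(t),\varphi)=\langle\mathbf 1_\omega u(t),\varphi\rangle_{L^2(\Omega)}$ for all $\varphi\in V(\Omega)$, in the sense of distributions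 on $(0,T)$. The equation is null-controllable (on $\omega$) in time $T>0$ if for every $g_0\in L^2(\Omega)$ there exists a control $u\in L^2((0,T)\times\Omega)$ such that the solution satisfies $g(T,\cdot,\cdot)=0$ in $\Omega$. *)

(* Defs.v *)
From HB Require Import structures.
From mathcomp Require Import all_boot all_order all_algebra.
From mathcomp Require Import all_classical all_reals all_analysis.

Set Implicit Arguments.
Unset Strict Implicit.
Unset Printing Implicit Defensive.

Import Order.TTheory GRing.Theory Num.Theory.
Import numFieldNormedType.Exports.

Local Open Scope classical_set_scope.
Local Open Scope ring_scope.

(* Functions are real-valued.  An element of an L^2 space is given by a
   representative, and equality of such elements is equality a.e. *)

Section test_functions.
Context {R : realType} {U : normedModType R}.

Definition smooth (f : U -> R) : Prop :=
  forall s : seq U,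
    continuous (foldr (fun v (h : U -> R) => 'D_v h) f s) /\
    forall v z, derivable (foldr (fun v (h : U -> R) => 'D_v h) f s) z v.

Definition test_function (D : set U) (f : U -> R) : Prop :=
  [/\ smooth f, compact (closure [set z | f z != 0])
    & closure [set z | f z != 0] `<=` D].

End test_functions.

Section grushin.
Context {R : realType}.

(* R with the Borel sigma-algebra, the domain of [lebesgue_measure] *)
Local Notation bR := (measurableTypeR R).
Local Notation plane := (R * R)%type.
Local Notation leb := (@lebesgue_measure R).

Definition leb2 : {measure set (bR * bR) -> \bar R} := (leb \x leb)%E.

(* [\x^] computes the same measure as [\x], but only needs its left factor to
   be declared sigma-finite *)
Definition leb3 : {measure set (bR * (bR * bR)) -> \bar R} := (leb \x^ leb2)%E.

Definition Omega : set (bR * bR) := [set: bR] `*` `]0, pi[.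

Lemma measurable_Omega : measurable Omega.
Proof. exact: measurableX. Qed.

Definition muOmega : {measure set (bR * bR) -> \bar R} :=
  mrestr leb2 measurable_Omega.

Definition cylinder (T : R) : set (bR * (bR * bR)) := `]0, T[ `*` Omega.

Lemma measurable_cylinder T : measurable (cylinder T).
Proof. by apply: measurableX => //; exact: measurable_Omega. Qed.

Definition mucyl (T : R) : {measure set (bR * (bR * bR)) -> \bar R} :=
  mrestr leb3 (measurable_cylinder T).

Definition L2Omega : {pred plane -> R} := Lfun muOmega 2%:E.

Definition L2cyl (T : R) : {pred R * plane -> R} := Lfun (mucyl T) 2%:E.

Definition distL2 (g h : plane -> R) : \bar R :=
  'N[muOmega]_(2%:E)[EFin \o (g \- h)%R]%E.

Definition innerL2 (g h : plane -> R) : R := \int[muOmega]_z (g z * h z).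

Definition dx (phi : plane -> R) : plane -> R := 'D_((1, 0) : plane) phi.

Definition xdy (phi : plane -> R) : plane -> R :=
  fun z => z.1 * 'D_((0, 1) : plane) phi z.

(* The completion V(Omega) is realized inside L^2(Omega): on test functions
   (g, g) dominates the square of the L^2 norm (Poincare inequality in y, then
   the harmonic oscillator in x), and (dx, xdy) is closable in L^2.
   [is_grad g p q] states that g is the element of V(Omega) whose distributional
   gradient (dx g, x dy g) is (p, q); the pair (p, q) is unique a.e. *)
Definition is_grad (g p q : plane -> R) : Prop :=
  [/\ g \in L2Omega, p \in L2Omega, q \in L2Omega &
      exists phi : nat -> plane -> R,
        [/\ forall n, test_function Omega (phi n),
            distL2 (phi n) g @[n --> \oo] --> 0%E,
            distL2 (dx (phi n)) p @[n --> \oo] --> 0%E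
          & distL2 (xdy (phi n)) q @[n --> \oo] --> 0%E]].

Definition V : set (plane -> R) := [set g | exists p q, is_grad g p q].

Definition grad (g : plane -> R) : (plane -> R) * (plane -> R) :=
  xget (cst 0, cst 0) [set pq | is_grad g pq.1 pq.2].

Definition formV (g h : plane -> R) : R :=
  \int[muOmega]_z ((grad g).1 z * (grad h).1 z + (grad g).2 z * (grad h).2 z).

Definition normV (g : plane -> R) : R := Num.sqrt (formV g g).

(* C([0,T]; L^2(Omega)); values of g outside [0,T] are irrelevant *)
Definition continuous_L2 (T : R) (g : R -> plane -> R) : Prop :=
  forall t, t \in `[0, T] ->
    g t \in L2Omega /\
    distL2 (g s) (g t) @[s --> within `[0, T] (nbhs t)] --> 0%E.

Definition simple_V (s : R -> plane -> R) : Prop :=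
  exists (k : nat) (A : 'I_k -> set R) (v : 'I_k -> plane -> R),
    [/\ forall i, measurable (A i), forall i, V (v i)
      & s = fun t z => \sum_(i < k) \1_(A i) t * v i z].

(* Bochner space L^2(0,T; V(Omega)): strongly measurable functions, i.e. a.e.
   limits in V(Omega) of simple functions, with square integrable norm *)
Definition L2V (T : R) (g : R -> plane -> R) : Prop :=
  [/\ {ae leb, forall t, t \in `]0, T[ -> V (g t)},
      exists s : nat -> R -> plane -> R,
        (forall n, simple_V (s n)) /\
        {ae leb, forall t, t \in `]0, T[ ->
          normV (g t \- s n t) @[n --> \oo] --> (0 : R)}
    & (\int[leb]_(t in `]0%R, T[) (normV (g t) ^+ 2)%:E < +oo)%E].

(* a' + b = c in the sense of distributions on (0,T) *)
Definition distr_ode (T : R) (a b c : R -> R) : Prop :=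
  forall theta : R -> R, test_function (`]0, T[ : set R) theta ->
    - (\int[leb]_(t in `]0, T[) (a t * (theta^`())%classic t))
      + \int[leb]_(t in `]0, T[) (b t * theta t)
    = \int[leb]_(t in `]0, T[) (c t * theta t).

Definition grushin_solution (omega : set plane) (T : R)
    (g0 : plane -> R) (u : R * plane -> R) (g : R -> plane -> R) : Prop :=
  [/\ continuous_L2 T g, L2V T g, g 0 = g0 %[ae muOmega]
    & forall phi, V phi ->
        distr_ode T (fun t => innerL2 (g t) phi) (fun t => formV (g t) phi)
          (fun t => innerL2 (fun z => \1_omega z * u (t, z)) phi)].

Definition null_controllable (omega : set plane) (T : R) : Prop :=
  forall g0, g0 \in L2Omega ->
    exists u g, [/\ u \in L2cyl T, grushin_solution omega T g0 u g
      & g T = cst 0 %[ae muOmega]].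

End grushin.

(* Main.v *)
Require Import Defs.
From HB Require Import structures.
From mathcomp Require Import all_boot all_order all_algebra.
From mathcomp Require Import complex.
From mathcomp Require Import all_classical all_reals all_analysis.
From mathcomp Require Import measurable_realfun.
From mathcomp Require Import ring lra.

Set Implicit Arguments.
Unset Strict Implicit.
Unset Printing Implicit Defensive.

Import Order.TTheory GRing.Theory Num.Theory.
Import numFieldNormedType.Exports.

Local Open Scope classical_set_scope.
Local Open Scope ring_scope.

(* The functions phi_n = e^(-n x^2 / 2) sin (n y) satisfy
   (d_x^2 + x^2 d_y^2) phi_n = - n phi_n, so for a solution g the pairing
   c_n(t) = <g(t), phi_n> solves c_n' + n c_n = <1_omega u(t), phi_n>, and
   g(T) = 0 forces
     <g_0, phi_n> = - int_0^T int_omega u e^(n t) phi_n   for all n >= 1.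
   With w = e^(t - x^2 / 2 + i y), the product e^(n t) phi_n is the imaginary
   part of w^n.  Where |w| >= rho / 2, rho := e^(-1/2), the point x stays bounded,
   hence f(x) is bounded below and w avoids a sector around the ray of angle y_0
   when (x, y) is in omega.  The relevant values of w therefore omit a
   neighbourhood of the slit [rho, oo) e^(i y_0), and by pole pushing along the
   slit there are polynomials equal to 1 at rho e^(i y_0) and uniformly small on
   these values.  A linear combination of the identities above with their
   coefficients makes the right-hand side arbitrarily small, whereas for
   g_0 = x 1_[1,2](x) 1_[y_0,pi](y) the left-hand side contains the value of the
   polynomial at rho e^(i y_0) and stays away from 0. *)

(** * Polynomial approximation on a slit disc *)

(** Uniform smallness of the polynomials is not enough, because [u] is integrated over an unbounded
    strip: the bound must carry a factor [|w|], which is at most [e^T e^(- x^2 / 8)] and makes the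
    integral against [|u|] finite. The datum supplies this factor. Its moments are [(rho^n - s^n)
    (cos (n y_0) - cos (n pi)) / n^2] with [s = e^(-2)]; clearing the denominator applies the Euler
    operator [z d/dz] twice on the control side, and its image is divisible by [z]. The price is two
    derivatives of a high power [E^m], that is a factor of order [m^2], which loses against
    geometric decay. The identities are real, so only real parts of coefficients can be used. Taking
    them averages a polynomial with its conjugate reflection, so every estimate is also needed at
    the conjugate points; these avoid the slit because [0 < y_0 < pi]. On the side of the equation,
    the obstacle is that the gradient in V(Omega) is only a choice of some L^2 limit. It is never
    identified with a classical gradient: pairings are computed along test functions, where
    derivatives can be moved. *)

Section polynomial_hull.
Variable C : numFieldType.
Implicit Types (K : C -> Prop) (p z : C) (A E : {poly C}).

(** Over the complex numbers this says that [p] lies outside the polynomially convex hull of [K]: a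
    polynomial larger at [p] than on [K] can be normalised at [p] and raised to a high power. *)
Definition peaks K p := forall eta : C, 0 < eta ->
  exists E, E.[p] = 1 /\ forall z, K z -> `|E.[z]| <= eta.

(** An Archimedean property, which a general [numFieldType] does not have; [complex_small_power]
    supplies it for [R[i]]. *)
Hypothesis small_power : forall q eta : C, 0 <= q -> q < 1 -> 0 < eta ->
  exists J, q ^+ J <= eta.

(** Starting point of the pole pushing: beyond a disc containing [K], powers of [z / p] already peak
    at [p]. *)
Lemma peaks_outside_disc K p (r : C) : 0 < r -> r < `|p| ->
  (forall z, K z -> `|z| <= r) -> peaks K p.
Proof.
move=> r0 rp Kr eta eta0.
have p0 : 0 < `|p| by exact: lt_trans rp.
have pN0 : p != 0 by rewrite -normr_gt0.
have [||J hJ] := @small_power (r / `|p|) eta _ _ eta0.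
- by rewrite divr_ge0// ltW.
- by rewrite ltr_pdivrMr// mul1r.
exists ((p^-1 *: 'X) ^+ J); split.
  by rewrite horner_exp hornerZ hornerX mulVf// expr1n.
move=> z Kz; rewrite horner_exp hornerZ hornerX normrX normrM normfV.
apply: le_trans hJ; rewrite lerXn2r ?nnegrE ?mulr_ge0 ?invr_ge0 ?(ltW r0)//.
by rewrite mulrC ler_wpM2r ?invr_ge0// Kr.
Qed.

Lemma geometric_half (a : C) n : `|a| <= 2^-1 ->
  `|\sum_(i < n) a ^+ i| <= 2.
Proof.
move=> ha; apply: le_trans (ler_norm_sum _ _ _) _.
have : \sum_(i < n) `|a ^+ i| <= \sum_(i < n) (2^-1 : C) ^+ i.
  by apply: ler_sum => i _; rewrite normrX lerXn2r ?nnegrE ?invr_ge0.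
move/le_trans; apply.
suff -> : \sum_(i < n) (2^-1 : C) ^+ i = 2 - 2 * 2^-1 ^+ n.
  by rewrite gerBl mulr_ge0// exprn_ge0// invr_ge0.
elim: n => [|n IH]; first by rewrite big_ord0 expr0 mulr1 subrr.
by rewrite big_ord_recr/= IH exprS; field.
Qed.

(* Pole pushing: with [E = 1 - (X - p) A], the polynomial [A] approximates
   [1 / (z - p)] on [K], and [1 / (z - p')] is a geometric series in it. *)
Lemma peaks_step K p p' (d : C) : 0 < d ->
  (forall z, K z -> d <= `|z - p|) -> `|p' - p| <= d / 4 ->
  peaks K p -> peaks K p'.
Proof.
move=> d0 hK hp peak eta eta0.
have [||J hJ] := @small_power 2^-1 (eta / 2) _ _ (divr_gt0 eta0 (ltr0n C 2)).
- by rewrite invr_ge0.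
- by rewrite invf_lt1// ltr1n.
(* This value meets both demands below: [eta1 <= 1], so that [|1 - E| <= 2] on [K], and
   [2 * eta1 <= eta / 2], where 2 bounds the geometric sum. *)
pose eta1 := eta / (eta + 4).
have eta4 : 0 < eta + 4 by rewrite addr_gt0.
have [|E [Ep hE]] := peak eta1; first by rewrite divr_gt0.
have eta1_1 : eta1 <= 1 by rewrite ler_pdivrMr// mul1r lerDl.
have eta1_4 : eta1 * 2 <= eta / 2.
  rewrite /eta1 ler_pdivlMr// -mulrA mulrC mulrA ler_pdivrMr//.
  by rewrite -natrM mulrDr mulrC lerDr mulr_ge0// ltW.
have /factor_theorem [A EA] : root (1 - E) p.
  by rewrite rootE hornerD hornerN hornerC Ep subrr.
pose e := p' - p.
pose S := \sum_(i < J) (e *: A) ^+ i.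
exists (1 - ('X - p'%:P) * A * S); split.
  by rewrite !(hornerE, hornerM) subrr !mul0r subr0.
move=> z Kz.
have Az : A.[z] * (z - p) = 1 - E.[z].
  have := congr1 (horner^~ z) EA.
  by rewrite hornerM !hornerE => <-.
set a := e * A.[z].
have zp0 : 0 < `|z - p| by apply: lt_le_trans d0 (hK _ Kz).
have ha : `|a| <= 2^-1.
  have : `|a| * `|z - p| <= d / 2.
    rewrite -normrM /a -mulrA Az normrM.
    have h2 : `|1 - E.[z]| <= 2.
      apply: le_trans (ler_normB _ _) _; rewrite normr1 -[2]/(1 + 1) lerD2l.
      exact: le_trans (hE _ Kz) eta1_1.
    apply: le_trans (ler_pM _ _ hp h2) _ => //.
    have -> : d / 4 * 2 = d / 2 by field.
    exact: lexx.
  move=> h; rewrite -(ler_pM2r zp0); apply: le_trans h _.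
  by rewrite mulrC ler_wpM2l ?invr_ge0// hK.
have Sz : S.[z] = \sum_(i < J) a ^+ i.
  rewrite /S horner_sum; apply: eq_bigr => i _.
  by rewrite horner_exp hornerZ.
(* Since [(z - p') A = (1 - a) - E] at [z], multiplying by [S] telescopes the first part to
   [1 - a ^+ J]. Both remaining terms are at most [eta / 2]. *)
have -> : (1 - ('X - p'%:P) * A * S).[z] = a ^+ J + E.[z] * S.[z].
  have hg : 1 - a ^+ J = (1 - a) * S.[z] by rewrite Sz -[LHS]opprB subrX1 -mulNr opprB.
  rewrite !(hornerE, hornerM).
  have -> : a ^+ J = 1 - (1 - a) * S.[z] by rewrite -hg; ring.
  have -> : E.[z] = 1 - A.[z] * (z - p) by rewrite Az; ring.
  by rewrite /a /e; ring.
apply: le_trans (ler_normD _ _) _.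
rewrite -[eta](@mulfVK _ 2) ?pnatr_eq0// mulr_natr mulr2n.
apply: lerD.
  apply: le_trans hJ; rewrite normrX lerXn2r ?nnegrE ?invr_ge0//.
apply: le_trans eta1_4; rewrite normrM ler_pM//; first exact: hE.
by rewrite Sz geometric_half.
Qed.

(** The admissible step [d / 4] does not shrink along the way as long as all centres keep the same
    distance [d] from [K], so finitely many equal steps reach [p']. *)
Lemma peaks_segment K p p' (d : C) N : 0 < d -> `|p' - p| <= N.+1%:R * (d / 4) ->
  (forall z i, (i <= N.+1)%N -> K z ->
     d <= `|z - (p + i%:R * ((p' - p) / N.+1%:R))|) ->
  peaks K p -> peaks K p'.
Proof.
move=> d0 hp hK pk.
have /(_ N.+1 (leqnn _)) : forall i, (i <= N.+1)%N ->
    peaks K (p + i%:R * ((p' - p) / N.+1%:R)).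
  elim=> [|i IH] iN; first by rewrite mul0r addr0.
  apply: (peaks_step (d := d)) (IH (ltnW iN)) => //.
    by move=> z Kz; apply: hK => //; exact: ltnW.
  rewrite opprD addrACA subrr add0r -mulrBl -natrB// subSnn mul1r.
  rewrite normrM normfV ler_pdivrMr ?normr_gt0 ?pnatr_eq0//.
  by rewrite normr_nat mulrC.
by rewrite mulrC divfK ?pnatr_eq0// addrC subrK.
Qed.

End polynomial_hull.

(** * The Euler operator on polynomials *)

Section euler_operator.
Variable F : comNzRingType.
Implicit Types p : {poly F}.

(** The operator [z d/dz]. Applied twice it multiplies the n-th coefficient by [n ^ 2], the
    denominator in the moments of the initial datum. *)
Definition theta p := 'X * deriv p.

Lemma coef_theta p n : (theta p)`_n = p`_n *+ n.
Proof. by rewrite coefXM; case: n => [|n]; rewrite ?mulr0n// coef_deriv. Qed.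

Lemma thetaM p q : theta (p * q) = theta p * q + p * theta q.
Proof. by rewrite /theta derivM mulrDr mulrA mulrCA. Qed.

Lemma theta_exp p n : theta (p ^+ n.+1) = p ^+ n * theta p *+ n.+1.
Proof.
elim: n => [|n IH]; first by rewrite expr1 expr0 mul1r.
by rewrite exprS thetaM IH [RHS]mulrS mulrnAr mulrA -exprS mulrC.
Qed.

(** This form displays what the estimate needs: an outer factor ['X], powers of [p] that are at
    least the k-th and hence small where [p] is small, and numerical factors that are only quadratic
    in [k]. *)
Lemma theta2_exp p k : theta (theta (p ^+ k.+2)) =
  'X * (p ^+ k * ('X * deriv p ^+ 2) *+ (k.+2 * k.+1)
       + p ^+ k.+1 * deriv (theta p) *+ k.+2).
Proof.
rewrite theta_exp.
have -> q n : theta (q *+ n) = theta q *+ n by rewrite /theta derivMn mulrnAr.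
rewrite (thetaM (p ^+ k.+1) (theta p)) theta_exp.
have -> : theta (theta p) = 'X * deriv (theta p) by [].
have -> : theta p = 'X * deriv p by [].
rewrite mulrnDl mulrnAl -mulrnA (mulnC k.+1) mulrDr !mulrnAr.
move: (p ^+ k) (p ^+ k.+1) (deriv p) (deriv ('X * deriv p)) => a b c d.
by congr (_ *+ _ + _ *+ _); ring.
Qed.

End euler_operator.

Lemma horner_bounded (C : numFieldType) (p : {poly C}) (r : C) :
  exists2 M, 0 <= M & forall z, `|z| <= r -> `|p.[z]| <= M.
Proof.
(* [C] is only partially ordered, so [r] need not be comparable with 0. If [0 <= r] fails, no [z]
   satisfies the premise. *)
have [r0|r0] := boolP (0 <= r); last first.
  exists 0 => // z zr; exfalso; move/negP: r0; apply.
  exact: le_trans zr.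
exists (\sum_(i < size p) `|p`_i| * r ^+ i).
  by apply: sumr_ge0 => i _; rewrite mulr_ge0// exprn_ge0.
move=> z zr; rewrite horner_coef; apply: le_trans (ler_norm_sum _ _ _) _.
apply: ler_sum => i _; rewrite normrM normrX ler_wpM2l//.
by rewrite lerXn2r ?nnegrE.
Qed.

(** * Polar coordinates in the complex plane *)

Section polar.
Local Open Scope complex_scope.
Variable R : realType.
Implicit Types (r y : R) (z w : R[i]).

Definition polar r y : R[i] := (r * cos y) +i* (r * sin y).

Lemma polarX r y n : polar r y ^+ n = polar (r ^+ n) (n%:R * y).
Proof.
elim: n => [|n IH]; first by rewrite !expr0 mul0r /polar cos0 sin0 mulr0 mulr1.
rewrite exprS IH /polar; simpc; rewrite -natr1 mulrDl mul1r cosD sinD exprS.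
by congr (_ +i* _); ring.
Qed.

Lemma norm_polar r y : 0 <= r -> `|polar r y| = r%:C.
Proof.
move=> r0; rewrite normc_def /=; congr (_%:C).
by rewrite !exprMn -mulrDr cos2Dsin2 mulr1 sqrtr_sqr ger0_norm.
Qed.

Lemma polarB r r' y y' :
  `|polar r y - polar r' y'| ^+ 2 = (r ^+ 2 + r' ^+ 2 - 2 * r * r' * cos (y - y'))%:C.
Proof.
rewrite -add_Re2_Im2 /=; congr (_%:C).
rewrite cosB; have := cos2Dsin2 y; have := cos2Dsin2 y'.
move=> h1 h2.
transitivity (r ^+ 2 * (cos y ^+ 2 + sin y ^+ 2)
  + r' ^+ 2 * (cos y' ^+ 2 + sin y' ^+ 2)
  - 2 * r * r' * (cos y * cos y' + sin y * sin y')); first by ring.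
by rewrite h1 h2 !mulr1.
Qed.

Lemma Re_sum (I : Type) (s : seq I) (P : pred I) (F : I -> R[i]) :
  complex.Re (\sum_(i <- s | P i) F i) = \sum_(i <- s | P i) complex.Re (F i).
Proof. by apply: (big_morph (@complex.Re R)) => // -[a b] [c d]. Qed.

Lemma Im_sum (I : Type) (s : seq I) (P : pred I) (F : I -> R[i]) :
  complex.Im (\sum_(i <- s | P i) F i) = \sum_(i <- s | P i) complex.Im (F i).
Proof. by apply: (big_morph (@complex.Im R)) => // -[a b] [c d]. Qed.

(** Replacing coefficients by their real parts averages [p] with its conjugate reflection; this is
    why [- y] appears next to [y]. *)
Lemma Re_coef_sin N (p : {poly R[i]}) r y : (size p <= N)%N ->
  \sum_(i < N) complex.Re p`_i * (r ^+ i * sin (i%:R * y)) =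
  complex.Im (p.[polar r y] - p.[polar r (- y)]) / 2.
Proof.
move=> pN; rewrite !(horner_coef_wide _ pN) -sumrB Im_sum mulr_suml; apply: eq_bigr => i _.
rewrite -mulrBr !polarX mulrN; case: (p`_i) => a b; rewrite /polar cosN sinN /=.
by field.
Qed.

Lemma Re_coef_cos N (p : {poly R[i]}) r y : (size p <= N)%N ->
  \sum_(i < N) complex.Re p`_i * (r ^+ i * cos (i%:R * y)) =
  complex.Re (p.[polar r y] + p.[polar r (- y)]) / 2.
Proof.
move=> pN; rewrite !(horner_coef_wide _ pN) -big_split /= Re_sum mulr_suml; apply: eq_bigr => i _.
rewrite -mulrDr !polarX mulrN; case: (p`_i) => a b; rewrite /polar cosN sinN /=.
by field.
Qed.

Lemma normc_Im z (e : R) : `|z| <= e%:C -> `|complex.Im z| <= e.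
Proof.
rewrite normc_def lecR; apply: le_trans.
by rewrite -sqrtr_sqr ler_wsqrtr// lerDr sqr_ge0.
Qed.

Lemma normc_Re z (e : R) : `|z| <= e%:C -> `|complex.Re z| <= e.
Proof.
rewrite normc_def lecR; apply: le_trans.
by rewrite -sqrtr_sqr ler_wsqrtr// lerDl sqr_ge0.
Qed.

Lemma complex_small_power (q eta : R[i]) : 0 <= q -> q < 1 -> 0 < eta ->
  exists J, q ^+ J <= eta.
Proof.
move=> q0 q1 e0.
have qE : q = (complex.Re q)%:C by rewrite RRe_real// ger0_real.
have eE : eta = (complex.Re eta)%:C by rewrite RRe_real// gtr0_real.
move: q0 q1 e0; rewrite qE eE -[1]/(1%:C) -[0]/(0%:C) lecR !ltcR => q0 q1 e0.
have /cvgrPdist_le /(_ _ e0) [J _ hJ] : (fun n : nat => complex.Re q ^+ n) @ \oo --> 0.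
  by apply: cvg_expr; rewrite ger0_norm.
exists J; have := hJ J (leqnn J); rewrite sub0r normrN ger0_norm ?exprn_ge0//.
by rewrite -rmorphXn lecR.
Qed.

End polar.

(** * Peaking at the tip of a slit *)

Section slit_disc.
Local Open Scope complex_scope.
Context {R : realType}.
Implicit Types (r y c rho t b d : R) (z w : R[i]).

Lemma polarE r y : polar r y = r%:C * polar 1 y.
Proof. by rewrite /polar !mul1r; simpc. Qed.

Lemma real_complexM (x y : R) : (x * y)%:C = x%:C * y%:C.
Proof. exact: rmorphM. Qed.

Lemma real_complexD (x y : R) : (x + y)%:C = x%:C + y%:C.
Proof. exact: rmorphD. Qed.

Lemma real_complexV (x : R) : x^-1%:C = x%:C^-1.
Proof. exact: fmorphV. Qed.

Lemma real_complex_nat n : (n%:R : R)%:C = n%:R.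
Proof. exact: rmorph_nat. Qed.

(** For [r <= rho / 2] the moduli alone are far apart, whatever the angle. Otherwise the angle
    counts: by the law of cosines the squared distance is at least
    [c (r - t)^2 + (1 - c) r^2 + (1 - c) t^2], hence at least [((1 - c) t)^2]. *)
Lemma polar_far r t y y0 rho c : 0 <= r -> 0 < rho -> rho <= t ->
  0 <= c -> c < 1 -> (rho / 2 < r -> cos (y - y0) <= c) ->
  ((1 - c) * rho / 2)%:C <= `|polar r y - polar t y0|.
Proof.
move=> r0 rho0 rhot c0 c1 hc.
have d0 : 0 <= (1 - c) * rho / 2 by apply: divr_ge0 => //; apply: mulr_ge0; lra.
rewrite -(@ler_pXn2r _ 2) ?nnegrE ?normr_ge0 ?ler0c// polarB -rmorphXn lecR.
have [rsmall|rbig] := leP r (rho / 2).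
  have cos1 := cos_le1 (y - y0).
  have h1 : 2 * r * t * cos (y - y0) <= 2 * r * t.
    by apply: ler_piMr => //; apply: mulr_ge0; [apply: mulr_ge0|]; lra.
  have h2 : (1 - c) * rho / 2 <= t - r by nra.
  have h3 : ((1 - c) * rho / 2) ^+ 2 <= (t - r) ^+ 2.
    by apply: lerXn2r; rewrite ?nnegrE//; lra.
  by apply: le_trans h3 _; rewrite sqrrB -mulr_natr; lra.
have h1 : 2 * r * t * cos (y - y0) <= 2 * r * t * c.
  by apply: ler_wpM2l; [apply: mulr_ge0; [apply: mulr_ge0|]; lra|exact: hc].
have h2 : ((1 - c) * rho / 2) ^+ 2 <= ((1 - c) * t) ^+ 2.
  by apply: lerXn2r; rewrite ?nnegrE//; nra.
have h3 : ((1 - c) * t) ^+ 2 <= (1 - c) * t ^+ 2.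
  by rewrite exprMn; apply: ler_wpM2r; rewrite ?sqr_ge0//; nra.
have h4 : 0 <= c * (r - t) ^+ 2 by rewrite mulr_ge0 ?sqr_ge0.
have h5 : 0 <= (1 - c) * r ^+ 2 by apply: mulr_ge0; rewrite ?sqr_ge0//; lra.
nra.
Qed.

Definition slit_disc b rho d y0 z :=
  `|z| <= b%:C /\ forall t, rho <= t -> d%:C <= `|z - polar t y0|.

(** The pole starts at modulus [b + 1], outside the disc, and slides down the ray to modulus [rho].
    All intermediate centres lie on the slit, so the distance [d] is kept. *)
Lemma peaks_slit_disc b rho d y0 : 0 < d -> 0 < rho -> rho < b ->
  peaks (slit_disc b rho d y0) (polar rho y0).
Proof.
move=> d0 rho0 rhob.
(* With [N.+1] steps each one is shorter than [d / 4]. *)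
pose N := Num.truncn ((b + 1 - rho) / (d / 4)).
have b0 : 0 < b by exact: lt_trans rhob.
have hsub : polar rho y0 - polar (b + 1) y0 = (rho - (b + 1))%:C * polar 1 y0.
  by rewrite (polarE rho) (polarE (b + 1)) -mulrBl -rmorphB.
apply: (@peaks_segment _ (@complex_small_power R) _ (polar (b + 1) y0) _ d%:C N).
- by rewrite ltcR.
- rewrite hsub normrM norm_polar// mulr1 normc_def /= expr0n addr0 sqrtr_sqr.
  have -> : N.+1%:R * (d%:C / 4) = (N.+1%:R * (d / 4))%:C.
    by rewrite !real_complexM real_complexV !real_complex_nat.
  rewrite lecR distrC gtr0_norm; last by lra.
  by rewrite -ler_pdivrMr ?divr_gt0// ltW// truncnS_gt.
- move=> z i iN [_ hz].
  have -> : polar (b + 1) y0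
      + i%:R * ((polar rho y0 - polar (b + 1) y0) / N.+1%:R)
    = polar (b + 1 + i%:R * ((rho - (b + 1)) / N.+1%:R)) y0.
    rewrite hsub (polarE (b + 1)) (polarE (b + 1 + _)).
    rewrite [(b + 1 + _)%:C]real_complexD !real_complexM real_complexV !real_complex_nat.
    by move: (polar 1 y0) => u; ring.
  apply: hz.
  have : i%:R / N.+1%:R <= 1 :> R by rewrite ler_pdivrMr// mul1r ler_nat.
  have -> : b + 1 + i%:R * ((rho - (b + 1)) / N.+1%:R)
      = b + 1 - (b + 1 - rho) * (i%:R / N.+1%:R) by ring.
  move: (i%:R / N.+1%:R) => s s1.
  have : (b + 1 - rho) * s <= (b + 1 - rho) * 1 by apply: ler_wpM2l => //; lra.
  by lra.
- apply: (@peaks_outside_disc _ (@complex_small_power R) _ _ b%:C).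
  + by rewrite ltcR.
  + by rewrite norm_polar ?ltcR; lra.
  + by move=> z [].
Qed.

(** Two Euler derivatives of [E ^+ k.+2] cost [k.+2 ^ 2]; against the decay [8 ^ (- k)] this still
    leaves [4 * 2 ^ (- k)]. *)
Lemma ltn_sqr_8 k : (k.+2 ^ 2 * 2 ^ k <= 4 * 8 ^ k)%N.
Proof.
have : (k.+2 <= 2 ^ k.+1)%N by exact: ltn_expl.
move=> h; have := leq_mul h h; rewrite !expnS => h2.
have -> : (8 ^ k = 2 ^ k * 2 ^ k * 2 ^ k)%N by rewrite -!expnMn.
rewrite -expnS.
apply: leq_trans (leq_mul h2 (leqnn _)) _.
by move: (2 ^ k)%N => m; rewrite mulnACA -!mulnA.
Qed.

Lemma cos_le_pi (x y : R) : 0 <= x -> x <= y -> y <= pi -> cos y <= cos x.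
Proof.
move=> x0; rewrite le_eqVlt => /predU1P[-> //|xy] ypi; apply: ltW.
by rewrite ltr_cos ?in_itv /= ?x0 ?ypi ?andbT //; lra.
Qed.

Lemma abs_cos_lt1 (x : R) : 0 < x < pi -> `|cos x| < 1.
Proof.
move=> /sin_gt0_pi sx; rewrite lt_neqAle cos_max andbT norm_cos_eq1.
by rewrite gt_eqF.
Qed.

Lemma cos_sub_le (f y y0 : R) : 0 < y0 < pi -> 0 < y < pi ->
  0 <= f -> f <= `|y - y0| -> cos (y - y0) <= cos f.
Proof.
move=> /andP[? ?] /andP[? ?] f0 hf; rewrite -cos_norm.
by apply: cos_le_pi => //; rewrite ler_norml; apply/andP; split; lra.
Qed.

(** This keeps the conjugate point [polar r (- y)] off the slit: [y + y0] runs through an interval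
    from [y0] to [pi + y0], on which the cosine is largest at an end, with value [cos y0] or
    [- cos y0]. *)
Lemma cos_add_le (y y0 : R) : 0 < y0 < pi -> 0 < y < pi ->
  cos (y + y0) <= `|cos y0|.
Proof.
move=> /andP[? ?] /andP[? ?].
have [h|h] := leP (y + y0) pi.
  by apply: le_trans (ler_norm _); apply: cos_le_pi; lra.
rewrite -[y + y0](subrK pi) cosDpi -normrN.
by apply: le_trans (ler_norm _); rewrite lerN2; apply: cos_le_pi; lra.
Qed.

Lemma Re_mulrn z n : complex.Re (z *+ n) = complex.Re z * n%:R.
Proof.
elim: n => [|n IH]; first by rewrite !mulr0.
by rewrite mulrSr -natr1 mulrDr mulr1 -IH; case: z {IH} => a b; case: (_ *+ _).
Qed.

(* A Runge theorem with weights: the polynomials [E ^+ m] have value 1 at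
   [polar rho y0] and tend to 0 at the other points that matter. *)
Lemma peaking_coefficients (y0 rho s b e f1 : R) :
  0 < y0 < pi -> 0 < s <= rho / 2 -> rho < b -> 0 < e -> 0 < f1 ->
  exists N (a : nat -> R),
    (forall r y, 0 <= r <= b -> 0 < y < pi -> (rho / 2 < r -> f1 <= `|y - y0|) ->
      `|\sum_(n < N) a n * (n%:R ^+ 2 * (r ^+ n * sin (n%:R * y)))| <= e * r) /\
    4^-1 <= `|\sum_(n < N) a n * ((rho ^+ n - s ^+ n) *
                (cos (n%:R * y0) - cos (n%:R * pi)))|.
Proof.
move=> y0pi /andP[s0 srho] rhob e0 f10.
have rho0 : 0 < rho by lra.
have [y00 y0lt] := andP y0pi.
have pi2 := @pi_ge2 R.
(* The cap at 1 keeps [f2] below [pi], where the cosine is decreasing and less than 1. *)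
pose f2 := Num.min f1 1.
have f20 : 0 < f2 by rewrite lt_min f10 ltr01.
have f21 : f2 <= 1 by rewrite ge_min lexx orbT.
have f2f1 : f2 <= f1 by rewrite ge_min lexx.
(* One angular gap for all points in play: [cos f2] serves the points at angle at least [f1] from
   [y0], [|cos y0|] their conjugates and the angles [pi] and [- pi], and [cos (y0 + y0)] the
   conjugate of the peak itself. *)
pose c := Num.max (Num.max (cos f2) `|cos y0|) (cos (y0 + y0)).
have hc1 : cos f2 <= c by rewrite !le_max lexx.
have hc2 : `|cos y0| <= c by rewrite !le_max lexx orbT.
have hc3 : cos (y0 + y0) <= c by rewrite !le_max lexx orbT.
have c0 : 0 <= c by apply: le_trans hc2.
have cosy0 := abs_cos_lt1 y0pi.
have c1 : c < 1.
  rewrite !gt_max cosy0 andbT; apply/andP; split.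
    by apply: le_lt_trans (ler_norm _) _; apply: abs_cos_lt1; rewrite f20; lra.
  rewrite -[y0 + y0]mulr2n cos_mulr2n mulr2n -real_normK ?num_real//.
  by have := normr_ge0 (cos y0); nra.
pose d := (1 - c) * rho / 2.
have d0 : 0 < d by apply: divr_gt0 => //; apply: mulr_gt0; lra.
pose K := slit_disc b rho d y0.
have KP r y : 0 <= r -> r <= b -> (rho / 2 < r -> cos (y - y0) <= c) ->
    K (polar r y).
  move=> r0 rb hr; split; first by rewrite norm_polar// lecR.
  by move=> t rhot; apply: polar_far.
(* The value 1/8 is small enough to beat [k.+2 ^ 2] with room to spare, and it already gives
   [|B| <= 1/64] on [K] for every power with exponent at least 2. *)
have [|E [Ew KE]] := peaks_slit_disc y0 d0 rho0 rhob (eta := 8^-1).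
  by rewrite invr_gt0.
have [M1 M10 hM1] := horner_bounded ('X * deriv E ^+ 2) b%:C.
have [M2 M20 hM2] := horner_bounded (deriv (theta E)) b%:C.
pose M := M1 + M2 + 1.
have M0 : 0 < M by rewrite ltr_wpDl// addr_ge0.
(* The power is fixed only after the bounds [M1], [M2] on derivatives of [E], which do not depend on
   it; then [4 * 2 ^ (- k) * M <= e]. *)
have [|||k hk] := @complex_small_power R 2^-1 (e%:C / (4 * M)).
- by rewrite invr_ge0.
- by rewrite invf_lt1// ltr1n.
- by rewrite divr_gt0 ?mulr_gt0// ltcR.
pose B := E ^+ k.+2.
pose P := theta (theta B).
have PE z : K z -> `|P.[z]| <= `|z| * e%:C.
  move=> Kz; have zb := Kz.1.
  rewrite /P theta2_exp hornerM hornerX normrM; apply: ler_wpM2l => //.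
  have kE n : `|E.[z]| ^+ n <= 8^-1 ^+ n.
    by rewrite lerXn2r ?nnegrE ?invr_ge0 ?KE.
  have hsum : `|(E ^+ k * ('X * deriv E ^+ 2) *+ (k.+2 * k.+1) +
      E ^+ k.+1 * deriv (theta E) *+ k.+2).[z]|
      <= (8^-1 ^+ k * (M1 + M2)) *+ (k.+2 ^ 2).
    rewrite hornerD !hornerMn !(hornerM (E ^+ _)) !horner_exp.
    apply: le_trans (ler_normD _ _) _; rewrite !normrMn !normrM !normrX.
    rewrite mulrDr mulrnDl; apply: lerD.
      apply: le_trans (_ : _ <= (8^-1 ^+ k * M1) *+ (k.+2 * k.+1)) _.
        by rewrite lerMn2r; apply/orP; right; rewrite ler_pM ?exprn_ge0 ?hM1.
      rewrite ler_wpMn2l ?mulr_ge0 ?exprn_ge0 ?invr_ge0//.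
      by rewrite expnS expn1 leq_mul.
    apply: le_trans (_ : _ <= (8^-1 ^+ k * M2) *+ k.+2) _.
      rewrite lerMn2r; apply/orP; right; rewrite ler_pM ?exprn_ge0 ?hM2//.
      apply: le_trans (kE _) _; rewrite exprS ler_piMl ?exprn_ge0 ?invr_ge0//.
      by rewrite invf_le1// ler1n.
    rewrite ler_wpMn2l ?mulr_ge0 ?exprn_ge0 ?invr_ge0//.
    by rewrite expnS expn1 leq_pmulr.
  apply: le_trans hsum _.
  have h8 : (8^-1 ^+ k : R[i]) *+ (k.+2 ^ 2) <= 4 * 2^-1 ^+ k.
    rewrite !exprVn -[X in X <= _]mulr_natl ler_pdivrMr ?exprn_gt0//.
    rewrite [leRHS]mulrAC ler_pdivlMr; last by rewrite exprn_gt0.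
    by rewrite -!natrX -!natrM ler_nat ltn_sqr_8.
  rewrite -mulrnAl.
  apply: le_trans (ler_wpM2r (addr_ge0 M10 M20) h8) _.
  apply: le_trans (_ : _ <= 4 * (e%:C / (4 * M)) * M) _.
    apply: ler_pM; rewrite ?mulr_ge0 ?addr_ge0 ?exprn_ge0 ?invr_ge0//.
      by rewrite ler_wpM2l.
    by rewrite lerDl.
  rewrite le_eqVlt; apply/orP; left; apply/eqP; field.
  by rewrite gt_eqF.
exists (size B), (fun n => complex.Re B`_n); split.
  move=> r y /andP[r0 rb] /andP[ygt ylt] hr.
  have K1 : K (polar r y).
    apply: KP => // /hr hy; apply: le_trans hc1.
    apply: cos_sub_le => //; [by rewrite ygt|exact: ltW|exact: le_trans hy].
  have K2 : K (polar r (- y)).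
    apply: KP => // _; rewrite -cosN opprB opprK addrC; apply: le_trans hc2.
    by apply: cos_add_le; rewrite // ygt.
  have -> : \sum_(n < size B) complex.Re B`_n *
      (n%:R ^+ 2 * (r ^+ n * sin (n%:R * y)))
    = \sum_(n < size B) complex.Re P`_n * (r ^+ n * sin (n%:R * y)).
    by apply: eq_bigr => n _; rewrite /P !coef_theta !Re_mulrn; ring.
  have PB : (size P <= size B)%N.
    by apply/leq_sizeP => n /leq_sizeP Bn; rewrite /P !coef_theta Bn// !mul0rn.
  rewrite Re_coef_sin// normrM [X in _ * X]ger0_norm ?invr_ge0// ler_pdivrMr// mulrC.
  apply: normc_Im; apply: le_trans (ler_normB _ _) _.
  have := lerD (PE _ K1) (PE _ K2); rewrite !norm_polar// => /le_trans; apply.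
  by rewrite le_eqVlt; apply/orP; left; apply/eqP; rewrite !real_complexM real_complex_nat; ring.
have KB z : K z -> `|B.[z]| <= (64^-1)%:C.
  move=> Kz; rewrite horner_exp normrX.
  apply: le_trans (_ : _ <= 8^-1 ^+ 2) _.
    apply: le_trans (_ : _ <= 8^-1 ^+ k.+2) _.
      by rewrite lerXn2r ?nnegrE ?invr_ge0 ?KE.
    by apply: ler_wiXn2l; rewrite ?invr_ge0// invf_le1// ler1n.
  by rewrite real_complexV real_complex_nat exprVn -natrX.
have Bw : B.[polar rho y0] = 1 by rewrite horner_exp Ew expr1n.
have cosE r y : \sum_(n < size B) complex.Re B`_n * (r ^+ n * cos (n%:R * y)) =
    complex.Re (B.[polar r y] + B.[polar r (- y)]) / 2 by exact: Re_coef_cos.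
have small r y : K (polar r y) -> K (polar r (- y)) ->
    `|\sum_(n < size B) complex.Re B`_n * (r ^+ n * cos (n%:R * y))| <= 64^-1.
  move=> K1 K2; rewrite cosE normrM [X in _ * X]ger0_norm ?invr_ge0// ler_pdivrMr//.
  apply: normc_Re; apply: le_trans (ler_normD _ _) _.
  apply: le_trans (lerD (KB _ K1) (KB _ K2)) _.
  by rewrite -real_complexD lecR; clear; lra.
have Kpi r : 0 <= r -> r <= b -> K (polar r pi) /\ K (polar r (- pi)).
  move=> r0 rb; split; apply: KP => // _; apply: le_trans hc2.
    by rewrite cosB cospi sinpi mul0r addr0 mulN1r -normrN ler_norm.
  by rewrite cosB cosN sinN cospi sinpi oppr0 mul0r addr0 mulN1r -normrN ler_norm.
have sb : s <= b by clear -srho rhob rho0; lra.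
(* As [s <= rho / 2], no condition on the angle arises, not even at [y0]. *)
have Ks y : K (polar s y) by apply: KP => //; [exact: ltW|clear -srho; lra].
have h1 := small _ _ (Kpi rho (ltW rho0) (ltW rhob)).1 (Kpi rho (ltW rho0) (ltW rhob)).2.
have h2 := small _ _ (Kpi s (ltW s0) sb).1 (Kpi s (ltW s0) sb).2.
have h3 := small _ _ (Ks y0) (Ks (- y0)).
(* The peak contributes 1 and its conjugate at least [- 1/64]; half of the sum exceeds 3/8. The
   three other cosine sums are at most 1/64 in absolute value, which leaves more than 1/4. *)
have h4 : 3 / 8 <= \sum_(n < size B)
    complex.Re B`_n * (rho ^+ n * cos (n%:R * y0)).
  have Kw : K (polar rho (- y0)).
    by apply: KP; [exact: ltW|exact: ltW|rewrite -opprD cosN].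
  have := normc_Re (KB _ Kw); rewrite cosE Bw.
  case: (B.[polar rho (- y0)]) => x x' /=; rewrite ler_norml => /andP[h _].
  by lra.
have -> : \sum_(n < size B) complex.Re B`_n * ((rho ^+ n - s ^+ n) *
      (cos (n%:R * y0) - cos (n%:R * pi)))
  = \sum_(n < size B) complex.Re B`_n * (rho ^+ n * cos (n%:R * y0))
  - \sum_(n < size B) complex.Re B`_n * (rho ^+ n * cos (n%:R * pi))
  - \sum_(n < size B) complex.Re B`_n * (s ^+ n * cos (n%:R * y0))
  + \sum_(n < size B) complex.Re B`_n * (s ^+ n * cos (n%:R * pi)).
  by rewrite -!sumrB -big_split /=; apply: eq_bigr => n _; ring.
move: h1 h2 h3; rewrite !ler_norml => /andP[_ h1] /andP[h2 _] /andP[_ h3].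
by apply: le_trans (ler_norm _); clear -h1 h2 h3 h4; lra.
Qed.

End slit_disc.

(** * Smooth cutoffs *)

Section smooth_line.
Context {R : realType}.
Implicit Types (a b f g : R -> R) (x y c : R).

(* the largest class of differentiable functions closed under derivation *)
Definition smooth1 a := exists2 P : set (R -> R), P a &
  forall f, P f -> exists2 g, (forall x, is_derive x 1 f (g x)) & P g.

Lemma is_derive1E f g : (forall x, is_derive x 1 f (g x)) -> (f^`())%classic = g.
Proof. by move=> fg; apply/funext => x; rewrite derive1E; exact: derive_val. Qed.

Lemma smooth1_derive a : smooth1 a -> exists2 b, (forall x, is_derive x 1 a (b x)) & smooth1 b.
Proof. by move=> [P Pa PP]; have [b ab Pb] := PP a Pa; exists b => //; exists P. Qed.

Lemma smooth1_coind (P : set (R -> R)) :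
  (forall f, P f -> exists2 g, (forall x, is_derive x 1 f (g x)) & P g) ->
  forall a, P a -> smooth1 a.
Proof. by move=> PP a Pa; exists P. Qed.

Lemma smooth1_cst c : smooth1 (cst c).
Proof.
apply: (@smooth1_coind (range (@cst R R))); last by exists c.
by move=> _ [d _ <-]; exists (cst 0); [move=> x; exact: is_derive_cst|exists 0].
Qed.

(** The invariant for the coinduction: the derivative of a product is a sum of products, so neither
    sums nor products alone are stable under derivation. *)
Inductive smooth_algebra : set (R -> R) :=
| smooth_base a : smooth1 a -> smooth_algebra a
| smooth_sum a b : smooth_algebra a -> smooth_algebra b -> smooth_algebra (a \+ b)
| smooth_prod a b : smooth_algebra a -> smooth_algebra b -> smooth_algebra (a \* b).

Lemma smooth_algebra_smooth1 a : smooth_algebra a -> smooth1 a.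
Proof.
apply: smooth1_coind => {}a; elim => {a}.
- by move=> a /smooth1_derive [b ab sb]; exists b => //; exact: smooth_base.
- move=> a b sa [a' aa' sa'] sb [b' bb' sb']; exists (a' \+ b').
    by move=> x; exact: is_deriveD.
  exact: smooth_sum.
- move=> a b sa [a' aa' sa'] sb [b' bb' sb']; exists (a \* b' \+ b \* a').
    by move=> x; exact: is_deriveM.
  by apply: smooth_sum; exact: smooth_prod.
Qed.

Lemma smooth1D a b : smooth1 a -> smooth1 b -> smooth1 (a \+ b).
Proof.
by move=> sa sb; apply: smooth_algebra_smooth1; apply: smooth_sum; exact: smooth_base.
Qed.

Lemma smooth1M a b : smooth1 a -> smooth1 b -> smooth1 (a \* b).
Proof.
by move=> sa sb; apply: smooth_algebra_smooth1; apply: smooth_prod; exact: smooth_base.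
Qed.

Lemma smooth1_id : smooth1 (@idfun R).
Proof.
apply: (@smooth1_coind [set f | f = idfun \/ smooth1 f]); last by left.
move=> f [->|/smooth1_derive [g fg sg]].
  by exists (cst 1); [move=> x; exact: is_derive_id|right; exact: smooth1_cst].
by exists g => //; right.
Qed.

Lemma is_derive_affine f g c y : (forall x, is_derive x 1 f (g x)) ->
  forall x, is_derive x 1 (fun x => f (c * x + y)) (c * g (c * x + y)).
Proof.
move=> fg x; have h1 := fg (c * x + y).
have h2 : is_derive x 1 (fun x => c * x + y) c.
  by apply: is_derive_eq; rewrite /GRing.scale /=; ring.
by rewrite [c * g _]mulrC; exact: is_derive1_comp.
Qed.

Lemma smooth1_affine f c y : smooth1 f -> smooth1 (fun x => f (c * x + y)).
Proof.
move=> sf; apply: (@smooth1_coind [set h | exists g d, smooth1 g /\ h = (fun x => d * g (c * x + y))]).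
  move=> _ [g [d [/smooth1_derive [g' gg' sg'] ->]]].
  exists (fun x => (d * c) * g' (c * x + y)); last by exists g', (d * c).
  move=> x; rewrite -mulrA.
  exact: (@is_deriveZ _ _ _ (fun x => g (c * x + y)) d x 1 _ (is_derive_affine c y gg' x)).
by exists f, 1; split => //; apply/funext => x; rewrite mul1r.
Qed.

Lemma smooth1_expR f : smooth1 f -> smooth1 (expR \o f).
Proof.
move=> sf; have [f' ff' sf'] := smooth1_derive sf.
apply: (@smooth1_coind [set h | exists2 g, smooth1 g & h = g \* (expR \o f)]).
  move=> _ [g sg ->]; have [g' gg' sg'] := smooth1_derive sg.
  exists ((g \* f' \+ g') \* (expR \o f)); last first.
    by exists (g \* f' \+ g') => //; apply: smooth1D => //; exact: smooth1M.
  move=> x.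
  have h : is_derive x 1 (expR \o f) (f' x * expR (f x)).
    by rewrite mulrC; apply: is_derive1_comp.
  apply: is_derive_eq; rewrite /GRing.scale /=; ring.
by exists (cst 1); [exact: smooth1_cst|apply/funext => x; rewrite /= mul1r].
Qed.

Lemma smooth1_sin : smooth1 (@sin R).
Proof.
apply: (@smooth1_coind [set h | exists c d, h = (fun x => c * sin x + d * cos x)]).
  move=> _ [c [d ->]]; exists (fun x => - d * sin x + c * cos x).
    by move=> x; apply: is_derive_eq; rewrite /GRing.scale /=; ring.
  by exists (- d), c.
by exists 1, 0; apply/funext => x; rewrite mul1r mul0r addr0.
Qed.

End smooth_line.

(** * The flat function e^(-1/x) *)

Section flat_function.
Context {R : realType}.
Implicit Types (p : {poly R}) (x w : R).

Lemma powR_le_expR (w : R) n : 0 <= w -> w ^+ n.+1 <= n.+1%:R ^+ n.+1 * expR w.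
Proof.
move=> w0; have n0 : 0 < n.+1%:R :> R by [].
have -> : w ^+ n.+1 = n.+1%:R ^+ n.+1 * (w / n.+1%:R) ^+ n.+1.
  by rewrite -exprMn mulrCA divff ?mulr1// gt_eqF.
have -> : expR w = expR (w / n.+1%:R) ^+ n.+1.
  by rewrite -expRM_natl mulrCA divff ?mulr1// gt_eqF.
rewrite ler_wpM2l ?exprn_ge0// lerXn2r ?nnegrE ?divr_ge0 ?expR_ge0//.
by apply: le_trans (expR_ge1Dx _); rewrite lerDr.
Qed.

Lemma horner_le_expR p : exists C, forall w, 0 <= w -> `|p.[w]| <= C * expR w.
Proof.
have expn k : exists C : R, 0 <= C /\ forall w, 0 <= w -> w ^+ k <= C * expR w.
  case: k => [|n]; last first.
    exists (n.+1%:R ^+ n.+1); split; first exact: exprn_ge0.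
    by move=> w; exact: powR_le_expR.
  exists 1; split => // w w0; rewrite expr0 mul1r.
  by apply: le_trans (expR_ge1Dx _); rewrite lerDl.
pose C k := projT1 (cid (expn k)).
have CP k w : 0 <= w -> w ^+ k <= C k * expR w.
  by move=> w0; have [_] := projT2 (cid (expn k)); apply.
exists (\sum_(i < size p) `|p`_i| * C i) => w w0.
rewrite horner_coef mulr_suml; apply: le_trans (ler_norm_sum _ _ _) _.
apply: ler_sum => i _; rewrite normrM -mulrA ler_wpM2l// normrX ger0_norm//.
exact: CP.
Qed.

(** The polynomial parameter makes the family stable under derivation, with [p] going to
    ['X^2 * (p - deriv p)]; smoothness then follows by coinduction. *)
Definition flatp p x := if 0 < x then p.[x^-1] * expR (- x^-1) else 0.

(** With [w = 1 / x] this is the domination of [w ^ 2 p(w)] by [e ^ w]. The quadratic bound makes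
    the difference quotient at 0 vanish in the limit. *)
Lemma flatp_le p : exists C, forall x, `|flatp p x| <= C * x ^+ 2.
Proof.
have [C hC] := horner_le_expR (p * 'X^2).
have C0 : 0 <= C.
  by have := hC 0 (lexx _); rewrite expR0 mulr1; apply: le_trans.
exists C => x; rewrite /flatp; case: ifPn => x0; last first.
  by rewrite normr0 mulr_ge0 ?sqr_ge0.
have := hC x^-1; rewrite invr_ge0 => /(_ (ltW x0)).
rewrite hornerM hornerXn normrM [`|x^-1 ^+ 2|]ger0_norm; last first.
  by rewrite exprn_ge0 ?invr_ge0// ltW.
rewrite normrM [`|expR _|]ger0_norm ?expR_ge0// => h.
rewrite expRN -ler_pdivlMr ?invr_gt0 ?expR_gt0// invrK mulrAC.
by rewrite -ler_pdivrMr ?exprn_gt0// -exprVn.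
Qed.

Lemma is_derive_flatp p x :
  is_derive x 1 (flatp p) (flatp ('X^2 * (p - deriv p)) x).
Proof.
have [x0|x0|->] := ltgtP x 0.
- have -> : flatp ('X^2 * (p - deriv p)) x = 0 by rewrite /flatp ltNge (ltW x0).
  apply: near_eq_is_derive (is_derive_cst 0 x 1).
  near=> y; rewrite /flatp ifF//; apply/negbTE; rewrite -leNgt.
  by apply: ltW; near: y; exact: lt_nbhsl.
- have xN0 : x != 0 by rewrite gt_eqF.
  have -> : flatp ('X^2 * (p - deriv p)) x =
      x^-1 ^+ 2 * (p.[x^-1] - (deriv p).[x^-1]) * expR (- x^-1).
    by rewrite /flatp x0 hornerM hornerXn hornerD hornerN.
  have nE : \near x, p.[x^-1] * expR (- x^-1) = flatp p x.
    near=> y; rewrite /flatp ifT//; near: y; exact: lt_nbhsr.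
  apply: near_eq_is_derive nE _.
  have dV : is_derive x 1 (fun y : R => y^-1) (- x ^- 2).
    have := @is_deriveV R (@idfun R) x 1 1 xN0 (is_derive_id _ _).
    by rewrite /GRing.scale /= mulr1.
  have d1 : is_derive x 1 (fun y => p.[y^-1]) ((deriv p).[x^-1] * - x ^- 2).
    exact: is_derive1_comp.
  have d2 : is_derive x 1 (fun y => expR (- y^-1)) (expR (- x^-1) * x ^- 2).
    have h : is_derive x 1 (fun y : R => - y^-1) (- - x ^- 2) by exact: is_deriveN.
    by rewrite -[x ^- 2]opprK; exact: is_derive1_comp.
  apply: is_derive_eq (is_deriveM d1 d2) _.
  rewrite /GRing.scale /= exprVn; ring.
- have [C hC] := flatp_le p.
  have f0 q : flatp q 0 = 0 by rewrite /flatp ltxx.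
  rewrite f0.
  have lim : h^-1 *: (flatp p (h *: 1 + 0) - flatp p 0) @[h --> 0^'] --> 0.
    have C0 : 0 <= C by have := hC 1; rewrite expr1n mulr1; apply: le_trans.
    apply/cvgrPdist_le => e e0; near=> h.
    have h0 : h != 0 by near: h; exact: nbhs_dnbhs_neq.
    rewrite f0 subr0 sub0r normrN addr0 normrM normfV.
    rewrite ler_pdivrMl ?normr_gt0// [h *: 1]mulr1.
    apply: le_trans (hC h) _; rewrite -real_normK ?num_real// expr2 mulrCA.
    rewrite ler_wpM2l//.
    have : `|h| <= e / (C + 1).
      by near: h; apply: dnbhs0_le; apply: divr_gt0 => //; exact: ltr_wpDl.
    rewrite ler_pdivlMr ?ltr_wpDl// => he.
    by apply: le_trans he; rewrite mulrC ler_wpM2l// lerDl.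
  apply: DeriveDef; first by apply/cvg_ex; exists 0.
  exact: cvg_lim lim.
Unshelve. all: by end_near. Qed.

Lemma smooth1_flatp p : smooth1 (flatp p).
Proof.
apply: (@smooth1_coind _ (range flatp)); last by exists p.
move=> _ [q _ <-]; exists (flatp ('X^2 * (q - deriv q))); last by eexists.
by move=> x; exact: is_derive_flatp.
Qed.

Definition flat := flatp 1.
Definition dflat := flatp 'X^2.

Lemma is_derive_flat x : is_derive x 1 flat (dflat x).
Proof. by have := is_derive_flatp 1 x; rewrite -polyC1 derivC subr0 mulr1. Qed.

Lemma smooth1_flat : smooth1 flat. Proof. exact: smooth1_flatp. Qed.

Lemma flat_le0 x : x <= 0 -> flat x = 0.
Proof. by rewrite /flat /flatp leNgt; case: ifP. Qed.

Lemma flat_ge0 x : 0 <= flat x.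
Proof. by rewrite /flat /flatp; case: ifP => //; rewrite hornerC mul1r expR_ge0. Qed.

Lemma flat_le1 x : flat x <= 1.
Proof.
rewrite /flat /flatp; case: ifP => // x0.
by rewrite hornerC mul1r expR_le1 oppr_le0 invr_ge0 ltW.
Qed.

Lemma dflat_ge0 x : 0 <= dflat x.
Proof.
rewrite /dflat /flatp; case: ifP => // x0.
by rewrite hornerXn mulr_ge0 ?expR_ge0 ?sqr_ge0.
Qed.

Lemma sqr_expRN_le w : 0 <= w -> w ^+ 2 * expR (- w) <= 2.
Proof.
move=> w0; rewrite expRN ler_pdivrMr ?expR_gt0//.
have := expR_ge1Dxn 1 w0; rewrite /= => h.
by apply: le_trans (_ : 2 * (1 + w ^+ 2 / 2) <= _); [lra|rewrite ler_wpM2l].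
Qed.

Lemma dflat_le2 x : dflat x <= 2.
Proof.
rewrite /dflat /flatp; case: ifP => // x0.
by rewrite hornerXn sqr_expRN_le// invr_ge0 ltW.
Qed.

(** At [x = N * y - 1] the left-hand side is [y] times the derivative of [flat (N * y - 1)]: a
    cutoff at scale [1 / N] has slope at most a constant over the distance to the end, uniformly in
    [N]. *)
Lemma dflat_moment x : (x + 1) * dflat x <= 3.
Proof.
rewrite /dflat /flatp; case: ifP => [x0|_]; last by rewrite mulr0.
rewrite hornerXn; have xN0 : x != 0 by rewrite gt_eqF.
have w0 : 0 <= x^-1 by rewrite invr_ge0 ltW.
have -> : (x + 1) * (x^-1 ^+ 2 * expR (- x^-1)) =
  x^-1 * expR (- x^-1) + x^-1 ^+ 2 * expR (- x^-1) by field.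
have := sqr_expRN_le w0; set s := _ * expR _; set r := _ * expR _ => h.
suff : r <= 1 by lra.
rewrite /r expRN ler_pdivrMr ?expR_gt0// mul1r.
by apply: le_trans (expR_ge1Dx _); rewrite lerDr.
Qed.

Lemma flat_cvg1 : flat x @[x --> +oo] --> (1 : R).
Proof.
apply/cvgrPdist_le => e e0; near=> x.
have x0 : 0 < x by near: x; exact: nbhs_pinfty_gt.
rewrite ger0_norm ?subr_ge0 ?flat_le1// /flat /flatp x0 hornerC mul1r.
have := expR_ge1Dx (- x^-1) => h.
suff : x^-1 <= e by lra.
by rewrite -[e]invrK lef_pV2 ?posrE ?invr_gt0.
Unshelve. all: by end_near. Qed.

Lemma dflat_moment_cvg0 : (x + 1) * dflat x @[x --> +oo] --> (0 : R).
Proof.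
apply/cvgrPdist_le => e e0; near=> x.
have x0 : 0 < x by near: x; exact: nbhs_pinfty_gt.
have x1 : 1 <= x by near: x; apply: nbhs_pinfty_ge; rewrite num_real.
have xN0 : x != 0 by rewrite gt_eqF.
rewrite sub0r normrN ger0_norm ?mulr_ge0 ?dflat_ge0//; last by lra.
rewrite /dflat /flatp x0 hornerXn.
apply: le_trans (_ : (x + 1) * x^-1 ^+ 2 <= _).
  rewrite ler_wpM2l ?ler_piMr ?sqr_ge0//; first lra.
  by rewrite expR_le1 oppr_le0 invr_ge0 ltW.
apply: le_trans (_ : 2 * x^-1 <= _).
  have -> : (x + 1) * x^-1 ^+ 2 = ((x + 1) / x) * x^-1 by field.
  rewrite ler_wpM2r ?invr_ge0 ?(ltW x0)// ler_pdivrMr//; lra.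
by rewrite ler_pdivrMr// mulrC -ler_pdivrMr//.
Unshelve. all: by end_near. Qed.

End flat_function.

(** * Integration on the strip and on the cylinder *)

Section restricted_measure.
Context d (T : measurableType d) (R : realType).
Variables (mu : {measure set T -> \bar R}) (D : set T) (mD : measurable D).
Local Open Scope ereal_scope.

Lemma ge0_integral_mrestr (f : T -> \bar R) : (forall x, 0 <= f x) ->
  measurable_fun [set: T] f ->
  \int[mrestr mu mD]_x f x = \int[mu]_(x in D) f x.
Proof.
move=> f0 mf.
have mfD : measurable_fun D f by exact: measurable_funTS.
have mDC : measurable (~` D) by exact: measurableC.
(* On subsets of [D] the measure is the sum of its two restrictions, and the second one gives [D]
   mass zero. *)
transitivity (\int[measure_add (mrestr mu mD) (mrestr mu mDC)]_(x in D) f x);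
    last first.
  apply: eq_measure_integral => A mA AD.
  transitivity (mrestr mu mD A + mrestr mu mDC A).
    exact: measure_addE.
  by rewrite /= /mrestr (setIidl AD) -setDE (_ : A `\` D = set0) ?measure0 ?adde0// setD_eq0.
rewrite ge0_integral_measure_add//.
rewrite [X in _ = _ + X](_ : _ = 0) ?adde0; last first.
  by apply: null_set_integral => //; rewrite /= /mrestr setICr measure0.
transitivity (\int[mrestr mu mD]_(x in D `|` ~` D) f x); first by rewrite setUv.
rewrite ge0_integral_setU ?setUv//; last exact/disj_setPCl.
rewrite [X in _ + X = _](_ : _ = 0) ?adde0//.
apply: null_set_integral => //; [exact: measurable_funTS|by rewrite /= /mrestr setICl measure0].
Qed.

Lemma integral_mrestr (f : T -> \bar R) : measurable_fun [set: T] f ->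
  \int[mrestr mu mD]_x f x = \int[mu]_(x in D) f x.
Proof.
move=> mf; rewrite [LHS]integralE [RHS]integralE.
by rewrite !ge0_integral_mrestr//; [exact: measurable_funeneg|exact: measurable_funepos].
Qed.

End restricted_measure.

Lemma integrable_mrestr d (T : measurableType d) (R : realType)
    (mu : {measure set T -> \bar R}) (D : set T) (mD : measurable D)
    (f : T -> \bar R) : measurable_fun [set: T] f ->
  (mrestr mu mD).-integrable setT f <-> mu.-integrable D f.
Proof.
move=> mf; have mabs : measurable_fun [set: T] (abse \o f) by exact: measurableT_comp.
have E := integral_mrestr mu mD mabs.
split=> /integrableP[_ fi]; apply/integrableP; split => //.
- exact: measurable_funTS.
- by move: fi; rewrite E.
- by rewrite E.
Qed.

Section restricted_fubini.
Local Open Scope ereal_scope.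
Context d1 d2 (T1 : measurableType d1) (T2 : measurableType d2) (R : realType).
Variables (m1 : {sigma_finite_measure set T1 -> \bar R}).
Variables (m2 : {sigma_finite_measure set T2 -> \bar R}).

Lemma product_measure12E (A : set (T1 * T2)) : measurable A ->
  (m1 \x^ m2) A = (m1 \x m2) A.
Proof.
move=> mA; apply/esym.
by apply: product_measure_unique => // X Y mX mY; rewrite /= product_measure2E.
Qed.

Variables (D1 : set T1) (D2 : set T2).
Hypotheses (mD1 : measurable D1) (mD2 : measurable D2) (mD : measurable (D1 `*` D2)).

Let slice1 (f : T1 * T2 -> \bar R) x : (fun y => (f \_ (D1 `*` D2)) (x, y)) =
  if x \in D1 then (fun y => f (x, y)) \_ D2 else cst 0.
Proof.
apply/funext => y; rewrite /patch in_setX /=.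
by case: (x \in D1) => //=; case: ifP.
Qed.

Let slice2 (f : T1 * T2 -> \bar R) y : (fun x => (f \_ (D1 `*` D2)) (x, y)) =
  if y \in D2 then (fun x => f (x, y)) \_ D1 else cst 0.
Proof.
apply/funext => x; rewrite /patch in_setX /= andbC.
by case: (y \in D2) => //=; case: ifP.
Qed.

Let inner1 (f : T1 * T2 -> \bar R) :
  (fun x => \int[m2]_y (f \_ (D1 `*` D2)) (x, y)) =
  (fun x => \int[m2]_(y in D2) f (x, y)) \_ D1.
Proof.
apply/funext => x; rewrite slice1 [RHS]patchE; case: ifP => // _.
  by rewrite -integral_mkcond.
exact: integral0.
Qed.

Let inner2 (f : T1 * T2 -> \bar R) :
  (fun y => \int[m1]_x (f \_ (D1 `*` D2)) (x, y)) =
  (fun y => \int[m1]_(x in D1) f (x, y)) \_ D2.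
Proof.
apply/funext => y; rewrite slice2 [RHS]patchE; case: ifP => // _.
  by rewrite -integral_mkcond.
exact: integral0.
Qed.

Lemma restricted_fubini (f : T1 * T2 -> \bar R) :
  (mrestr (m1 \x m2) mD).-integrable setT f ->
  [/\ \int[mrestr (m1 \x m2) mD]_z f z = \int[m1]_(x in D1) \int[m2]_(y in D2) f (x, y),
      \int[mrestr (m1 \x m2) mD]_z f z = \int[m2]_(y in D2) \int[m1]_(x in D1) f (x, y),
      m1.-integrable D1 (fun x => \int[m2]_(y in D2) f (x, y)) &
      {ae m1, forall x, D1 x -> m2.-integrable D2 (fun y => f (x, y))}].
Proof.
move=> fi; have mf := measurable_int _ fi.
have fDi : (m1 \x m2).-integrable setT (f \_ (D1 `*` D2)).
  exact: (integrable_mkcond _ mD).1 ((integrable_mrestr (m1 \x m2) mD mf).1 fi).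
rewrite integral_mrestr// integral_mkcond; split.
- by have h := integral12_prod_meas1 fDi; rewrite -h /fubini_F inner1 [RHS]integral_mkcond.
- by have h := integral21_prod_meas1 fDi; rewrite -h /fubini_G inner2 [RHS]integral_mkcond.
- apply: (integrable_mkcond _ mD1).2; rewrite -inner1; exact: integrable_fubini_F.
- apply: filterS (ae_integrable1 fDi) => x; rewrite slice1 => + D1x.
  by rewrite mem_set// => h; exact: (integrable_mkcond _ mD2).2.
Qed.

Lemma restricted_tonelli (f : T1 * T2 -> \bar R) : measurable_fun [set: T1 * T2] f ->
  \int[m1]_(x in D1) \int[m2]_(y in D2) `|f (x, y)| < +oo ->
  (mrestr (m1 \x m2) mD).-integrable setT f.
Proof.
move=> mf fi; apply: (integrable_mrestr (m1 \x m2) mD mf).2.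
apply: (integrable_mkcond _ mD).2.
have mfD : measurable_fun setT (f \_ (D1 `*` D2)).
  by apply: (measurable_restrictT _ mD).1; exact: measurable_funTS.
apply: (integrable12ltyP m1 m2 mfD).2.
have -> : (fun x => \int[m2]_y `|(f \_ (D1 `*` D2)) (x, y)|) =
    (fun x => \int[m2]_(y in D2) `|f (x, y)|) \_ D1.
  rewrite -(inner1 (abse \o f)); apply/funext => x; apply: eq_integral => y _.
  by rewrite /patch; case: ifP => // _; rewrite abse0.
by rewrite -integral_mkcond.
Qed.

End restricted_fubini.

(** [leb2] is declared as a bare measure. Carrying the proof of sigma-finiteness in the type of the
    alias lets a sigma-finite structure be attached, as Fubini requires. *)
Definition sigma_finite_alias d (T : measurableType d) (R : realType)
    (m : {measure set T -> \bar R}) of sigma_finite setT m : set T -> \bar R := m.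

Section sigma_finite_alias.
Context d (T : measurableType d) (R : realType) (m : {measure set T -> \bar R}).
Hypothesis ms : sigma_finite setT m.

HB.instance Definition _ := Measure.on (sigma_finite_alias ms).

HB.instance Definition _ := Measure_isSigmaFinite.Build _ _ _ (sigma_finite_alias ms) ms.

End sigma_finite_alias.

Section restricted_fubini_swapped.
Local Open Scope ereal_scope.
Context d1 d2 (T1 : measurableType d1) (T2 : measurableType d2) (R : realType).
Variables (m1 : {sigma_finite_measure set T1 -> \bar R}).
Variables (m2 : {measure set T2 -> \bar R}) (m2s : sigma_finite setT m2).
Variables (D1 : set T1) (D2 : set T2).
Hypotheses (mD1 : measurable D1) (mD2 : measurable D2) (mD : measurable (D1 `*` D2)).

Lemma restricted_fubini_swapped (f : T1 * T2 -> \bar R) :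
  (mrestr (m1 \x^ m2) mD).-integrable setT f ->
  [/\ \int[mrestr (m1 \x^ m2) mD]_z f z = \int[m1]_(x in D1) \int[mrestr m2 mD2]_y f (x, y),
      m1.-integrable D1 (fun x => \int[mrestr m2 mD2]_y f (x, y)) &
      {ae m1, forall x, D1 x -> (mrestr m2 mD2).-integrable setT (fun y => f (x, y))}].
Proof.
pose s2 : {sigma_finite_measure set T2 -> \bar R} :=
  sigma_finite_alias m2s.
have E (A : set (T1 * T2)) : measurable A ->
    mrestr (m1 \x^ m2) mD A = mrestr (m1 \x s2) mD A.
  move=> mA; rewrite /mrestr /=; apply: (product_measure12E m1 s2).
  exact: measurableI.
move=> /[dup] fi /integrableP[mf fi'].
have fs : (mrestr (m1 \x s2) mD).-integrable setT f.
  apply/integrableP; split => //; apply: le_lt_trans fi'.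
  rewrite le_eqVlt; apply/orP; left; apply/eqP.
  by apply: eq_measure_integral => A mA _; exact/esym/E.
have inner : (fun x => \int[mrestr m2 mD2]_y f (x, y)) =
    (fun x => \int[s2]_(y in D2) f (x, y)).
  apply/funext => x; rewrite integral_mrestr//.
  exact: measurableT_comp.
have [h1 _ h2 h3] := restricted_fubini mD1 mD2 fs.
split; rewrite ?inner//.
- rewrite -h1; apply: eq_measure_integral => A mA _; exact: E.
- apply: filterS h3 => x h D1x; apply: (integrable_mrestr m2 mD2 _).2 (h D1x).
  exact: measurableT_comp.
Qed.

End restricted_fubini_swapped.

Section grushin_measures.
Context {R : realType}.
Local Notation bR := (measurableTypeR R).
Local Notation plane := (R * R)%type.
Local Notation leb := (@lebesgue_measure R).
Implicit Types (a b : R).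

Lemma sigma_finite_product d1 d2 (T1 : measurableType d1) (T2 : measurableType d2)
    (m1 : {sigma_finite_measure set T1 -> \bar R})
    (m2 : {sigma_finite_measure set T2 -> \bar R}) :
  sigma_finite setT (m1 \x m2)%E.
Proof.
have /sigma_finiteP[F [FT ndF Ffin]] := sigma_finiteT m1.
have /sigma_finiteP[G [GT ndG Gfin]] := sigma_finiteT m2.
exists (fun n => F n `*` G n) => [|n].
  apply/seteqP; split => // -[x y] _.
  have [i _ Fx] : (\bigcup_i F i) x by rewrite -FT.
  have [j _ Gy] : (\bigcup_j G j) y by rewrite -GT.
  exists (maxn i j) => //; split.
    by have /subsetPset := ndF _ _ (leq_maxl i j); apply.
  by have /subsetPset := ndG _ _ (leq_maxr i j); apply.
have [mF Fn] := Ffin n; have [mG Gn] := Gfin n.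
split; first exact: measurableX.
by rewrite product_measure1E// lte_mul_pinfty// ge0_fin_numE.
Qed.

Lemma muOmega_fubini (f : plane -> \bar R) : muOmega.-integrable setT f ->
  (\int[muOmega]_z f z = \int[leb]_x \int[leb]_(y in `]0%R, pi[) f (x, y))%E /\
  (\int[muOmega]_z f z = \int[leb]_(y in `]0%R, pi[) \int[leb]_x f (x, y))%E.
Proof.
have mI : measurable (`]0, pi[ : set bR) by [].
move=> fi; have [h1 h2 _ _] := @restricted_fubini _ _ bR bR R leb leb setT `]0, pi[
  measurableT mI measurable_Omega f fi.
exact (conj h1 h2).
Qed.

Lemma muOmega_tonelli (f : plane -> \bar R) : measurable_fun [set: bR * bR] f ->
  (\int[leb]_x \int[leb]_(y in `]0%R, pi[) `|f (x, y)| < +oo)%E ->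
  muOmega.-integrable setT f.
Proof.
exact: (@restricted_tonelli _ _ bR bR R leb leb setT `]0, pi[ measurable_Omega).
Qed.

Lemma mucyl_fubini T (f : R * plane -> \bar R) : (mucyl T).-integrable setT f ->
  [/\ (\int[mucyl T]_p f p =
        \int[leb]_(t in `]0%R, T[) \int[muOmega]_z f (t, z))%E,
      leb.-integrable `]0, T[ (fun t => \int[muOmega]_z f (t, z))%E &
      {ae leb, forall t, t \in `]0, T[ ->
         muOmega.-integrable setT (fun z => f (t, z))}].
Proof.
have mI : measurable (`]0, T[ : set bR) by [].
have ms : sigma_finite setT (leb2 : {measure set (bR * bR) -> \bar R}).
  exact: (@sigma_finite_product _ _ bR bR leb leb).
exact: (@restricted_fubini_swapped _ _ bR _ R leb leb2 ms `]0, T[ Omega mI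
  measurable_Omega (measurable_cylinder T)).
Qed.

(* An open set of the plane is a countable union of rational boxes. *)
Lemma open_measurable_plane (A : set plane) : open A -> measurable (A : set (bR * bR)).
Proof.
move=> oA.
pose box (q : rat * rat * (rat * rat)) : set (bR * bR) :=
  `]ratr q.1.1, ratr q.1.2[ `*` `]ratr q.2.1, ratr q.2.2[.
have mbox q : measurable (box q) by exact: measurableX.
pose G (k : nat) : set (bR * bR) := if unpickle k is Some q then
  (if `[< box q `<=` A >] then box q else set0) else set0.
rewrite (_ : A = \bigcup_k G k); last first.
  apply/seteqP; split => [[x y] Axy|z [k _]]; last first.
    by rewrite /G; case: unpickle => // q; case: asboolP => // qA /qA.
  have /nbhs_ballP[e /= e0 eA] := open_nbhs_nbhs (conj oA Axy).
  have rat2 (c : R) : exists q : rat * rat,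
      [/\ c - e < ratr q.1, ratr q.1 < c, c < ratr q.2 & ratr q.2 < c + e].
    have h1 : c - e < c by lra.
    have h2 : c < c + e by lra.
    have [q1] := rat_in_itvoo h1; rewrite in_itv /= => /andP[? ?].
    have [q2] := rat_in_itvoo h2; rewrite in_itv /= => /andP[? ?].
    by exists (q1, q2).
  have [qx [? ? ? ?]] := rat2 x; have [qy [? ? ? ?]] := rat2 y.
  exists (pickle (qx, qy)); first exact: I.
  rewrite /G pickleK.
  have -> : `[< box (qx, qy) `<=` A >].
    apply/asboolP => -[x' y'] [] /=; rewrite ?in_itv /= => /andP[? ?] /andP[? ?].
    by apply: eA; split; rewrite /ball /= ltr_distlC; apply/andP; split; lra.
  by split; rewrite /= in_itv /=; apply/andP.
apply: bigcupT_measurable => k; rewrite /G; case: unpickle => // q.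
by case: ifP => // _; exact: mbox.
Qed.

Lemma continuous_measurable_plane (h : plane -> R) : continuous h ->
  measurable_fun [set: bR * bR] h.
Proof.
move=> ch; apply: (measurability _ (RGenOpens.measurableE R)) => //.
move=> _ [_ [a [b ->] <-]]; rewrite setTI.
by apply: open_measurable_plane; apply: open_comp => // z _; exact: ch.
Qed.

End grushin_measures.

(** * Inner products and convergence in L^2 *)

Section square_integrable.
Context d (T : measurableType d) (R : realType).
Variable mu : {measure set T -> \bar R}.
Implicit Types f g : T -> R.

Lemma Lnorm2E f :
  ('N[mu]_(2%:E)[EFin \o f] = (\int[mu]_x (f x ^+ 2)%:E) `^ (2^-1))%E.
Proof.
rewrite unlock; congr poweR; apply: eq_integral => x _ /=.
by rewrite powR_mulrn// real_normK ?num_real.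
Qed.

Lemma Lfun2_measurable f : f \in Lfun mu 2%:E -> measurable_fun [set: T] f.
Proof. by rewrite inE => /andP[]; rewrite inE. Qed.

Lemma Lfun2P f : f \in Lfun mu 2%:E <->
  measurable_fun [set: T] f /\ mu.-integrable setT (fun x => (f x ^+ 2)%:E).
Proof.
split=> [fL2|[mf /integrableP[_ fi]]].
  by split; [exact: Lfun2_measurable|exact: Lfun2_integrable_sqr].
rewrite inE; apply/andP; split; rewrite inE//= /finite_norm Lnorm2E.
apply: poweR_lty; apply: le_lt_trans fi.
by rewrite le_eqVlt; apply/orP; left; apply/eqP; apply: eq_integral => x _ /=;
   rewrite ger0_norm ?sqr_ge0.
Qed.

Lemma integrable_mul f g : f \in Lfun mu 2%:E -> g \in Lfun mu 2%:E ->
  mu.-integrable setT (fun x => (f x * g x)%:E).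
Proof.
by move=> fL2 gL2; apply/(Lfun1_integrable mu (f \* g))/Lfun2_mul_Lfun1.
Qed.

Lemma Lfun2_sub f g : f \in Lfun mu 2%:E -> g \in Lfun mu 2%:E ->
  f \- g \in Lfun mu 2%:E.
Proof.
move=> fL2 gL2; apply: (@rpredB _ (Lfun mu 2%:E)) => //; by rewrite lee_fin ler1n.
Qed.

Lemma cauchy_schwarz f g : f \in Lfun mu 2%:E -> g \in Lfun mu 2%:E ->
  (`|\int[mu]_x (f x * g x)|%:E <=
   'N[mu]_(2%:E)[EFin \o f] * 'N[mu]_(2%:E)[EFin \o g])%E.
Proof.
move=> fL2 gL2; have fg := integrable_mul fL2 gL2.
have h := @hoelder _ T R mu f g 2 2 (Lfun2_measurable fL2) (Lfun2_measurable gL2).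
apply: le_trans (h _ _ _) => //; last by rewrite [RHS]splitr !div1r.
rewrite Lnorm1; apply: le_trans (_ : _ <= (\int[mu]_x `|f x * g x|)%:E)%E _.
  by rewrite lee_fin le_normr_Rintegral.
rewrite /Rintegral fineK//.
by have /integrable_norm := fg; exact: integrable_fin_num.
Qed.

Lemma Lnorm2_fin f : f \in Lfun mu 2%:E -> 'N[mu]_(2%:E)[EFin \o f]%E \is a fin_num.
Proof.
rewrite inE => /andP[_]; rewrite inE/= /finite_norm => h.
by rewrite ge0_fin_numE// Lnorm_ge0.
Qed.

(** A general filter serves two uses: sequences of test functions, and times tending to [t] within
    [[0, T]]. *)
Lemma cvg_inner {I : Type} {F : set_system I} {FF : Filter F}
    (f_ : I -> T -> R) f g :
  (\forall i \near F, f_ i \in Lfun mu 2%:E) -> f \in Lfun mu 2%:E ->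
  g \in Lfun mu 2%:E ->
  'N[mu]_(2%:E)[EFin \o (f_ i \- f)%R]%E @[i --> F] --> 0%E ->
  (fun i => (\int[mu]_x (f_ i x * g x))%R) @ F --> (\int[mu]_x (f x * g x))%R.
Proof.
move=> fiL2 fL2 gL2 cvg0; apply/cvgrPdist_le => e e0.
pose M := fine 'N[mu]_(2%:E)[EFin \o g]%E + 1.
have M0 : 0 < M by rewrite ltr_wpDl// fine_ge0// Lnorm_ge0.
have eM : 0 < e / M by exact: divr_gt0.
have small : \forall i \near F, ('N[mu]_(2%:E)[EFin \o (f_ i \- f)%R] <= (e / M)%:E)%E.
  have /fine_cvgP[fin] := cvg0; move/cvgrPdist_le => /(_ _ eM) h.
  near=> i; rewrite -[leLHS]fineK; last by near: i.
  rewrite lee_fin; have : `|0 - fine 'N[mu]_(2%:E)[EFin \o (f_ i \- f)%R]%E| <= e / M.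
    by near: i.
  by apply: le_trans; rewrite sub0r normrN ler_norm.
near=> i.
have fi : f_ i \in Lfun mu 2%:E by near: i.
rewrite distrC -RintegralB//; [|exact: integrable_mul..].
have := cauchy_schwarz (Lfun2_sub fi fL2) gL2.
under eq_Rintegral do rewrite /= mulrBl.
move=> h; rewrite -lee_fin; apply: le_trans h _.
apply: le_trans (_ : _ <= (e / M)%:E * M%:E)%E _; last first.
  by rewrite -EFinM divfK// gt_eqF.
apply: lee_pmul; rewrite ?Lnorm_ge0//; first by near: i.
by rewrite -[leLHS]fineK ?Lnorm2_fin// lee_fin /M lerDl.
Unshelve. all: by end_near. Qed.

Lemma cvg_Lnorm2_0 (f_ : nat -> T -> R) :
  (\int[mu]_x (f_ n x ^+ 2)%:E @[n --> \oo] --> 0)%E ->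
  ('N[mu]_(2%:E)[EFin \o f_ n] @[n --> \oo] --> 0)%E.
Proof.
move=> h; under eq_fun do rewrite Lnorm2E.
apply/fine_cvgP; move/fine_cvgP : h => [fin /cvgrPdist_le h]; split.
  near=> n.
  have fi : (\int[mu]_x (f_ n x ^+ 2)%:E)%E \is a fin_num by near: n.
  by rewrite -(fineK fi).
apply/cvgrPdist_le => e e0; have e20 : 0 < e ^+ 2 by exact: exprn_gt0.
have {}h := h _ e20; near=> n.
have fi : (\int[mu]_x (f_ n x ^+ 2)%:E)%E \is a fin_num by near: n.
have i0 : 0 <= fine (\int[mu]_x (f_ n x ^+ 2)%:E)%E.
  by rewrite fine_ge0// integral_ge0// => x _; rewrite lee_fin sqr_ge0.
rewrite sub0r normrN /= -(fineK fi) /= powR12_sqrt// ger0_norm ?sqrtr_ge0//.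
rewrite -[e]gtr0_norm// -sqrtr_sqr ler_wsqrtr//.
have : `|0 - fine (\int[mu]_x (f_ n x ^+ 2)%:E)%E| <= e ^+ 2 by near: n.
by rewrite sub0r normrN ger0_norm.
Unshelve. all: by end_near. Qed.

End square_integrable.

(** * A Gaussian majorant on the strip *)

Section gaussian_weight.
Context {R : realType}.
Local Notation bR := (measurableTypeR R).
Local Notation plane := (R * R)%type.
Local Notation leb := (@lebesgue_measure R).
Implicit Types (h : plane -> R) (x C : R).

(** A common integrable majorant for the modes with [n >= 1]: the gap between 1/8 and [n / 2] leaves
    room to absorb a factor [|x|]. Up to normalisation it is the normal density of standard
    deviation 2. *)
Definition gweight x := expR (- x ^+ 2 / 8).

Lemma gweight_gt0 x : 0 < gweight x. Proof. exact: expR_gt0. Qed.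

Lemma gweight_le1 x : gweight x <= 1.
Proof. by rewrite expR_le1 mulNr oppr_le0 divr_ge0// sqr_ge0. Qed.

Lemma gweight_bound M x : `|x| <= M -> 1 <= expR (M ^+ 2 / 8) * gweight x.
Proof.
move=> xM; rewrite -expRD -[leLHS]expR0 ler_expR -mulrDl divr_ge0// subr_ge0.
by rewrite -real_normK ?num_real// lerXn2r ?nnegrE// (le_trans _ xM).
Qed.

Lemma integrable_gweight : leb.-integrable setT (fun x => (gweight x)%:E).
Proof.
have h := integrableZl measurableT (normal_peak 2)^-1 (@integrable_normal_pdf R 0 2).
apply: eq_integrable h => // x _; rewrite -EFinM; congr EFin.
rewrite normal_pdfE ?gt_eqF// mulrA mulVf ?mul1r; last first.
  by rewrite gt_eqF// normal_peak_gt0// gt_eqF.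
rewrite /normal_fun /gweight subr0; congr (expR (_ / _)).
by rewrite -mulr_natr expr2; ring.
Qed.

Lemma continuous_gweight : continuous gweight.
Proof.
move=> x; apply: (@continuous_comp _ _ _ (fun x : R => - x ^+ 2 / 8) expR).
  by apply/differentiable_continuous/derivable1_diffP.
exact: continuous_expR.
Qed.

Lemma measurable_gweight : measurable_fun [set: bR * bR] (fun z : plane => gweight z.1).
Proof.
apply: (@continuous_measurable_plane R) => z.
by apply: continuous_comp; [exact: cvg_fst|exact: continuous_gweight].
Qed.

Lemma integrable_gweight_plane :
  muOmega.-integrable setT (fun z : plane => (gweight z.1)%:E).
Proof.
have mg := (measurable_EFinP setT _).2 measurable_gweight.
apply: muOmega_tonelli; first exact: mg.
have -> : (fun x : R => \int[leb]_(y in `]0%R, pi[) `|(gweight (x, y).1)%:E|)%E =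
    (fun x => (gweight x)%:E * pi%:E)%E.
  apply/funext => x; rewrite /= integral_cst//= ger0_norm ?(ltW (gweight_gt0 _))//.
  by rewrite lebesgue_measure_itv /= lte_fin pi_gt0 oppr0 adde0.
rewrite (integralZr measurableT integrable_gweight).
have fin := integrable_fin_num measurableT integrable_gweight.
by rewrite -(fineK fin) -EFinM ltry.
Qed.

Lemma weighted_integrable h C : measurable_fun [set: bR * bR] h ->
  (forall z, Omega z -> `|h z| <= C * gweight z.1) ->
  muOmega.-integrable setT (fun z => (h z)%:E).
Proof.
move=> mh hC.
have mhE : measurable_fun [set: bR * bR] (fun z => (h z)%:E) by exact/measurable_EFinP.
apply: (integrable_mrestr leb2 measurable_Omega mhE).2.
have i1 := integrableZl measurableT C integrable_gweight_plane.
have := (integrable_mrestr leb2 measurable_Omega (measurable_int _ i1)).1 i1.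
apply: le_integrable => //; first exact: measurable_Omega.
  exact: measurable_funTS.
move=> z Oz /=; rewrite lee_fin; apply: le_trans (hC z Oz) _.
by rewrite ler_norm.
Qed.

Lemma weighted_L2 h C : measurable_fun [set: bR * bR] h ->
  (forall z, Omega z -> `|h z| <= C * gweight z.1) -> h \in L2Omega.
Proof.
move=> mh hC; apply/Lfun2P; split => //.
apply: (@weighted_integrable (fun z => h z ^+ 2) (C ^+ 2)).
  exact: measurable_funX.
move=> z Oz; rewrite ger0_norm ?sqr_ge0// -real_normK ?num_real//.
apply: le_trans (_ : _ <= (C * gweight z.1) ^+ 2) _.
  by rewrite lerXn2r ?nnegrE ?hC// (le_trans _ (hC z Oz)).
rewrite exprMn ler_wpM2l ?sqr_ge0// expr2 ler_piMl ?gweight_le1//.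
exact/ltW/gweight_gt0.
Qed.

(** Dominated convergence: as [gweight <= 1], the square of the bound is still at most
    [C ^ 2 * gweight]. *)
Lemma weighted_cvg (h_ : nat -> plane -> R) h C :
  (forall n, measurable_fun [set: bR * bR] (h_ n)) -> measurable_fun [set: bR * bR] h ->
  (forall n z, Omega z -> `|h_ n z - h z| <= C * gweight z.1) ->
  (forall z, Omega z -> h_ n z @[n --> \oo] --> h z) ->
  distL2 (h_ n) h @[n --> \oo] --> 0%E.
Proof.
move=> mh_ mh hC cvgh; apply: (@cvg_Lnorm2_0 _ _ R muOmega (fun n => h_ n \- h)).
have md n : measurable_fun [set: bR * bR] (fun z => ((h_ n z - h z) ^+ 2)%:E).
  apply/measurable_EFinP; apply: measurable_funX.
  by apply: measurable_funB; [exact: mh_|exact: mh].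
have mO := @measurable_Omega R.
under eq_fun do rewrite (integral_mrestr leb2 mO (md _)).
rewrite -(integral0 leb2 (@Omega R)).
have i1 := integrableZl measurableT (C ^+ 2) integrable_gweight_plane.
apply: (@dominated_cvg _ _ _ leb2 _ mO _ _ (fun z => (C ^+ 2)%:E * (gweight z.1)%:E)%E).
- by move=> n; apply: measurable_funTS; exact: md.
- move=> z Oz; apply: cvg_EFin; first by near=> n.
  rewrite (_ : 0 = (h z - h z) ^+ 2); last by rewrite subrr expr0n.
  have hz : (h_ n z - h z) @[n --> \oo] --> h z - h z.
    by apply: cvgB; [exact: cvgh|exact: cvg_cst].
  exact: (cvgM hz hz).
- by [].
- by apply: (integrable_mrestr leb2 mO (measurable_int _ i1)).1.
- move=> n z Oz; rewrite -EFinM abse_EFin lee_fin ger0_norm ?sqr_ge0//.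
  rewrite -real_normK ?num_real//.
  apply: le_trans (_ : _ <= (C * gweight z.1) ^+ 2) _.
    by rewrite lerXn2r ?nnegrE ?hC// (le_trans _ (hC n z Oz)).
  rewrite exprMn ler_wpM2l ?sqr_ge0// expr2 ler_piMl ?gweight_le1//.
  exact/ltW/gweight_gt0.
Unshelve. all: by end_near. Qed.

End gaussian_weight.

(** * Eigenfunctions in the energy space *)

Section integration_by_parts_plane.
Context {R : realType}.
Local Notation bR := (measurableTypeR R).
Local Notation plane := (R * R)%type.
Local Notation leb := (@lebesgue_measure R).
Implicit Types (h k : plane -> R) (x y M : R).

Local Notation e1 := ((1, 0) : plane).
Local Notation e2 := ((0, 1) : plane).

Lemma is_derive_slice1 h x y c :
  is_derive (x, y) e1 h c -> is_derive x 1 (fun x => h (x, y)) c.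
Proof.
have E : (fun t : R => t^-1 *: (h (t *: e1 + (x, y)) - h (x, y))) =
         (fun t : R => t^-1 *: (h (t *: (1 : R) + x, y) - h (x, y))).
  apply/funext => t; congr (_ *: (h _ - _)).
  have -> : t *: e1 + (x, y) = (t *: (1 : R) + x, t *: (0 : R) + y) by [].
  by rewrite scaler0 add0r.
by move=> [dh dc]; apply: DeriveDef; move: dh dc; rewrite /derivable /derive /= E.
Qed.

Lemma is_derive_slice2 h x y c :
  is_derive (x, y) e2 h c -> is_derive y 1 (fun y => h (x, y)) c.
Proof.
have E : (fun t : R => t^-1 *: (h (t *: e2 + (x, y)) - h (x, y))) =
         (fun t : R => t^-1 *: (h (x, t *: (1 : R) + y) - h (x, y))).
  apply/funext => t; congr (_ *: (h _ - _)).
  have -> : t *: e2 + (x, y) = (t *: (0 : R) + x, t *: (1 : R) + y) by [].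
  by rewrite scaler0 add0r.
by move=> [dh dc]; apply: DeriveDef; move: dh dc; rewrite /derivable /derive /= E.
Qed.

Lemma FTC_everywhere (F f : R -> R) a b : a < b -> continuous f ->
  (forall x, is_derive x 1 F (f x)) ->
  (\int[leb]_(x in `[a, b]) (f x)%:E = (F b - F a)%:E)%E.
Proof.
move=> ab cf Ff; rewrite EFinB.
have cF : continuous F.
  move=> x; apply/differentiable_continuous/derivable1_diffP.
  by have := Ff x.
apply: continuous_FTC2 => //.
- exact: continuous_subspaceT.
- split.
  + by move=> x _; have := Ff x.
  + exact/cvg_at_right_filter/cF.
  + exact/cvg_at_left_filter/cF.
- by move=> x _; rewrite derive1E; have [_ ->] := Ff x.
Qed.

Lemma continuous_slice1 h y : continuous h -> continuous (fun x => h (x, y)).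
Proof.
move=> ch x; apply: (@continuous_comp _ _ _ (fun x : R => (x, y)) h); last exact: ch.
by apply: (@cvg_pair _ _ _ (nbhs x) (nbhs x) (nbhs y)); [exact: cvg_id|exact: cvg_cst].
Qed.

Lemma continuous_slice2 h x : continuous h -> continuous (fun y => h (x, y)).
Proof.
move=> ch y; apply: (@continuous_comp _ _ _ (fun y : R => (x, y)) h); last exact: ch.
by apply: (@cvg_pair _ _ _ (nbhs y) (nbhs x) (nbhs y)); [exact: cvg_cst|exact: cvg_id].
Qed.

(** Boundedness of the support is asked in [x] only: in [y] the strip is bounded, and continuity on
    its closure gives the rest. *)
Definition xbounded h := exists M, forall z, M < `|z.1| -> h z = 0.

Lemma xbounded_le_gweight h : continuous h -> xbounded h ->
  exists C, forall z, Omega z -> `|h z| <= C * gweight z.1.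
Proof.
move=> ch [M hM].
have cK : compact (`[- M, M] `*` `[0, pi] : set plane).
  by apply: compact_setX; exact: segment_compact.
have : bounded_set (h @` (`[- M, M] `*` `[0, pi])).
  apply/compact_bounded/continuous_compact => //.
  exact: continuous_subspaceT.
move=> [B [_ /(_ (`|B| + 1))]]; rewrite (le_lt_trans (ler_norm _)) ?ltrDl//.
move=> /(_ isT) hB; exists ((`|B| + 1) * expR (M ^+ 2 / 8)) => z Oz.
have [zM|zM] := leP `|z.1| M; last first.
  by rewrite hM// normr0 !mulr_ge0 ?expR_ge0// addr_ge0.
have hz : `|h z| <= `|B| + 1.
  apply: hB; exists z => //; split; rewrite /= in_itv /=.
    by rewrite -ler_norml.
  by case: Oz => _ /=; rewrite in_itv /= => /andP[? ?]; rewrite !ltW.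
apply: le_trans hz _; rewrite -mulrA ler_peMr ?addr_ge0//.
exact: gweight_bound.
Qed.

Lemma xbounded_integrable h : continuous h -> xbounded h ->
  muOmega.-integrable setT (fun z => (h z)%:E).
Proof.
move=> ch /xbounded_le_gweight -/(_ ch) [C hC]; apply: weighted_integrable hC.
exact: continuous_measurable_plane.
Qed.

Lemma xbounded_L2 h : continuous h -> xbounded h -> h \in L2Omega.
Proof.
move=> ch /xbounded_le_gweight -/(_ ch) [C hC]; apply: weighted_L2 hC.
exact: continuous_measurable_plane.
Qed.

Lemma xbounded_derive h k : xbounded h -> (forall z, is_derive z e1 h (k z)) ->
  xbounded k.
Proof.
move=> [M hM] hk; exists M => z zM.
have := hk z; have : is_derive z e1 h 0.
  apply: near_eq_is_derive (is_derive_cst 0 z e1).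
  have : \forall w \near z, M < `|w.1|.
    have c1 : {for z, continuous (fun w : plane => `|w.1|)}.
      apply: (@continuous_comp _ _ _ fst (fun x : R => `|x|)); first exact: cvg_fst.
      exact: norm_continuous.
    exact: (c1 _ (lt_nbhsr zM)).
  by apply: filterS => w /hM ->.
by move=> [_ D0] [_ <-].
Qed.

Lemma integral_dx_eq0 h k : continuous h -> continuous k -> xbounded h ->
  (forall z, is_derive z e1 h (k z)) -> \int[muOmega]_z k z = 0.
Proof.
move=> ch ck bh hk; have bk := xbounded_derive bh hk.
have ik := xbounded_integrable ck bk.
rewrite /Rintegral (muOmega_fubini ik).2 (_ : (fun y => _) = cst 0%E); last first.
  apply/funext => y; have [M hM] := bh; have [M' kM'] := bk.
  pose N := Num.max (Num.max `|M| `|M'|) 0 + 1.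
  have MN : M < N.
    by rewrite (le_lt_trans (ler_norm M))// /N ltr_pwDr// !le_max lexx.
  have MN' : M' < N.
    by rewrite (le_lt_trans (ler_norm M'))// /N ltr_pwDr// !le_max lexx orbT.
  have N0 : 0 < N by rewrite /N ltr_pwDr// le_max lexx orbT.
  have cky := continuous_slice1 (y := y) ck.
  have E : (\int[leb]_(x in `[(- N)%R, N]) (k (x, y))%:E = 0)%E.
    have NN : - N < N by lra.
    rewrite (@FTC_everywhere (fun x => h (x, y)) (fun x => k (x, y)) _ _ NN cky
      (fun x => is_derive_slice1 (hk (x, y)))).
    by rewrite !hM ?subrr//= ?normrN ger0_norm//; exact: ltW.
  rewrite -[RHS]E [RHS]integral_mkcond; apply: eq_integral => x _.
  rewrite patchE; case: ifPn => //.
  rewrite notin_setE /= in_itv /= -ler_norml => /negP; rewrite -ltNge => xN.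
  by rewrite kM'//= (lt_trans MN').
by rewrite integral0.
Qed.

Lemma integral_dy_eq0 h k : continuous h -> continuous k -> xbounded k ->
  (forall x, h (x, 0) = 0) -> (forall x, h (x, pi) = 0) ->
  (forall z, is_derive z e2 h (k z)) -> \int[muOmega]_z k z = 0.
Proof.
move=> ch ck bk h0 hpi hk.
have ik := xbounded_integrable ck bk.
rewrite /Rintegral (muOmega_fubini ik).1 (_ : (fun x => _) = cst 0%E); last first.
  apply/funext => x.
  have ckx := continuous_slice2 (x := x) ck.
  rewrite integral_itv_obnd_cbnd; last first.
    by apply/measurable_EFinP; apply: measurable_funTS; exact: continuous_measurable_fun.
  rewrite integral_itv_bndo_bndc; last first.
    by apply/measurable_EFinP; apply: measurable_funTS; exact: continuous_measurable_fun.
  rewrite (@FTC_everywhere (fun y => h (x, y)) (fun y => k (x, y)) _ _ (pi_gt0 R) ckx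
    (fun y => is_derive_slice2 (hk (x, y)))).
  by rewrite h0 hpi subrr.
by rewrite integral0.
Qed.

End integration_by_parts_plane.

(** * Smoothness of tensor products *)

Section tensor_products.
Context {R : realType}.
Local Notation plane := (R * R)%type.
Implicit Types (a b : R -> R) (z v : plane).

Definition tensor a b : plane -> R := fun z => a z.1 * b z.2.

Lemma is_derive_dir a (x c w : R) : is_derive x 1 a c -> is_derive x w a (w * c).
Proof.
move=> [da dac]; have dd : differentiable a x by exact/derivable1_diffP.
apply: DeriveDef; first exact: diff_derivable.
by rewrite deriveE// deriv1E// derive1E dac.
Qed.

Lemma is_derive_fst a z v (c : R) : is_derive z.1 1 a c ->
  is_derive z v (fun z : plane => a z.1) (v.1 * c).
Proof. by move=> /(is_derive_dir v.1) [da dac]; apply: DeriveDef. Qed.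

Lemma is_derive_snd a z v (c : R) : is_derive z.2 1 a c ->
  is_derive z v (fun z : plane => a z.2) (v.2 * c).
Proof. by move=> /(is_derive_dir v.2) [da dac]; apply: DeriveDef. Qed.

Lemma is_derive_tensor a b z v (ca cb : R) :
  is_derive z.1 1 a ca -> is_derive z.2 1 b cb ->
  is_derive z v (tensor a b) (v.1 * ca * b z.2 + v.2 * a z.1 * cb).
Proof.
move=> /(is_derive_fst v) da /(is_derive_snd v) db.
apply: is_derive_eq (is_deriveM da db) _.
by rewrite /GRing.scale /=; ring.
Qed.

Lemma is_derive_continuous (f g : R -> R) : (forall x : R, is_derive x 1 f (g x)) -> continuous f.
Proof.
move=> fg x; apply/differentiable_continuous/derivable1_diffP.
by have := fg x.
Qed.

Lemma continuous_tensor a b : continuous a -> continuous b -> continuous (tensor a b).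
Proof.
move=> ca cb z; apply: cvgM.
  by apply: (@continuous_comp _ _ _ fst a); [exact: cvg_fst|exact: ca].
by apply: (@continuous_comp _ _ _ snd b); [exact: cvg_snd|exact: cb].
Qed.

(** A directional derivative of a tensor is a sum of two tensors, so this class is stable under all
    directional derivatives. *)
Inductive tensor_sum : set (plane -> R) :=
| tensor_sum1 a b : smooth1 a -> smooth1 b -> tensor_sum (tensor a b)
| tensor_sumD f g : tensor_sum f -> tensor_sum g -> tensor_sum (f \+ g).

Lemma tensor_sum_continuous f : tensor_sum f -> continuous f.
Proof.
elim=> {f} [a b /smooth1_derive[a' aa' _] /smooth1_derive[b' bb' _]|f g _ cf _ cg].
  by apply: continuous_tensor; [exact: is_derive_continuous aa'|exact: is_derive_continuous bb'].
by move=> z; apply: cvgD; [exact: cf|exact: cg].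
Qed.

Lemma tensor_sum_derive f v : tensor_sum f ->
  exists2 g, (forall z, is_derive z v f (g z)) & tensor_sum g.
Proof.
elim=> {f} [a b sa sb|f g _ [f' ff' sf'] _ [g' gg' sg']].
  have [a' aa' sa'] := smooth1_derive sa; have [b' bb' sb'] := smooth1_derive sb.
  exists (tensor (cst v.1 \* a') b \+ tensor (cst v.2 \* a) b').
    by move=> z; apply: is_derive_eq (is_derive_tensor _ (aa' _) (bb' _)) _.
  apply: tensor_sumD; apply: tensor_sum1 => //; apply: smooth1M => //; exact: smooth1_cst.
exists (f' \+ g'); last exact: tensor_sumD.
by move=> z; exact: is_deriveD.
Qed.

Lemma tensor_sum_smooth f : tensor_sum f -> smooth f.
Proof.
move=> tf s.
suff h : tensor_sum (foldr (fun v (h : plane -> R) => 'D_v h) f s).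
  split; first exact: tensor_sum_continuous.
  by move=> v z; have [g /(_ z) []] := tensor_sum_derive v h.
elim: s => //= v s /(tensor_sum_derive v) [g hg tg].
by rewrite (_ : 'D_v _ = g)//; apply/funext => z; have [_ ->] := hg z.
Qed.

Lemma smooth1_smooth a : smooth1 a -> smooth a.
Proof.
move=> sa s.
suff h : smooth1 (foldr (fun (v : R) (h : R -> R) => 'D_v h) a s).
  have [b hb sb] := smooth1_derive h.
  split; first exact: is_derive_continuous hb.
  by move=> v z; have [] := is_derive_dir v (hb z).
elim: s => //= v s /smooth1_derive [g hg sg].
rewrite (_ : 'D_v _ = cst v \* g); first by apply: smooth1M => //; exact: smooth1_cst.
by apply/funext => z; have [_ ->] := is_derive_dir v (hg z).
Qed.

End tensor_products.

Section test_functions_plane.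
Context {R : realType}.
Local Notation plane := (R * R)%type.
Implicit Types (f g h : plane -> R) (z v : plane).

Lemma smooth_derive f v : smooth f -> smooth ('D_v f).
Proof. by move=> sf s; have := sf (rcons s v); rewrite foldr_rcons. Qed.

Lemma smooth_continuous f : smooth f -> continuous f.
Proof. by move=> /(_ [::]) []. Qed.

Lemma smooth_is_derive f v z : smooth f -> is_derive z v f ('D_v f z).
Proof. by move=> /(_ [::]) [_ /(_ v z)] /derivableP. Qed.

Lemma support_derive f v z : ~ closure [set z | f z != 0] z -> 'D_v f z = 0.
Proof.
move=> nz; have : is_derive z v f 0.
  apply: near_eq_is_derive (is_derive_cst 0 z v).
  have := open_nbhs_nbhs (conj (closed_openC (@closed_closure _ [set z | f z != 0])) nz).
  apply: filterS => w /= nw; apply/esym/eqP; apply: contra_notT nw => fw.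
  exact: subset_closure.
by move=> [].
Qed.

Lemma support_eq0 f z : ~ closure [set z | f z != 0] z -> f z = 0.
Proof. by move=> nz; apply: contra_notP nz => /eqP fz; exact: subset_closure. Qed.

Lemma compact_xbounded f (K : set plane) : compact K -> (forall z, ~ K z -> f z = 0) ->
  xbounded f.
Proof.
move=> cK fK.
have : bounded_set ((fun z : plane => z.1) @` K).
  apply/compact_bounded/continuous_compact => //.
  by apply: continuous_subspaceT => z; exact: cvg_fst.
move=> [B [_ /(_ (`|B| + 1))]]; rewrite (le_lt_trans (ler_norm _)) ?ltrDl//.
move=> /(_ isT) hB; exists (`|B| + 1) => z zB; apply: fK => Kz.
by have := hB z.1 (imageP _ Kz); rewrite /= leNgt zB.
Qed.

Lemma test_xbounded f : test_function (@Omega R) f -> xbounded f.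
Proof. by move=> [_ cK _]; apply: compact_xbounded cK _ => z; exact: support_eq0. Qed.

Lemma test_xbounded_derive f v : test_function (@Omega R) f -> xbounded ('D_v f).
Proof. by move=> [_ cK _]; apply: compact_xbounded cK _ => z; exact: support_derive. Qed.

Lemma not_Omega0 x : ~ Omega (x, 0 : R).
Proof. by case=> _; rewrite /= in_itv /= ltxx. Qed.

Lemma not_Omegapi x : ~ Omega (x, pi : R).
Proof. by case=> _; rewrite /= in_itv /= ltxx andbF. Qed.

Lemma test_boundary f z : test_function (@Omega R) f -> ~ Omega z -> f z = 0.
Proof. by move=> [_ _ KO] nO; apply: support_eq0 => /KO. Qed.

Lemma test_derive f v : test_function (@Omega R) f -> test_function (@Omega R) ('D_v f).
Proof.
move=> [sf cK KO].
have sub : closure [set z | 'D_v f z != 0] `<=` closure [set z | f z != 0].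
  rewrite [X in _ `<=` X](closure_id _).1; last exact: closed_closure.
  apply: closureS => z /= fz.
  by apply: contrapT => /(support_derive v) /eqP; rewrite (negbTE fz).
split; first exact: smooth_derive.
  by apply: subclosed_compact sub => //; exact: closed_closure.
exact: subset_trans sub KO.
Qed.

Lemma test_continuous f : test_function (@Omega R) f -> continuous f.
Proof. by case=> sf _ _; exact: smooth_continuous. Qed.

Lemma test_is_derive f v z : test_function (@Omega R) f -> is_derive z v f ('D_v f z).
Proof. by case=> sf _ _; exact: smooth_is_derive. Qed.

End test_functions_plane.

(** * The eigenvalue equation in the energy space *)

Section weak_eigenfunctions.
Context {R : realType}.
Local Notation bR := (measurableTypeR R).
Local Notation plane := (R * R)%type.
Local Notation leb := (@lebesgue_measure R).
Local Notation e1 := ((1, 0) : plane).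
Local Notation e2 := ((0, 1) : plane).
Implicit Types (f g h psi : plane -> R) (z : plane).

Lemma continuous_mul f g : continuous f -> continuous g -> continuous (fun z => f z * g z).
Proof. by move=> cf cg z; apply: cvgM; [exact: cf|exact: cg]. Qed.

Lemma xbounded_mul f g : xbounded g -> xbounded (fun z => f z * g z).
Proof. by move=> [M gM]; exists M => z zM; rewrite gM// mulr0. Qed.

Lemma integration_by_parts_dx f f' g g' :
  continuous f -> continuous f' -> continuous g -> continuous g' ->
  (forall z, is_derive z e1 f (f' z)) -> (forall z, is_derive z e1 g (g' z)) ->
  xbounded g ->
  \int[muOmega]_z (f' z * g z) = - \int[muOmega]_z (f z * g' z).
Proof.
move=> cf cf' cg cg' ff' gg' bg; have bg' := xbounded_derive bg gg'.
have c1 := continuous_mul cf' cg; have c2 := continuous_mul cf cg'.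
apply/eqP; rewrite -addr_eq0 -RintegralD//; last 2 first.
- by apply: xbounded_integrable => //; exact: xbounded_mul.
- by apply: xbounded_integrable => //; exact: xbounded_mul.
apply/eqP; apply: (@integral_dx_eq0 R (fun z => f z * g z)).
- exact: continuous_mul.
- by move=> z; apply: cvgD; [exact: c1|exact: c2].
- exact: xbounded_mul.
- move=> z; apply: is_derive_eq (is_deriveM (ff' z) (gg' z)) _.
  by rewrite /GRing.scale /=; ring.
Qed.

Lemma integration_by_parts_dy f f' g g' :
  continuous f -> continuous f' -> continuous g -> continuous g' ->
  (forall z, is_derive z e2 f (f' z)) -> (forall z, is_derive z e2 g (g' z)) ->
  xbounded g -> xbounded g' -> (forall x, g (x, 0) = 0) -> (forall x, g (x, pi) = 0) ->
  \int[muOmega]_z (f' z * g z) = - \int[muOmega]_z (f z * g' z).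
Proof.
move=> cf cf' cg cg' ff' gg' bg bg' g0 gpi.
have c1 := continuous_mul cf' cg; have c2 := continuous_mul cf cg'.
apply/eqP; rewrite -addr_eq0 -RintegralD//; last 2 first.
- by apply: xbounded_integrable => //; exact: xbounded_mul.
- by apply: xbounded_integrable => //; exact: xbounded_mul.
apply/eqP; apply: (@integral_dy_eq0 R (fun z => f z * g z)).
- exact: continuous_mul.
- by move=> z; apply: cvgD; [exact: c1|exact: c2].
- have [M gM] := bg; have [M' gM'] := bg'; exists (Num.max M M') => z.
  by rewrite gt_max => /andP[/gM -> /gM' ->]; rewrite !mulr0 addr0.
- by move=> x; rewrite g0 mulr0.
- by move=> x; rewrite gpi mulr0.
- move=> z; apply: is_derive_eq (is_deriveM (ff' z) (gg' z)) _.
  by rewrite /GRing.scale /=; ring.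
Qed.

Lemma continuous_fst2 : continuous (fun z : plane => z.1 ^+ 2).
Proof. by move=> z; apply: cvgM; exact: cvg_fst. Qed.

(* a smooth solution [f] of [(d_x^2 + x^2 d_y^2) f = - lambda f] *)
Record eigen (lambda : R) f := Eigen {
  eigen_dx : plane -> R; eigen_dxx : plane -> R;
  eigen_dy : plane -> R; eigen_dyy : plane -> R;
  eigen_c : [/\ continuous f, continuous eigen_dx, continuous eigen_dxx,
                continuous eigen_dy & continuous eigen_dyy];
  eigen_d1 : forall z, is_derive z e1 f (eigen_dx z);
  eigen_d11 : forall z, is_derive z e1 eigen_dx (eigen_dxx z);
  eigen_d2 : forall z, is_derive z e2 f (eigen_dy z);
  eigen_d22 : forall z, is_derive z e2 eigen_dy (eigen_dyy z);
  eigen_eq : forall z, eigen_dxx z + z.1 ^+ 2 * eigen_dyy z = - lambda * f z }.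

Lemma is_derive_sqr_fst f z c : is_derive z e2 f c ->
  is_derive z e2 (fun z => z.1 ^+ 2 * f z) (z.1 ^+ 2 * c).
Proof.
move=> fc; have h : is_derive z e2 (fun z : plane => z.1 ^+ 2) 0.
  have hx : is_derive z.1 1 (fun x : R => x ^+ 2) (2 * z.1).
    by apply: is_derive_eq; rewrite /GRing.scale /=; ring.
  by have := is_derive_fst e2 hx; rewrite mul0r.
apply: is_derive_eq (is_deriveM h fc) _.
by rewrite /GRing.scale /= mulr0 addr0.
Qed.

(** The pair [(p, q)] is any weak gradient of [f], known only as an L^2 limit. Along the
    approximants [phi n] both derivatives are moved onto [psi], and the limit leaves [f] itself;
    they are then moved back onto [f] classically. Boundary terms vanish because [psi] and its
    derivatives do, so [f] needs no boundary condition here. *)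
Lemma test_pairing (lambda : R) f p q psi : eigen lambda f -> is_grad f p q ->
  test_function (@Omega R) psi ->
  \int[muOmega]_z (dx psi z * p z + xdy psi z * q z) =
  lambda * \int[muOmega]_z (psi z * f z).
Proof.
move=> ef [fL2 pL2 qL2 [phi [tphi phif phip phiq]]] tpsi.
have [cf cfx cfxx cfy cfyy] := eigen_c ef.
have tx := test_derive e1 tpsi; have txx := test_derive e1 tx.
have ty := test_derive e2 tpsi; have tyy := test_derive e2 ty.
have cpsi := test_continuous tpsi.
have cx := test_continuous tx; have cxx := test_continuous txx.
have cy := test_continuous ty; have cyy := test_continuous tyy.
have bpsi := test_xbounded tpsi.
have bx := test_xbounded tx; have bxx := test_xbounded txx.
have bdy := test_xbounded ty; have byy := test_xbounded tyy.
pose x2 f z := z.1 ^+ 2 * f z : R.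
have cx2 g : continuous g -> continuous (x2 g).
  by move=> cg; apply: continuous_mul => //; exact: continuous_fst2.
have bx2 g : xbounded g -> xbounded (x2 g) by exact: xbounded_mul.
have L2 g : continuous g -> xbounded g -> g \in L2Omega by exact: xbounded_L2.
have phiL2 n : phi n \in L2Omega.
  by apply: L2; [exact: test_continuous|exact: test_xbounded].
have cxdy g : continuous ('D_e2 g) -> continuous (xdy g).
  by move=> cg; apply: continuous_mul => // z; exact: cvg_fst.
have bxdy g : xbounded ('D_e2 g) -> xbounded (xdy g) by exact: xbounded_mul.
have xdyL2 : xdy psi \in L2Omega := L2 _ (cxdy _ cy) (bxdy _ bdy).
have dxL2 : dx psi \in L2Omega := L2 _ cx bx.
have dxxL2 := L2 _ cxx bxx.
have yyL2 := L2 _ (cx2 _ cyy) (bx2 _ byy).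
have dxphiL2 n : dx (phi n) \in L2Omega.
  by apply: L2; [apply: test_continuous; exact: test_derive|exact: test_xbounded_derive].
have xdyphiL2 n : xdy (phi n) \in L2Omega.
  apply: L2; first by apply/cxdy/test_continuous; exact: test_derive.
  by apply/bxdy; exact: test_xbounded_derive.
have y0 g (tg : test_function (@Omega R) g) x : g (x, 0) = 0.
  by apply: (test_boundary tg); exact: not_Omega0.
have ypi g (tg : test_function (@Omega R) g) x : g (x, pi) = 0.
  by apply: (test_boundary tg); exact: not_Omegapi.
have x20 g (tg : test_function (@Omega R) g) x : x2 g (x, 0) = 0.
  by rewrite /x2 (y0 _ tg) mulr0.
have x2pi g (tg : test_function (@Omega R) g) x : x2 g (x, pi) = 0.
  by rewrite /x2 (ypi _ tg) mulr0.
have px : \int[muOmega]_z (p z * dx psi z) = - \int[muOmega]_z (f z * 'D_e1 (dx psi) z).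
  have h1 : (fun n => \int[muOmega]_z (dx (phi n) z * dx psi z)) @ \oo -->
      \int[muOmega]_z (p z * dx psi z).
    exact: cvg_inner (nearW _ dxphiL2) pL2 dxL2 phip.
  have h2 : (fun n => - \int[muOmega]_z (phi n z * 'D_e1 (dx psi) z)) @ \oo -->
      - \int[muOmega]_z (f z * 'D_e1 (dx psi) z).
    by apply: cvgN; exact: cvg_inner (nearW _ phiL2) fL2 dxxL2 phif.
  have E n : \int[muOmega]_z (dx (phi n) z * dx psi z) =
      - \int[muOmega]_z (phi n z * 'D_e1 (dx psi) z).
    exact: (@integration_by_parts_dx (phi n) (dx (phi n)) (dx psi) ('D_e1 (dx psi))
      (test_continuous (tphi n)) (test_continuous (test_derive e1 (tphi n))) cx cxx
      (fun z => test_is_derive e1 z (tphi n)) (fun z => test_is_derive e1 z tx) bx).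
  by rewrite (funext E) in h1; exact: (cvg_unique _ h1 h2).
have qy : \int[muOmega]_z (q z * xdy psi z) =
    - \int[muOmega]_z (f z * x2 ('D_e2 ('D_e2 psi)) z).
  have h1 : (fun n => \int[muOmega]_z (xdy (phi n) z * xdy psi z)) @ \oo -->
      \int[muOmega]_z (q z * xdy psi z).
    exact: cvg_inner (nearW _ xdyphiL2) qL2 xdyL2 phiq.
  have h2 : (fun n => - \int[muOmega]_z (phi n z * x2 ('D_e2 ('D_e2 psi)) z)) @ \oo -->
      - \int[muOmega]_z (f z * x2 ('D_e2 ('D_e2 psi)) z).
    by apply: cvgN; exact: cvg_inner (nearW _ phiL2) fL2 yyL2 phif.
  have E n : \int[muOmega]_z (xdy (phi n) z * xdy psi z) =
      - \int[muOmega]_z (phi n z * x2 ('D_e2 ('D_e2 psi)) z).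
    rewrite -(@integration_by_parts_dy (phi n) ('D_e2 (phi n)) (x2 ('D_e2 psi))
      (x2 ('D_e2 ('D_e2 psi))) (test_continuous (tphi n))
      (test_continuous (test_derive e2 (tphi n))) (cx2 _ cy) (cx2 _ cyy)
      (fun z => test_is_derive e2 z (tphi n))
      (fun z => is_derive_sqr_fst (test_is_derive e2 z ty))
      (bx2 _ bdy) (bx2 _ byy) (x20 _ ty) (x2pi _ ty)).
    by apply: eq_Rintegral => z _; rewrite /xdy /x2; ring.
  by rewrite (funext E) in h1; exact: (cvg_unique _ h1 h2).
have fx : \int[muOmega]_z (f z * 'D_e1 (dx psi) z) =
    \int[muOmega]_z (eigen_dxx ef z * psi z).
  have E1 := @integration_by_parts_dx f (eigen_dx ef) (dx psi) ('D_e1 (dx psi)) cf cfx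
    cx cxx (eigen_d1 ef) (fun z => test_is_derive e1 z tx) bx.
  have E2 := @integration_by_parts_dx (eigen_dx ef) (eigen_dxx ef) psi (dx psi) cfx cfxx
    cpsi cx (eigen_d11 ef) (fun z => test_is_derive e1 z tpsi) bpsi.
  by rewrite E2 E1 opprK.
have fy : \int[muOmega]_z (f z * x2 ('D_e2 ('D_e2 psi)) z) =
    \int[muOmega]_z (x2 (eigen_dyy ef) z * psi z).
  have E1 := @integration_by_parts_dy f (eigen_dy ef) (x2 ('D_e2 psi))
    (x2 ('D_e2 ('D_e2 psi))) cf cfy (cx2 _ cy) (cx2 _ cyy) (eigen_d2 ef)
    (fun z => is_derive_sqr_fst (test_is_derive e2 z ty)) (bx2 _ bdy) (bx2 _ byy)
    (x20 _ ty) (x2pi _ ty).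
  have E2 := @integration_by_parts_dy (x2 (eigen_dy ef)) (x2 (eigen_dyy ef)) psi ('D_e2 psi)
    (cx2 _ cfy) (cx2 _ cfyy) cpsi cy (fun z => is_derive_sqr_fst (eigen_d22 ef z))
    (fun z => test_is_derive e2 z tpsi) bpsi bdy (y0 _ tpsi) (ypi _ tpsi).
  rewrite E2 -[LHS]opprK -E1; congr (- _); apply: eq_Rintegral => z _.
  by rewrite /x2; ring.
rewrite RintegralD//; last 2 first.
- exact: integrable_mul.
- exact: integrable_mul.
have -> : \int[muOmega]_z (dx psi z * p z) = \int[muOmega]_z (p z * dx psi z).
  by apply: eq_Rintegral => z _; rewrite mulrC.
have -> : \int[muOmega]_z (xdy psi z * q z) = \int[muOmega]_z (q z * xdy psi z).
  by apply: eq_Rintegral => z _; rewrite mulrC.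
rewrite px fx qy fy -opprD -RintegralD//; last 2 first.
- by apply: xbounded_integrable; [exact: continuous_mul|exact: xbounded_mul].
- by apply: xbounded_integrable; [apply: continuous_mul => //; exact: cx2|exact: xbounded_mul].
have -> : \int[muOmega]_z (eigen_dxx ef z * psi z + x2 (eigen_dyy ef) z * psi z) =
    \int[muOmega]_z (- lambda * (psi z * f z)).
  by apply: eq_Rintegral => z _; rewrite -mulrDl (eigen_eq ef); ring.
rewrite RintegralZl//; first by rewrite mulNr opprK.
exact: integrable_mul (L2 _ cpsi bpsi) fL2.
Qed.

(** [test_pairing] passes to the limit along test functions approximating [g]. This turns the form
    in the weak equation into a multiple of the pairing, so that the equation becomes a scalar
    one. *)
Lemma formV_eigen (lambda : R) f g : eigen lambda f -> V f -> V g ->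
  formV g f = lambda * innerL2 g f.
Proof.
move=> ef [p0 [q0 gradf]] [p1 [q1 gradg]].
have Gf : is_grad f (grad f).1 (grad f).2.
  by apply: (xgetPex _ (P := [set pq | is_grad f pq.1 pq.2])); exists (p0, q0).
have Gg : is_grad g (grad g).1 (grad g).2.
  by apply: (xgetPex _ (P := [set pq | is_grad g pq.1 pq.2])); exists (p1, q1).
rewrite /formV /innerL2; move: (grad f) (grad g) Gf Gg => [p q] [p' q'] /= Gf.
have [fL2 pL2 qL2 _] := Gf.
move=> [gL2 p'L2 q'L2 [psi [tpsi psig psip psiq]]].
have L2 h : continuous h -> xbounded h -> h \in L2Omega by exact: xbounded_L2.
have dxL2 n : dx (psi n) \in L2Omega.
  by apply: L2; [apply: test_continuous; exact: test_derive|exact: test_xbounded_derive].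
have xdyL2 n : xdy (psi n) \in L2Omega.
  apply: L2; last by apply: xbounded_mul; exact: test_xbounded_derive.
  apply: continuous_mul; first by move=> z; exact: cvg_fst.
  by apply: test_continuous; exact: test_derive.
have psiL2 n : psi n \in L2Omega.
  by apply: L2; [exact: test_continuous|exact: test_xbounded].
have h1 : (fun n => \int[muOmega]_z (dx (psi n) z * p z)) @ \oo -->
    \int[muOmega]_z (p' z * p z) by exact: cvg_inner (nearW _ dxL2) p'L2 pL2 psip.
have h2 : (fun n => \int[muOmega]_z (xdy (psi n) z * q z)) @ \oo -->
    \int[muOmega]_z (q' z * q z) by exact: cvg_inner (nearW _ xdyL2) q'L2 qL2 psiq.
have h3 : (fun n => \int[muOmega]_z (psi n z * f z)) @ \oo -->
    \int[muOmega]_z (g z * f z) by exact: cvg_inner (nearW _ psiL2) gL2 fL2 psig.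
rewrite RintegralD//; [|exact: integrable_mul|exact: integrable_mul].
have h12 : (fun n => \int[muOmega]_z (dx (psi n) z * p z) +
      \int[muOmega]_z (xdy (psi n) z * q z)) @ \oo -->
    \int[muOmega]_z (p' z * p z) + \int[muOmega]_z (q' z * q z).
  exact: cvgD h1 h2.
have h4 : (fun n => lambda * \int[muOmega]_z (psi n z * f z)) @ \oo -->
    lambda * \int[muOmega]_z (g z * f z) by apply: cvgM h3; exact: cvg_cst.
have E n : lambda * \int[muOmega]_z (psi n z * f z) =
    \int[muOmega]_z (dx (psi n) z * p z) + \int[muOmega]_z (xdy (psi n) z * q z).
  rewrite -(test_pairing ef Gf (tpsi n)) RintegralD//.
    exact: integrable_mul (dxL2 n) pL2.
  exact: integrable_mul (xdyL2 n) qL2.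
by rewrite (funext E) in h4; exact: (cvg_unique _ h12 h4).
Qed.

End weak_eigenfunctions.

(** * Cutoffs near the ends of an interval *)

Section cutoffs.
Context {R : realType}.
Implicit Types (L N x y c : R).

(** Supported in [[1 / N, L - 1 / N]]. It is used in [y] with [L = pi] and in time with [L = T]. *)
Definition cutoff L N y := flat (N * y + -1) * flat (- N * y + (N * L - 1)).

Definition dcutoff L N y :=
  N * dflat (N * y + -1) * flat (- N * y + (N * L - 1))
  - flat (N * y + -1) * (N * dflat (- N * y + (N * L - 1))).

Lemma smooth1_cutoff L N : smooth1 (cutoff L N).
Proof.
by apply: (smooth1M (a := fun y => flat (N * y + -1)));
  apply: smooth1_affine; exact: smooth1_flat.
Qed.

Lemma is_derive_cutoff L N y : is_derive y 1 (cutoff L N) (dcutoff L N y).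
Proof.
have d1 := is_derive_affine N (-1) (@is_derive_flat R) y.
have d2 := is_derive_affine (- N) (N * L - 1) (@is_derive_flat R) y.
apply: is_derive_eq (is_deriveM d1 d2) _.
by rewrite /GRing.scale /dcutoff /=; ring.
Qed.

Lemma cutoff_ge0 L N y : 0 <= cutoff L N y.
Proof. by rewrite mulr_ge0 ?flat_ge0. Qed.

Lemma cutoff_le1 L N y : cutoff L N y <= 1.
Proof. by rewrite mulr_ile1 ?flat_ge0 ?flat_le1. Qed.

Lemma cutoff_neq0 L N y : cutoff L N y != 0 -> 1 < N * y /\ 1 < N * (L - y).
Proof.
rewrite /cutoff mulf_eq0 negb_or => /andP[h1 h2]; split; rewrite ltNge; apply/negP => h.
  by move/eqP: h1; apply; apply: flat_le0; lra.
by move/eqP: h2; apply; apply: flat_le0; move: h; rewrite mulrBr; lra.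
Qed.

(** A quantity vanishing linearly at both ends compensates the slope of the cutoff there, with a
    bound free of [N]. It is applied to [s = |sin (n y)|] with [c = n], and to [s = t (T - t)] with
    [c = T]. *)
Lemma dcutoff_moment L N y c s : 0 < N -> 0 <= c -> 0 <= s ->
  s <= c * y -> s <= c * (L - y) -> s * `|dcutoff L N y| <= 6 * c.
Proof.
move=> N0 c0 s0 sy sL; rewrite /dcutoff.
have half u w : 0 <= u -> s <= c * u -> 0 <= w -> w <= 1 ->
    s * (N * dflat (N * u - 1) * w) <= 3 * c.
  move=> u0 su w0 w1.
  have h := @dflat_moment R (N * u - 1); rewrite subrK in h.
  have d0 := @dflat_ge0 R (N * u - 1).
  apply: le_trans (_ : s * (N * dflat (N * u - 1)) <= _).
    by rewrite ler_wpM2l// ler_piMr// mulr_ge0// ltW.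
  apply: le_trans (_ : c * u * (N * dflat (N * u - 1)) <= _).
    by rewrite ler_wpM2r// mulr_ge0// ltW.
  have -> : c * u * (N * dflat (N * u - 1)) = c * (N * u * dflat (N * u - 1)) by ring.
  by rewrite [leRHS]mulrC ler_wpM2l.
(* For [c > 0] the hypotheses force [0 <= y <= L]; for [c = 0] they do not, but then [s = 0]. *)
have [cE|cN0] := eqVneq c 0.
  have -> : s = 0 by apply/eqP; rewrite eq_le s0 andbT; move: sy; rewrite cE mul0r.
  by rewrite mul0r cE mulr0.
have cgt0 : 0 < c by rewrite lt_neqAle eq_sym cN0.
have y0 : 0 <= y by rewrite -(pmulr_rge0 _ cgt0) (le_trans s0).
have Ly0 : 0 <= L - y by rewrite -(pmulr_rge0 _ cgt0) (le_trans s0).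
have := half y _ y0 sy (flat_ge0 (- N * y + (N * L - 1))) (flat_le1 _).
have := half (L - y) _ Ly0 sL (flat_ge0 (N * y + -1)) (flat_le1 _).
have -> : N * (L - y) - 1 = - N * y + (N * L - 1) by ring.
set a := N * dflat (N * y + -1) * _; set b := _ * flat (N * y + -1) => hb ha.
have -> : flat (N * y + -1) * (N * dflat (- N * y + (N * L - 1))) = b by rewrite mulrC.
apply: le_trans (_ : s * (a + b) <= _); last by rewrite mulrDr; lra.
rewrite ler_wpM2l//; apply: le_trans (ler_normB _ _) _.
rewrite !ger0_norm// ?mulr_ge0 ?flat_ge0 ?dflat_ge0// ltW//.
Qed.

Lemma affine_cvgy c d : 0 < c -> (c * n.+1%:R + d) @[n --> \oo] --> +oo.
Proof.
move=> c0; apply/cvgryPge => A; near=> n.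
rewrite -lerBlDr mulrC -ler_pdivrMr//; apply: le_trans (_ : n%:R <= _).
  by near: n; exact: nbhs_infty_ger.
by rewrite ler_nat.
Unshelve. all: by end_near. Qed.

Lemma flat_affine_cvg c d : 0 < c -> flat (c * n.+1%:R + d) @[n --> \oo] --> (1 : R).
Proof.
by move=> c0; apply: (cvg_comp (fun n : nat => c * n.+1%:R + d) flat);
  [exact: affine_cvgy|exact: flat_cvg1].
Qed.

Lemma dflat_moment_affine_cvg c d : 0 < c ->
  ((c * n.+1%:R + d + 1) * dflat (c * n.+1%:R + d)) @[n --> \oo] --> (0 : R).
Proof.
by move=> c0; apply: (cvg_comp (fun n : nat => c * n.+1%:R + d) (fun x => (x + 1) * dflat x));
  [exact: affine_cvgy|exact: dflat_moment_cvg0].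
Qed.

Lemma dflat_cvg0 : dflat x @[x --> +oo] --> (0 : R).
Proof.
apply: (squeeze_cvgr _ (cvg_cst 0) (@dflat_moment_cvg0 R)).
near=> x; rewrite dflat_ge0 /= ler_peMl ?dflat_ge0//.
by have : 0 <= x by []; lra.
Unshelve. all: by end_near. Qed.

Lemma dflat_affine_cvg c d : 0 < c -> dflat (c * n.+1%:R + d) @[n --> \oo] --> (0 : R).
Proof.
by move=> c0; apply: (cvg_comp (fun n : nat => c * n.+1%:R + d) dflat);
  [exact: affine_cvgy|exact: dflat_cvg0].
Qed.

Lemma cutoff_cvg L y : 0 < y < L -> cutoff L n.+1%:R y @[n --> \oo] --> (1 : R).
Proof.
move=> /andP[y0 yL]; rewrite /cutoff -[X in _ --> X]mulr1.
have E1 n : n.+1%:R * y + -1 = y * n.+1%:R + -1 by rewrite mulrC.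
have E2 n : - n.+1%:R * y + (n.+1%:R * L - 1) = (L - y) * n.+1%:R + -1 by ring.
under eq_fun do rewrite E1 E2.
by apply: cvgM; apply: flat_affine_cvg => //; rewrite subr_gt0.
Qed.

Lemma dcutoff_cvg L y : 0 < y < L -> dcutoff L n.+1%:R y @[n --> \oo] --> (0 : R).
Proof.
move=> /andP[y0 yL]; rewrite /dcutoff.
have Ly0 : 0 < L - y by rewrite subr_gt0.
have E1 n : n.+1%:R * y + -1 = y * n.+1%:R + -1 by rewrite mulrC.
have E2 n : - n.+1%:R * y + (n.+1%:R * L - 1) = (L - y) * n.+1%:R + -1 by ring.
have lim c : 0 < c ->
    (n.+1%:R * dflat (c * n.+1%:R + -1)) @[n --> \oo] --> (0 : R).
  move=> c0; have cN0 : c != 0 by rewrite gt_eqF.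
  have E n : n.+1%:R * dflat (c * n.+1%:R + -1) =
      c^-1 * ((c * n.+1%:R + -1 + 1) * dflat (c * n.+1%:R + -1)) by field.
  have h : (fun n => c^-1 * ((c * n.+1%:R + -1 + 1) * dflat (c * n.+1%:R + -1))) @ \oo -->
      c^-1 * 0 by apply: cvgM; [exact: cvg_cst|exact: dflat_moment_affine_cvg].
  by rewrite mulr0 -(funext E) in h.
under eq_fun do rewrite E1 E2.
have -> : (0 : R) = 0 * 1 - 1 * 0 by rewrite mul0r mulr0 subrr.
apply: cvgB; apply: cvgM; try exact: lim; exact: flat_affine_cvg.
Qed.

End cutoffs.

(** * The modes and their truncations *)

Section grushin_modes.
Context {R : realType}.
Local Notation bR := (measurableTypeR R).
Local Notation plane := (R * R)%type.
Local Notation e1 := ((1, 0) : plane).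
Local Notation e2 := ((0, 1) : plane).
Variable n : nat.
Implicit Types (x y : R) (z : plane).
Local Notation m := (n%:R : R).

(** The ground state, of energy [n], of the harmonic oscillator [- d_x^2 + n^2 x^2] to which the
    operator reduces on [sin (n y)]. *)
Definition gauss_n x := expR (- (m / 2) * x ^+ 2).
Definition dgauss_n x := - m * x * gauss_n x.
Definition ddgauss_n x := (m ^+ 2 * x ^+ 2 - m) * gauss_n x.
Definition sin_n y := sin (m * y).
Definition dsin_n y := m * cos (m * y).
Definition ddsin_n y := - m ^+ 2 * sin (m * y).

Lemma is_derive_gauss_n x : is_derive x 1 gauss_n (dgauss_n x).
Proof.
have h : is_derive x 1 (fun x => - (m / 2) * x ^+ 2) (- m * x).
  by apply: is_derive_eq; rewrite /GRing.scale /=; field.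
by rewrite /dgauss_n mulrC; exact: is_derive1_comp.
Qed.

Lemma is_derive_dgauss_n x : is_derive x 1 dgauss_n (ddgauss_n x).
Proof.
have h : is_derive x 1 (fun x => - m * x) (- m).
  by apply: is_derive_eq; rewrite /GRing.scale /=; ring.
apply: is_derive_eq (is_deriveM h (is_derive_gauss_n x)) _.
by rewrite /GRing.scale /ddgauss_n /dgauss_n /=; ring.
Qed.

Lemma is_derive_sin_n y : is_derive y 1 sin_n (dsin_n y).
Proof.
have h : is_derive y 1 (fun y => m * y) m.
  by apply: is_derive_eq; rewrite /GRing.scale /=; ring.
by rewrite /dsin_n mulrC; exact: is_derive1_comp.
Qed.

Lemma is_derive_dsin_n y : is_derive y 1 dsin_n (ddsin_n y).
Proof.
have h : is_derive y 1 (fun y => m * y) m.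
  by apply: is_derive_eq; rewrite /GRing.scale /=; ring.
have h2 : is_derive y 1 (fun y => cos (m * y)) (- sin (m * y) * m).
  exact: is_derive1_comp.
apply: is_derive_eq (is_deriveZ m h2) _.
by rewrite /GRing.scale /ddsin_n /=; ring.
Qed.

Lemma continuous_gauss_n : continuous gauss_n.
Proof. exact: is_derive_continuous is_derive_gauss_n. Qed.

Lemma continuous_dgauss_n : continuous dgauss_n.
Proof. exact: is_derive_continuous is_derive_dgauss_n. Qed.

Lemma continuous_ddgauss_n : continuous ddgauss_n.
Proof.
move=> x; apply: (@continuousM _ _ (fun x => m ^+ 2 * x ^+ 2 - m) gauss_n).
  by apply/differentiable_continuous/derivable1_diffP.
exact: continuous_gauss_n.
Qed.

Lemma continuous_sin_n : continuous sin_n.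
Proof. exact: is_derive_continuous is_derive_sin_n. Qed.

Lemma continuous_dsin_n : continuous dsin_n.
Proof. exact: is_derive_continuous is_derive_dsin_n. Qed.

Lemma continuous_ddsin_n : continuous ddsin_n.
Proof.
move=> y; apply: (@continuousM _ _ (cst (- m ^+ 2)) sin_n); first exact: cvg_cst.
exact: continuous_sin_n.
Qed.

Lemma smooth1_gauss_n : smooth1 gauss_n.
Proof.
apply: (smooth1_expR (f := fun x => - (m / 2) * x ^+ 2)).
have -> : (fun x : R => - (m / 2) * x ^+ 2) = cst (- (m / 2)) \* (idfun \* idfun).
  by apply/funext => x; rewrite /= expr2.
by apply: smooth1M; [exact: smooth1_cst|apply: smooth1M; exact: smooth1_id].
Qed.

Lemma smooth1_sin_n : smooth1 sin_n.
Proof.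
have -> : sin_n = (fun y => sin (m * y + 0)) by apply/funext => y; rewrite addr0.
exact/smooth1_affine/smooth1_sin.
Qed.

Definition mode : plane -> R := tensor gauss_n sin_n.
Definition mode_dx : plane -> R := tensor dgauss_n sin_n.
Definition mode_xdy z : R := z.1 * tensor gauss_n dsin_n z.

Lemma eigen_mode : eigen m mode.
Proof.
apply: (@Eigen R m mode mode_dx (tensor ddgauss_n sin_n) (tensor gauss_n dsin_n)
  (tensor gauss_n ddsin_n)).
- split; apply: continuous_tensor; first [exact: continuous_gauss_n
  |exact: continuous_sin_n|exact: continuous_dgauss_n|exact: continuous_ddgauss_n
  |exact: continuous_dsin_n|exact: continuous_ddsin_n].
- move=> z; apply: is_derive_eq (is_derive_tensor e1 (is_derive_gauss_n _) (is_derive_sin_n _)) _.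
  by rewrite /= mul1r !mul0r addr0.
- move=> z; apply: is_derive_eq (is_derive_tensor e1 (is_derive_dgauss_n _) (is_derive_sin_n _)) _.
  by rewrite /= mul1r !mul0r addr0.
- move=> z; apply: is_derive_eq (is_derive_tensor e2 (is_derive_gauss_n _) (is_derive_sin_n _)) _.
  by rewrite /= mul1r !mul0r add0r.
- move=> z; apply: is_derive_eq (is_derive_tensor e2 (is_derive_gauss_n _) (is_derive_dsin_n _)) _.
  by rewrite /= mul1r !mul0r add0r.
- by move=> z; rewrite /mode /tensor /ddgauss_n /ddsin_n /sin_n; ring.
Qed.

Hypothesis n0 : (0 < n)%N.

Lemma gauss_n_gt0 x : 0 < gauss_n x. Proof. exact: expR_gt0. Qed.

Lemma m_ge1 : 1 <= m. Proof. by rewrite ler1n. Qed.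

Lemma gauss_n_le x : gauss_n x <= gweight x.
Proof.
rewrite ler_expR; have := m_ge1; have := sqr_ge0 x; nra.
Qed.

(** Of the exponent [x^2 / 2], one eighth is kept for the weight and [3 x^2 / 8] absorbs [|x|],
    because [|x| <= 1 + 3 x^2 / 8 <= e^(3 x^2 / 8)]. *)
Lemma xgauss_n_le x : `|x| * gauss_n x <= gweight x.
Proof.
apply: le_trans (_ : `|x| * expR (- (3 / 8) * x ^+ 2) * gweight x <= _).
  rewrite -mulrA -expRD ler_wpM2l// ler_expR.
  by have := m_ge1; have := sqr_ge0 x; nra.
rewrite ler_piMl ?(ltW (gweight_gt0 _))// mulNr expRN ler_pdivrMr ?expR_gt0// mul1r.
apply: le_trans (expR_ge1Dx _); rewrite -[x ^+ 2]real_normK ?num_real//.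
by have := sqr_ge0 (3 / 4 * `|x| - 1); nra.
Qed.

Lemma abs_sin_le (w : R) : 0 <= w -> `|sin w| <= w.
Proof.
rewrite le_eqVlt => /predU1P[<-|w0]; first by rewrite sin0 normr0.
have [c _] := MVT w0 (fun x _ => is_derive_sin x)
  (continuous_subspaceT (@continuous_sin R)).
rewrite sin0 !subr0 => ->; rewrite normrM (gtr0_norm w0) ler_piMl ?(ltW w0)//.
exact: cos_max.
Qed.

Lemma sin_n_le y : 0 <= y -> `|sin_n y| <= m * y.
Proof. by move=> y0; apply: abs_sin_le; rewrite mulr_ge0. Qed.

Lemma sin_npi k : sin (k%:R * pi) = 0 :> R.
Proof.
elim: k => [|k IH]; first by rewrite mul0r sin0.
by rewrite -natr1 mulrDl mul1r sinDpi IH oppr0.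
Qed.

Lemma sin_n_le_pi y : y <= pi -> `|sin_n y| <= m * (pi - y).
Proof.
move=> ypi; have -> : `|sin_n y| = `|sin (m * (pi - y))|.
  rewrite mulrBr sinB sin_npi mul0r sub0r normrN normrM.
  by rewrite (sin0cos1 (sin_npi n)) mul1r.
by apply: abs_sin_le; rewrite mulr_ge0// subr_ge0.
Qed.

Lemma sin_n_le1 y : `|sin_n y| <= 1. Proof. exact: sin_max. Qed.

Lemma dsin_n_le y : `|dsin_n y| <= m.
Proof. by rewrite normrM ger0_norm// ler_piMr// cos_max. Qed.

(** Translates instead of rescalings: the ends move to infinity, so the slope stays bounded and
    tends to 0 pointwise, and the Gaussian takes care of the rest. *)
Definition xcut (k : nat) x : R := flat (x + k.+1%:R) * flat (- x + k.+1%:R).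
Definition dxcut (k : nat) x : R :=
  dflat (x + k.+1%:R) * flat (- x + k.+1%:R) - flat (x + k.+1%:R) * dflat (- x + k.+1%:R).

Lemma xcut_affine k : xcut k =
  (fun x => flat (1 * x + k.+1%:R)) \* (fun x => flat (-1 * x + k.+1%:R)).
Proof. by apply/funext => x; rewrite /xcut /= mul1r mulN1r. Qed.

Lemma smooth1_xcut k : smooth1 (xcut k).
Proof. by rewrite xcut_affine; apply: smooth1M; apply: smooth1_affine; exact: smooth1_flat. Qed.

Lemma is_derive_xcut k x : is_derive x 1 (xcut k) (dxcut k x).
Proof.
have d1 := is_derive_affine 1 k.+1%:R (@is_derive_flat R) x.
have d2 := is_derive_affine (-1) k.+1%:R (@is_derive_flat R) x.
rewrite xcut_affine; apply: is_derive_eq (is_deriveM d1 d2) _.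
by rewrite /GRing.scale /dxcut /= !mul1r !mulN1r; ring.
Qed.

Lemma xcut_ge0 k x : 0 <= xcut k x. Proof. by rewrite mulr_ge0 ?flat_ge0. Qed.

Lemma xcut_le1 k x : xcut k x <= 1.
Proof. by rewrite mulr_ile1 ?flat_ge0 ?flat_le1. Qed.

Lemma dxcut_le k x : `|dxcut k x| <= 4.
Proof.
have h (a b : R) : `|flat a * dflat b| <= 2.
  rewrite ger0_norm ?mulr_ge0 ?flat_ge0 ?dflat_ge0//.
  by rewrite -[leRHS]mul1r ler_pM ?flat_ge0 ?dflat_ge0 ?flat_le1 ?dflat_le2.
apply: le_trans (ler_normB _ _) _.
have := h (- x + k.+1%:R) (x + k.+1%:R); rewrite mulrC.
by have := h (x + k.+1%:R) (- x + k.+1%:R); lra.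
Qed.

Lemma xcut_neq0 k x : xcut k x != 0 -> `|x| < k.+1%:R.
Proof.
rewrite /xcut mulf_eq0 negb_or => /andP[h1 h2]; rewrite ltr_norml; apply/andP; split;
  rewrite ltNge; apply/negP => h.
  by move/eqP: h1; apply; apply: flat_le0; lra.
by move/eqP: h2; apply; apply: flat_le0; lra.
Qed.

Lemma xcut_cvg x : xcut k x @[k --> \oo] --> (1 : R).
Proof.
rewrite -[X in _ --> X]mulr1; apply: cvgM.
  have := @flat_affine_cvg R 1 x ltr01; apply: cvg_trans; apply: near_eq_cvg.
  by near=> k; rewrite mul1r addrC.
have := @flat_affine_cvg R 1 (- x) ltr01; apply: cvg_trans; apply: near_eq_cvg.
by near=> k; rewrite mul1r addrC.
Unshelve. all: by end_near. Qed.

Lemma dxcut_cvg x : dxcut k x @[k --> \oo] --> (0 : R).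
Proof.
have E (y : R) k : y + k.+1%:R = 1 * k.+1%:R + y by rewrite mul1r addrC.
have f (y : R) : flat (y + k.+1%:R) @[k --> \oo] --> (1 : R).
  by under eq_fun do rewrite E; exact: flat_affine_cvg.
have d (y : R) : dflat (y + k.+1%:R) @[k --> \oo] --> (0 : R).
  by under eq_fun do rewrite E; exact: dflat_affine_cvg.
have -> : (0 : R) = 0 * 1 - 1 * 0 by rewrite mul0r mulr0 subrr.
by apply: cvgB; apply: cvgM.
Qed.

Definition cut_mode k : plane -> R :=
  tensor (gauss_n \* xcut k) (sin_n \* cutoff pi k.+1%:R).

Lemma test_cut_mode k : test_function Omega (cut_mode k).
Proof.
pose N : R := k.+1%:R; have N0 : 0 < N by rewrite ltr0n.
pose K : set plane := `[- N, N] `*` `[N^-1, pi - N^-1].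
have cK : compact K by apply: compact_setX; exact: segment_compact.
have clK : closed K.
  by apply: compact_closed => //; exact: norm_hausdorff.
have sK : [set z | cut_mode k z != 0] `<=` K.
  move=> z /= zN0.
  have /xcut_neq0 hx : xcut k z.1 != 0.
    by apply: contra_neq zN0 => E; rewrite /cut_mode /tensor /= E mulr0 mul0r.
  have [h1 h2] : 1 < N * z.2 /\ 1 < N * (pi - z.2).
    apply: cutoff_neq0; apply: contra_neq zN0 => E.
    by rewrite /cut_mode /tensor /= E !mulr0.
  split; rewrite /= in_itv /=.
    by rewrite -ler_norml ltW.
  have hy : N^-1 < z.2 by rewrite -[ltLHS]mulr1 ltr_pdivrMl.
  have hy' : N^-1 < pi - z.2 by rewrite -[ltLHS]mulr1 ltr_pdivrMl.
  by rewrite (ltW hy) /= lerBrDr -lerBrDl (ltW hy').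
have clsK : closure [set z | cut_mode k z != 0] `<=` K.
  by rewrite [K](closure_id K).1//; exact: closureS.
split.
- apply: tensor_sum_smooth; apply: tensor_sum1; apply: smooth1M.
  + exact: smooth1_gauss_n.
  + exact: smooth1_xcut.
  + exact: smooth1_sin_n.
  + exact: smooth1_cutoff.
- by apply: subclosed_compact clsK => //; exact: closed_closure.
- apply: subset_trans clsK _ => z [_]; rewrite /= in_itv /= => /andP[h1 h2].
  split => //=; rewrite in_itv /=.
  have iN : 0 < N^-1 by rewrite invr_gt0.
  by rewrite (lt_le_trans iN h1) (le_lt_trans h2)// ltrBlDr ltrDl.
Qed.

End grushin_modes.

Section modes_in_V.
Context {R : realType}.
Local Notation bR := (measurableTypeR R).
Local Notation plane := (R * R)%type.
Variables (n : nat) (n0 : (0 < n)%N).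
Implicit Types (x y : R) (z : plane).
Local Notation m := (n%:R : R).

Lemma dx_cut_mode k z : dx (cut_mode n k) z =
  (dgauss_n n z.1 * xcut k z.1 + gauss_n n z.1 * dxcut k z.1)
  * (sin_n n z.2 * cutoff pi k.+1%:R z.2).
Proof.
have da : is_derive z.1 1 (gauss_n n \* xcut k)
    (gauss_n n z.1 * dxcut k z.1 + xcut k z.1 * dgauss_n n z.1).
  exact: is_deriveM (is_derive_gauss_n n z.1) (is_derive_xcut k z.1).
have db : is_derive z.2 1 (sin_n n \* cutoff pi k.+1%:R)
    (sin_n n z.2 * dcutoff pi k.+1%:R z.2 + cutoff pi k.+1%:R z.2 * dsin_n n z.2).
  exact: is_deriveM (is_derive_sin_n n z.2) (is_derive_cutoff pi k.+1%:R z.2).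
have [_] := is_derive_tensor ((1, 0) : plane) da db.
by rewrite /dx => ->; rewrite /GRing.scale /=; ring.
Qed.

Lemma xdy_cut_mode k z : xdy (cut_mode n k) z =
  z.1 * (gauss_n n z.1 * xcut k z.1 *
   (dsin_n n z.2 * cutoff pi k.+1%:R z.2 + sin_n n z.2 * dcutoff pi k.+1%:R z.2)).
Proof.
have da : is_derive z.1 1 (gauss_n n \* xcut k)
    (gauss_n n z.1 * dxcut k z.1 + xcut k z.1 * dgauss_n n z.1).
  exact: is_deriveM (is_derive_gauss_n n z.1) (is_derive_xcut k z.1).
have db : is_derive z.2 1 (sin_n n \* cutoff pi k.+1%:R)
    (sin_n n z.2 * dcutoff pi k.+1%:R z.2 + cutoff pi k.+1%:R z.2 * dsin_n n z.2).
  exact: is_deriveM (is_derive_sin_n n z.2) (is_derive_cutoff pi k.+1%:R z.2).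
have [_] := is_derive_tensor ((0, 1) : plane) da db.
by rewrite /xdy => ->; rewrite /GRing.scale /=; ring.
Qed.

Lemma continuous_mode : continuous (mode n : plane -> R).
Proof.
by apply: continuous_tensor; [exact: continuous_gauss_n|exact: continuous_sin_n].
Qed.

Lemma continuous_mode_dx : continuous (mode_dx n : plane -> R).
Proof.
by apply: continuous_tensor; [exact: continuous_dgauss_n|exact: continuous_sin_n].
Qed.

Lemma continuous_mode_xdy : continuous (mode_xdy n : plane -> R).
Proof.
apply: (@continuous_mul R (fun z => z.1)); first by move=> z; exact: cvg_fst.
by apply: continuous_tensor; [exact: continuous_gauss_n|exact: continuous_dsin_n].
Qed.

Lemma mode_le z : `|mode n z| <= gauss_n n z.1.
Proof.
rewrite normrM (gtr0_norm (gauss_n_gt0 _ _)) ler_piMr ?(ltW (gauss_n_gt0 _ _))//.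
exact: sin_n_le1.
Qed.

Lemma dgauss_n_le x : `|dgauss_n n x| <= m * gweight x.
Proof.
rewrite /dgauss_n -mulrA mulNr normrN normrM (ger0_norm (ler0n _ n)) normrM.
by rewrite (gtr0_norm (gauss_n_gt0 _ _)) ler_wpM2l// xgauss_n_le.
Qed.

Lemma mode_L2 : mode n \in (@L2Omega R).
Proof.
apply: (@weighted_L2 _ _ 1); first exact: continuous_measurable_plane continuous_mode.
by move=> z _; rewrite mul1r (le_trans (mode_le _))// gauss_n_le.
Qed.

Lemma mode_dx_L2 : mode_dx n \in (@L2Omega R).
Proof.
apply: (@weighted_L2 _ _ m); first exact: continuous_measurable_plane continuous_mode_dx.
move=> z _; rewrite /mode_dx /tensor normrM -[leRHS]mulr1 ler_pM ?dgauss_n_le//.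
exact: sin_n_le1.
Qed.

Lemma mode_xdy_L2 : mode_xdy n \in (@L2Omega R).
Proof.
apply: (@weighted_L2 _ _ m); first exact: continuous_measurable_plane continuous_mode_xdy.
move=> z _; rewrite /mode_xdy /tensor mulrA normrM normrM [leRHS]mulrC.
rewrite (gtr0_norm (gauss_n_gt0 _ _)) ler_pM ?mulr_ge0 ?(ltW (gauss_n_gt0 _ _))//.
  exact: xgauss_n_le.
exact: dsin_n_le.
Qed.

Lemma itv_Omega z : Omega z -> 0 < z.2 < pi.
Proof. by move=> [_]; rewrite /= in_itv. Qed.

Lemma abs_cut_sub1 (a : R) : 0 <= a -> a <= 1 -> `|a - 1| <= 1.
Proof. by move=> a0 a1; rewrite ler_norml; apply/andP; split; lra. Qed.

Lemma cut_sub1_le k z : `|xcut k z.1 * cutoff pi k.+1%:R z.2 - 1| <= 1.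
Proof.
apply: abs_cut_sub1; first by rewrite mulr_ge0 ?xcut_ge0 ?cutoff_ge0.
by rewrite mulr_ile1 ?xcut_ge0 ?cutoff_ge0 ?xcut_le1 ?cutoff_le1.
Qed.

Lemma cut_mode_cvg : distL2 (cut_mode n k : plane -> R) (mode n) @[k --> \oo] --> 0%E.
Proof.
apply: (@weighted_cvg _ _ _ 1).
- by move=> k; exact: continuous_measurable_plane (test_continuous (test_cut_mode n k)).
- exact: continuous_measurable_plane continuous_mode.
- move=> k z _; rewrite mul1r; apply: le_trans (gauss_n_le n0 _).
  have -> : cut_mode n k z - mode n z =
      mode n z * (xcut k z.1 * cutoff pi k.+1%:R z.2 - 1).
    by rewrite /cut_mode /mode /tensor /=; ring.
  rewrite normrM -[leRHS]mulr1 ler_pM ?mode_le//.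
  exact: cut_sub1_le.
- move=> z /itv_Omega hz; rewrite -[mode n z]mulr1 -[1 in X in _ --> X]mulr1.
  have E k : cut_mode n k z = mode n z * (xcut k z.1 * cutoff pi k.+1%:R z.2).
    by rewrite /cut_mode /mode /tensor /=; ring.
  under eq_fun do rewrite E.
  apply: cvgM; first exact: cvg_cst.
  by apply: cvgM; [exact: xcut_cvg|exact: cutoff_cvg].
Qed.

Lemma dx_cut_mode_cvg : distL2 (dx (cut_mode n k : plane -> R)) (mode_dx n) @[k --> \oo] --> 0%E.
Proof.
apply: (@weighted_cvg _ _ _ (m + 4)).
- move=> k; apply: continuous_measurable_plane.
  exact: test_continuous (test_derive ((1, 0) : plane) (test_cut_mode n k)).
- exact: continuous_measurable_plane continuous_mode_dx.
- move=> k z _; rewrite dx_cut_mode.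
  have -> : (dgauss_n n z.1 * xcut k z.1 + gauss_n n z.1 * dxcut k z.1)
      * (sin_n n z.2 * cutoff pi k.+1%:R z.2) - mode_dx n z =
      dgauss_n n z.1 * (sin_n n z.2 * (xcut k z.1 * cutoff pi k.+1%:R z.2 - 1))
      + gauss_n n z.1 * (dxcut k z.1 * (sin_n n z.2 * cutoff pi k.+1%:R z.2)).
    by rewrite /mode_dx /tensor /=; ring.
  apply: le_trans (ler_normD _ _) _; rewrite [leRHS]mulrDl; apply: lerD.
    rewrite normrM -[leRHS]mulr1 ler_pM ?dgauss_n_le//.
    by rewrite normrM mulr_ile1 ?sin_n_le1 ?cut_sub1_le.
  have h1 : `|sin_n n z.2 * cutoff pi k.+1%:R z.2| <= 1.
    rewrite normrM mulr_ile1 ?sin_n_le1//.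
    by rewrite ger0_norm ?cutoff_ge0 ?cutoff_le1.
  have h2 : `|dxcut k z.1 * (sin_n n z.2 * cutoff pi k.+1%:R z.2)| <= 4.
    by rewrite normrM -[leRHS]mulr1; apply: ler_pM => //; exact: dxcut_le.
  rewrite normrM [leRHS]mulrC; apply: ler_pM => //.
  by rewrite (gtr0_norm (gauss_n_gt0 _ _)) gauss_n_le.
- move=> z /itv_Omega hz; under eq_fun do rewrite dx_cut_mode.
  have -> : mode_dx n z =
      (dgauss_n n z.1 * 1 + gauss_n n z.1 * 0) * (sin_n n z.2 * 1).
    by rewrite /mode_dx /tensor; ring.
  apply: cvgM.
    apply: cvgD; apply: cvgM; try exact: cvg_cst; first exact: xcut_cvg.
    exact: dxcut_cvg.
  by apply: cvgM; [exact: cvg_cst|exact: cutoff_cvg].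
Qed.

Lemma xdy_cut_mode_cvg : distL2 (xdy (cut_mode n k : plane -> R)) (mode_xdy n) @[k --> \oo] --> 0%E.
Proof.
apply: (@weighted_cvg _ _ _ (m + 6 * m)).
- move=> k; apply: continuous_measurable_plane.
  apply: (@continuous_mul R (fun z => z.1) ('D_((0, 1) : plane) (cut_mode n k))).
    by move=> z; exact: cvg_fst.
  exact: test_continuous (test_derive ((0, 1) : plane) (test_cut_mode n k)).
- exact: continuous_measurable_plane continuous_mode_xdy.
- move=> k z /itv_Omega/andP[z0 zpi]; rewrite xdy_cut_mode.
  have -> : z.1 * (gauss_n n z.1 * xcut k z.1 *
     (dsin_n n z.2 * cutoff pi k.+1%:R z.2 + sin_n n z.2 * dcutoff pi k.+1%:R z.2))
     - mode_xdy n z =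
     z.1 * gauss_n n z.1 * (dsin_n n z.2 * (xcut k z.1 * cutoff pi k.+1%:R z.2 - 1)
      + xcut k z.1 * (sin_n n z.2 * dcutoff pi k.+1%:R z.2)).
    by rewrite /mode_xdy /tensor /=; ring.
  rewrite mulrC [leRHS]mulrC normrM [leRHS]mulrC ler_pM//; last first.
    by rewrite normrM (gtr0_norm (gauss_n_gt0 _ _)) xgauss_n_le.
  apply: le_trans (ler_normD _ _) _; apply: lerD.
    rewrite normrM -[leRHS]mulr1 ler_pM ?dsin_n_le//.
    exact: cut_sub1_le.
  rewrite normrM ger0_norm ?xcut_ge0// -[leRHS]mul1r ler_pM ?xcut_ge0 ?xcut_le1//.
  (* The Dirichlet condition enters here: [sin (n y)] vanishes linearly at 0 and [pi], which tames
     the derivative of the cutoff in [y]. *)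
  rewrite normrM; apply: dcutoff_moment => //.
  + by rewrite sin_n_le// ltW.
  + by rewrite sin_n_le_pi// ltW.
- move=> z /itv_Omega hz; under eq_fun do rewrite xdy_cut_mode.
  have -> : mode_xdy n z = z.1 * (gauss_n n z.1 * 1 * (dsin_n n z.2 * 1 + sin_n n z.2 * 0)).
    by rewrite /mode_xdy /tensor; ring.
  apply: cvgM; first exact: cvg_cst.
  apply: cvgM; first by apply: cvgM; [exact: cvg_cst|exact: xcut_cvg].
  apply: cvgD; apply: cvgM; try exact: cvg_cst; first exact: cutoff_cvg.
  exact: dcutoff_cvg.
Qed.

Lemma mode_in_V : V (mode n : plane -> R).
Proof.
exists (mode_dx n), (mode_xdy n); split.
- exact: mode_L2.
- exact: mode_dx_L2.
- exact: mode_xdy_L2.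
- exists (cut_mode n); split.
  + exact: test_cut_mode.
  + exact: cut_mode_cvg.
  + exact: dx_cut_mode_cvg.
  + exact: xdy_cut_mode_cvg.
Qed.

End modes_in_V.

(** * Duhamel formula and moments *)

Section ae_equal_integrals.
Context d (T : measurableType d) (R : realType) (mu : {measure set T -> \bar R}).
Import HBNNSimple.
Local Open Scope ereal_scope.

(* A simple function below [f] is below [g] once it is set to zero on [N]. *)
Let ge0_le_integral_off_null (f g : T -> \bar R) (N : set T) : measurable N -> mu N = 0 ->
  (forall x, 0 <= f x) -> (forall x, 0 <= g x) -> (forall x, ~ N x -> f x = g x) ->
  \int[mu]_x f x <= \int[mu]_x g x.
Proof.
move=> mN N0 f0 g0 fg; rewrite !ge0_integralTE//.
apply: ge_ereal_sup => _ [h hf <-].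
have mNC : measurable (~` N) by exact: measurableC.
apply: ereal_sup_ubound; exists (proj_nnsfun h mNC) => [x|].
  rewrite /proj_nnsfun /= mindicE; have [xN|xN] := boolP (x \in ~` N).
    by rewrite mulr1 -fg ?hf//; move: xN; rewrite in_setE.
  by rewrite mulr0.
rewrite -!integralT_nnsfun; apply: ge0_ae_eq_integral => //.
- by apply/measurable_EFinP; exact: measurable_funPT.
- by apply/measurable_EFinP; exact: measurable_funPT.
- by move=> x _; rewrite lee_fin.
- by move=> x _; rewrite lee_fin.
exists N; split => // x /=; apply: contra_notP => Nx _.
by rewrite /proj_nnsfun /= mindicE mem_set ?mulr1.
Qed.

(** Stated for arbitrary functions, because measurability of [t -> formV (g t) (mode n)] is not at
    hand: [formV] rests on a choice of gradients for each [t]. The argument therefore goes through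
    simple functions. *)
Lemma integral_ae_eq (D : set T) (f g : T -> \bar R) :
  {ae mu, forall x, D x -> f x = g x} ->
  \int[mu]_(x in D) f x = \int[mu]_(x in D) g x.
Proof.
move=> [N [mN N0 sN]]; rewrite integral_mkcond [RHS]integral_mkcond.
have E x : ~ N x -> (f \_ D) x = (g \_ D) x.
  move=> Nx; rewrite !patchE; case: ifPn => // /set_mem Dx.
  by apply: contra_notP Nx => h; apply: sN => /= /(_ Dx).
rewrite integralE [RHS]integralE.
by congr (_ - _); apply/eqP; rewrite eq_le; apply/andP; split;
  apply: (ge0_le_integral_off_null mN N0) => // x /E; rewrite ?funeposE ?funenegE => ->.
Qed.

End ae_equal_integrals.

Section real_dominated_convergence.
Context d (T : measurableType d) (R : realType) (mu : {measure set T -> \bar R}).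

Lemma Rintegral_dominated_cvg (D : set T) (h : nat -> T -> R) (f : T -> R) (g : T -> R) :
  measurable D -> (forall k, measurable_fun D (h k)) -> 
  mu.-integrable D (EFin \o g) ->
  (forall x, D x -> h k x @[k --> \oo] --> f x) ->
  (forall k x, D x -> `|h k x| <= g x) ->
  (\int[mu]_(x in D) h k x) @[k --> \oo] --> \int[mu]_(x in D) f x.
Proof.
move=> mD mh ig hf hg.
have := @dominated_cvg _ _ _ mu D mD (fun k => EFin \o h k) (EFin \o f) (EFin \o g).
have mh' k : measurable_fun D (EFin \o h k) by exact: (measurable_EFinP D _).2 (mh k).
have lim x : D x -> (EFin \o h k) x @[k --> \oo] --> (EFin \o f) x.
  by move=> Dx; apply: cvg_EFin; [exact: nearW|exact: hf].
have dom k x : D x -> (`|(EFin \o h k) x| <= (EFin \o g) x)%E.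
  by move=> Dx; rewrite lee_fin; exact: hg.
have fin x : D x -> (EFin \o g) x \is a fin_num by [].
move=> /(_ mh' lim fin ig dom).
have fi : mu.-integrable D (EFin \o f).
  apply: le_integrable ig => //.
    exact: (emeasurable_fun_cvg (fun k => EFin \o h k) (EFin \o f) mh' lim).
  move=> x Dx; rewrite /= lee_fin [leRHS]ger0_norm; last exact: le_trans (hg 0%N x Dx).
  apply: (cvgr_to_le (cvg_norm (hf x Dx))); first exact: nearW (fun k => hg k x Dx).
have hi k : mu.-integrable D (EFin \o h k).
  apply: le_integrable ig => // x Dx; apply: (le_trans (dom k x Dx)).
  by rewrite /= lee_fin ler_norm.
move=> L; rewrite /Rintegral; apply: fine_cvg; rewrite fineK//.
exact: integrable_fin_num.
Qed.

End real_dominated_convergence.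

Section time_interval.
Context {R : realType}.
Local Notation bR := (measurableTypeR R).
Local Notation leb := (@lebesgue_measure R).
Variables (T : R) (T0 : 0 < T).
Implicit Types f g h F c b C D : R -> R.

Local Notation I f := (\int[leb]_(t in `]0, T[) f t).

Lemma integrable_continuous_itvoo f : continuous f -> leb.-integrable `]0, T[ (EFin \o f).
Proof.
move=> cf; apply: (@integrableS _ _ _ leb `[0, T]) => //.
  by apply: subset_itv; rewrite bnd_simp.
apply: continuous_compact_integrable; first exact: segment_compact.
exact: continuous_subspaceT.
Qed.

Lemma integral_derivative F f : continuous f -> (forall t : R, is_derive t 1 F (f t)) ->
  I f = F T - F 0.
Proof.
move=> cf Ff; have mf (D : set bR) : measurable D -> measurable_fun D (EFin \o f).
  move=> mD; apply: (measurable_EFinP D _).2; apply: measurable_funTS.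
  exact: continuous_measurable_fun.
rewrite /Rintegral (@integral_itv_obnd_cbnd R 0 (BLeft T) (EFin \o f)); last exact: mf.
rewrite (@integral_itv_bndo_bndc R (BLeft 0) T (EFin \o f)); last exact: mf.
by rewrite (@FTC_everywhere _ F f 0 T T0 cf Ff).
Qed.

Lemma integrable_itvoo_mul b f : leb.-integrable `]0, T[ (EFin \o b) -> continuous f ->
  leb.-integrable `]0, T[ (EFin \o (fun t => b t * f t)).
Proof.
move=> ib cf.
have /compact_bounded[M [_ fM]] := continuous_compact
  (continuous_subspaceT cf) (@segment_compact R 0 T).
have fM1 t : t \in `]0, T[ -> `|f t| <= `|M| + 1.
  move=> tT; apply: fM; first by rewrite (le_lt_trans (ler_norm M))// ltrDl.
  by exists t => //; move: tT; apply: subset_itv; rewrite bnd_simp.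
have iM : leb.-integrable `]0, T[ (fun t => ((`|M| + 1)%:E * (b t)%:E)%E).
  exact: integrableZl.
apply: le_integrable iM => //.
  apply: (measurable_EFinP _ _).2; apply: measurable_funM.
    exact: (measurable_EFinP _ b).1 (measurable_int _ ib).
  by apply: measurable_funTS; exact: continuous_measurable_fun.
move=> t tT; rewrite /= lee_fin !normrM mulrC ler_wpM2r//.
by rewrite (le_trans (fM1 t tT))// ler_norm.
Qed.

End time_interval.

(** * The integrating factor and cutoffs in time *)

Section duhamel.
Context {R : realType}.
Local Notation bR := (measurableTypeR R).
Local Notation leb := (@lebesgue_measure R).
Variables (T : R) (T0 : 0 < T).
Implicit Types f g h F c b C D : R -> R.

Local Notation I f := (\int[leb]_(t in `]0, T[) f t).
Local Notation chi k := (cutoff T k.+1%:R).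
Local Notation dchi k := (dcutoff T k.+1%:R).

Lemma continuous_cutoff L N : continuous (@cutoff R L N).
Proof. exact: is_derive_continuous (is_derive_cutoff L N). Qed.

Lemma smooth1_continuous_derivative F f : smooth1 F ->
  (forall t : R, is_derive t 1 F (f t)) -> continuous f.
Proof.
move=> /smooth1_derive[g Fg /smooth1_derive[g' gg' _]] Ff.
have -> : f = g by apply/funext => t; have [_ <-] := Ff t; have [_ ->] := Fg t.
exact: is_derive_continuous gg'.
Qed.

Lemma continuous_dcutoff L N : continuous (@dcutoff R L N).
Proof.
exact: smooth1_continuous_derivative (smooth1_cutoff L N) (is_derive_cutoff L N).
Qed.

Lemma cutoff_boundary k : chi k 0 = 0 /\ chi k T = 0.
Proof.
split; rewrite /cutoff.
  by rewrite mulr0 add0r flat_le0 ?mul0r// lerN10.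
by rewrite [X in _ * flat X](_ : _ = -1) ?[flat (-1)]flat_le0 ?mulr0 ?lerN10//; ring.
Qed.

(** Each of the two factors of the cutoff is monotone with values in [[0, 1]], so each adds at most
    1 to the total variation. *)
Lemma integral_abs_dcutoff k : I (fun t => `|dchi k t|) <= 2.
Proof.
pose N : R := k.+1%:R; have N0 : 0 < N by rewrite ltr0n.
pose F (t : R) := flat (N * t + -1) - flat (- N * t + (N * T - 1)).
pose f (t : R) := N * dflat (N * t + -1) + N * dflat (- N * t + (N * T - 1)).
have Ff (t : R) : is_derive t 1 F (f t).
  have d1 := is_derive_affine N (-1) (@is_derive_flat R) t.
  have d2 := is_derive_affine (- N) (N * T - 1) (@is_derive_flat R) t.
  apply: is_derive_eq (is_deriveB d1 d2) _.
  by rewrite /f; ring.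
have sF : smooth1 F.
  have -> : F = (fun t => flat (N * t + -1)) \+ (cst (-1) \* (fun t => flat (- N * t + (N * T - 1)))).
    by apply/funext => t; rewrite /F /= mulN1r.
  apply: smooth1D; last apply: smooth1M; try exact: smooth1_cst.
    by apply: smooth1_affine; exact: smooth1_flat.
  by apply: smooth1_affine; exact: smooth1_flat.
have cf := smooth1_continuous_derivative sF Ff.
apply: le_trans (_ : I f <= _).
  apply: le_Rintegral => //.
  - by apply: integrable_continuous_itvoo => t; apply: cvg_norm; exact: continuous_dcutoff.
  - exact: integrable_continuous_itvoo.
  move=> t _; rewrite /dcutoff; apply: le_trans (ler_normB _ _) _.
  rewrite -/N !normrM (gtr0_norm N0) !(ger0_norm (flat_ge0 _)) !(ger0_norm (dflat_ge0 _)).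
  have d0 w : 0 <= N * dflat w by rewrite mulr_ge0 ?dflat_ge0// ltW.
  by apply: lerD; [rewrite ler_piMr ?flat_le1|rewrite ler_piMl ?flat_le1].
rewrite (integral_derivative T0 cf Ff) /F.
have := @flat_ge0 R; have := @flat_le1 R => h1 h0.
have := h1 (N * T + -1); have := h0 (- N * T + (N * T - 1)).
have := h0 (N * 0 + -1); have := h1 (- N * 0 + (N * T - 1)); lra.
Qed.

(** Near the ends [D] is below [e] by continuity; elsewhere [t (T - t)] is at least [d1 * d2] and
    [D] is bounded. The first term will meet the total variation of the cutoffs, the second
    [dcutoff_moment]. *)
Lemma bounded_by_parabola D : continuous D -> D 0 = 0 -> D T = 0 ->
  forall e, 0 < e -> exists2 M, 0 < M &
    forall t, t \in `]0, T[ -> `|D t| <= e + M * (t * (T - t)).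
Proof.
move=> cD D0 DT e e0.
have /compact_bounded[B [_ hB]] := continuous_compact
  (continuous_subspaceT cD) (@segment_compact R 0 T).
have DB t : t \in `]0, T[ -> `|D t| <= `|B| + 1.
  move=> tT; apply: hB; first by rewrite (le_lt_trans (ler_norm B))// ltrDl.
  by exists t => //; move: tT; apply: subset_itv; rewrite bnd_simp.
have near0 s : D s = 0 -> exists2 d, 0 < d & forall t, `|s - t| < d -> `|D t| <= e.
  move=> Ds; have /cvgrPdist_le/(_ _ e0) := cD s.
  move=> /nbhs_ballP[d d0 h]; exists d => // t /h.
  by rewrite /= Ds sub0r normrN.
have [d1 d10 h1] := near0 0 D0; have [d2 d20 h2] := near0 T DT.
have d120 : 0 < d1 * d2 by exact: mulr_gt0.
exists ((`|B| + 1) / (d1 * d2)); first by rewrite divr_gt0// ltr_wpDl.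
move=> t tT; have := tT; rewrite in_itv /= => /andP[t0 tT'].
have p0 : 0 <= (`|B| + 1) / (d1 * d2) * (t * (T - t)).
  apply: mulr_ge0; first by apply: divr_ge0; [exact: addr_ge0|exact: ltW].
  by apply: mulr_ge0; [exact: ltW|rewrite subr_ge0 ltW].
have [td|td] := ltP t d1.
  apply: le_trans (h1 t _) _; last by rewrite lerDl.
  by rewrite sub0r normrN gtr0_norm.
have [Td|Td] := ltP (T - t) d2.
  apply: le_trans (h2 t _) _; last by rewrite lerDl.
  by rewrite gtr0_norm// subr_gt0.
apply: le_trans (DB t tT) _; rewrite -mulrA ler_wpDl ?(ltW e0)//.
rewrite ler_peMr ?addr_ge0// mulrC ler_pdivlMr// mul1r.
by rewrite ler_pM// ltW.
Qed.

Lemma dcutoff_pairing_cvg0 D : continuous D -> D 0 = 0 -> D T = 0 ->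
  I (fun t => D t * dchi k t) @[k --> \oo] --> (0 : R).
Proof.
move=> cD D0 DT; apply/cvgr0Pnorm_le => e e0.
(* The total variation is at most 2, so this term costs [e / 2]; the parabola supplies the other
   half. *)
have e4 : 0 < e / 4 by rewrite divr_gt0.
have [M M0 hM] := bounded_by_parabola cD D0 DT e4.
have cabs k : continuous (fun t => `|dchi k t|).
  by move=> t; apply: cvg_norm; exact: continuous_dcutoff.
have cpar : continuous (fun t : R => t * (T - t)).
  by move=> t; apply: cvgM; [exact: cvg_id|apply: cvgB; [exact: cvg_cst|exact: cvg_id]].
have lim : I (fun t => t * (T - t) * `|dchi k t|) @[k --> \oo] --> (0 : R).
  have := @Rintegral_dominated_cvg _ bR R leb `]0, T[
    (fun k t => t * (T - t) * `|dchi k t|) (cst 0) (cst (6 * T)).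
  rewrite Rintegral_cst// mul0r; apply => //.
  - move=> k; apply: measurable_funTS; apply: continuous_measurable_fun => t.
    by apply: cvgM; [exact: cpar|exact: cabs].
  - by apply: (@integrable_continuous_itvoo R T (cst (6 * T))) => t; exact: cvg_cst.
  - move=> t; rewrite /= in_itv /= => tT.
    have : (fun k => t * (T - t) * `|dchi k t|) @ \oo --> t * (T - t) * `|0 : R|.
      by apply: cvgM; [exact: cvg_cst|apply: cvg_norm; exact: dcutoff_cvg].
    by rewrite normr0 mulr0.
  - move=> k t; rewrite /= in_itv /= => /andP[t0 tT].
    have tT0 : 0 < T - t by rewrite subr_gt0.
    rewrite normrM normr_id ger0_norm; last exact: mulr_ge0 (ltW t0) (ltW tT0).
    apply: dcutoff_moment => //; [exact: ltW|exact: mulr_ge0 (ltW t0) (ltW tT0)|..].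
      by rewrite mulrC ler_pM2r// gerBl ltW.
    by rewrite ler_pM2r// ltW.
have eM : 0 < e / (2 * M) by rewrite divr_gt0// mulr_gt0.
have /cvgr0Pnorm_le/(_ _ eM) small := lim.
near=> k.
have hk : `|I (fun t => t * (T - t) * `|dchi k t|)| <= e / (2 * M) by near: k.
have int1 : leb.-integrable `]0, T[ (EFin \o (fun t => e / 4 * `|dchi k t|)).
  by apply: (integrable_continuous_itvoo) => t; apply: cvgM; [exact: cvg_cst|exact: cabs].
have int2 : leb.-integrable `]0, T[ (EFin \o (fun t => M * (t * (T - t) * `|dchi k t|))).
  apply: (integrable_continuous_itvoo) => t; apply: cvgM; first exact: cvg_cst.
  by apply: cvgM; [exact: cpar|exact: cabs].
have intD : leb.-integrable `]0, T[ (EFin \o (fun t => D t * dchi k t)).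
  by apply: (integrable_continuous_itvoo) => t; apply: cvgM;
    [exact: cD|exact: continuous_dcutoff].
apply: le_trans (le_normr_Rintegral _ _) _ => //.
apply: le_trans (_ : I (fun t => e / 4 * `|dchi k t| + M * (t * (T - t) * `|dchi k t|)) <= _).
  apply: le_Rintegral => //.
  - exact: integrable_norm.
  - by have := integrableD _ int1 int2; apply.
  move=> t tT; rewrite normrM [M * _]mulrA -mulrDl ler_wpM2r//; exact: hM.
rewrite RintegralD// !RintegralZl//; last 2 first.
- by apply: (integrable_continuous_itvoo) => t; apply: cvgM; [exact: cpar|exact: cabs].
- exact: (integrable_continuous_itvoo).
have h1 := integral_abs_dcutoff k.
have h2 : I (fun t => t * (T - t) * `|dchi k t|) <= e / (2 * M).
  exact: le_trans (ler_norm _) hk.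
apply: le_trans (_ : e / 4 * 2 + M * (e / (2 * M)) <= _).
  by apply: lerD; rewrite ler_pM2l.
rewrite le_eqVlt; apply/orP; left; apply/eqP; field; exact: lt0r_neq0.
Unshelve. all: by end_near. Qed.
(** The derivatives of the cutoffs tend to the Dirac mass at 0 minus the one at [T]. Subtracting
    [C 0] times the affine function [L], with [L 0 = 1] and [L T = 0], reduces to a function
    vanishing at both ends; for [L] itself an integration by parts gives the limit. *)
Lemma dcutoff_pairing_cvg C : continuous C -> C T = 0 ->
  I (fun t => C t * dchi k t) @[k --> \oo] --> C 0.
Proof.
move=> cC CT; pose L (t : R) := 1 - T^-1 * t.
have cL : continuous L.
  by move=> t; apply: cvgB; [exact: cvg_cst|apply: cvgM; [exact: cvg_cst|exact: cvg_id]].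
have TN0 : T != 0 by rewrite gt_eqF.
pose D t := C t - C 0 * L t.
have cD : continuous D.
  by move=> t; apply: cvgB; [exact: cC|apply: cvgM; [exact: cvg_cst|exact: cL]].
have D0 : D 0 = 0 by rewrite /D /L mulr0 subr0 mulr1 subrr.
have DT : D T = 0 by rewrite /D /L mulVf// subrr mulr0 CT subr0.
have cLd k : continuous (fun t => L t * dchi k t).
  by move=> t; apply: cvgM; [exact: cL|exact: continuous_dcutoff].
have cDd k : continuous (fun t => D t * dchi k t).
  by move=> t; apply: cvgM; [exact: cD|exact: continuous_dcutoff].
have cTc k : continuous (fun t => T^-1 * chi k t).
  by move=> t; apply: cvgM; [exact: cvg_cst|exact: continuous_cutoff].
have IL k : I (fun t => L t * dchi k t) = I (fun t => T^-1 * chi k t).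
  have LF (t : R) : is_derive t 1 (L \* chi k) (L t * dchi k t - T^-1 * chi k t).
    have dL : is_derive t 1 L (- T^-1).
      by rewrite /L; apply: is_derive_eq; rewrite /GRing.scale /=; ring.
    apply: is_derive_eq (is_deriveM dL (is_derive_cutoff T k.+1%:R t)) _.
    by rewrite /GRing.scale /=; ring.
  have := integral_derivative T0 _ LF; have [c0 cT] := cutoff_boundary k.
  rewrite /= c0 cT !mulr0 subrr RintegralB//; [|exact: (integrable_continuous_itvoo)..].
  move=> h; apply/eqP; rewrite -subr_eq0; apply/eqP/h => t.
  by apply: cvgB; [exact: cLd|exact: cTc].
have lim1 : I (fun t => L t * dchi k t) @[k --> \oo] --> (1 : R).
  rewrite (funext IL).
  have I1 : I (cst T^-1) = 1.
    by rewrite Rintegral_cst//= lebesgue_measure_itv /= lte_fin T0 /= subr0 mulVf.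
  have := @Rintegral_dominated_cvg _ bR R leb `]0, T[
    (fun k t => T^-1 * chi k t) (cst T^-1) (cst T^-1).
  rewrite I1; apply => //.
  - by move=> k; apply: measurable_funTS; apply: continuous_measurable_fun; exact: cTc.
  - by apply: (@integrable_continuous_itvoo R T (cst T^-1)) => t; exact: cvg_cst.
  - move=> t; rewrite /= in_itv /= => tT.
    have : (fun k => T^-1 * chi k t) @ \oo --> T^-1 * 1.
      by apply: cvgM; [exact: cvg_cst|exact: cutoff_cvg].
    by rewrite mulr1.
  - move=> k t _; rewrite ger0_norm; last first.
      by apply: mulr_ge0; [rewrite invr_ge0 ltW|exact: cutoff_ge0].
    by rewrite ler_piMr ?invr_ge0 ?cutoff_le1 ?(ltW T0).
have E k : I (fun t => C t * dchi k t) =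
    I (fun t => D t * dchi k t) + C 0 * I (fun t => L t * dchi k t).
  rewrite -RintegralZl//; last exact: (integrable_continuous_itvoo).
  rewrite -RintegralD//; last 2 first.
  - exact: (integrable_continuous_itvoo).
  - by apply: (integrable_continuous_itvoo) => t; apply: cvgM;
      [exact: cvg_cst|exact: cLd].
  by apply: eq_Rintegral => t _; rewrite /D; ring.
rewrite (funext E).
have := cvgD (dcutoff_pairing_cvg0 cD D0 DT) (cvgM (cvg_cst (C 0)) lim1).
rewrite mulr1 add0r; exact.
Qed.

Definition weighted_cutoff m k t := expR (m * t) * chi k t.

Lemma is_derive_weighted_cutoff m k (t : R) : is_derive t 1 (weighted_cutoff m k)
  (m * weighted_cutoff m k t + expR (m * t) * dchi k t).
Proof.
have h : is_derive t 1 (fun t => m * t) m.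
  by apply: is_derive_eq; rewrite /GRing.scale /=; ring.
have h2 : is_derive t 1 (fun t => expR (m * t)) (expR (m * t) * m).
  exact: is_derive1_comp.
apply: is_derive_eq (is_deriveM h2 (is_derive_cutoff T k.+1%:R t)) _.
by rewrite /GRing.scale /weighted_cutoff /=; ring.
Qed.

Lemma test_weighted_cutoff m k : test_function (`]0, T[ : set R) (weighted_cutoff m k).
Proof.
pose N : R := k.+1%:R; have N0 : 0 < N by rewrite ltr0n.
pose K : set R := [set` `[N^-1, T - N^-1]].
have cK : compact K by exact: segment_compact.
have clK : closed K by apply: compact_closed => //; exact: Rhausdorff.
have sK : [set t | weighted_cutoff m k t != 0] `<=` K.
  move=> t /= tN0.
  have [h1 h2] : 1 < N * t /\ 1 < N * (T - t).
    apply: cutoff_neq0; apply: contra_neq tN0 => E.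
    by rewrite /weighted_cutoff E mulr0.
  have hy : N^-1 < t by rewrite -[ltLHS]mulr1 ltr_pdivrMl.
  have hy' : N^-1 < T - t by rewrite -[ltLHS]mulr1 ltr_pdivrMl.
  by rewrite /K /= in_itv /= (ltW hy) /= lerBrDr -lerBrDl (ltW hy').
have clsK : closure [set t | weighted_cutoff m k t != 0] `<=` K.
  by rewrite [K](closure_id K).1//; exact: closureS.
split.
- apply: smooth1_smooth; apply: smooth1M; last exact: smooth1_cutoff.
  apply: (smooth1_expR (f := fun t => m * t)).
  have -> : (fun t : R => m * t) = cst m \* idfun by apply/funext.
  by apply: smooth1M; [exact: smooth1_cst|exact: smooth1_id].
- by apply: subclosed_compact clsK => //; exact: closed_closure.
- apply: subset_trans clsK _ => t; rewrite /K /= !in_itv /= => /andP[h1 h2].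
  have iN : 0 < N^-1 by rewrite invr_gt0.
  by rewrite (lt_le_trans iN h1) (le_lt_trans h2)// ltrBlDr ltrDl.
Qed.

(** With [e^(m t)] times a cutoff as test function, the terms in [m] cancel. The derivative of the
    cutoff is all that remains on the left, and it recovers the value at time 0. *)
Lemma duhamel m c b : continuous c -> leb.-integrable `]0, T[ (EFin \o b) ->
  distr_ode T c (fun t => m * c t) b -> c T = 0 ->
  c 0 = - I (fun t => b t * expR (m * t)).
Proof.
move=> cc ib ode cT.
have ce : continuous (fun t => expR (m * t)).
  move=> t; apply: (@continuous_comp _ _ _ (fun t => m * t) expR).
    by apply: cvgM; [exact: cvg_cst|exact: cvg_id].
  exact: continuous_expR.
pose C t := c t * expR (m * t).
have cC : continuous C by move=> t; apply: cvgM; [exact: cc|exact: ce].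
have lim1 : I (fun t => C t * dchi k t) @[k --> \oo] --> C 0.
  by apply: dcutoff_pairing_cvg => //; rewrite /C cT mul0r.
have ib2 := integrable_itvoo_mul ib ce.
have lim2 : I (fun t => b t * weighted_cutoff m k t) @[k --> \oo] -->
    I (fun t => b t * expR (m * t)).
  apply: (@Rintegral_dominated_cvg _ bR R leb `]0, T[
    (fun k t => b t * weighted_cutoff m k t) (fun t => b t * expR (m * t))
    (fun t => `|b t * expR (m * t)|)) => //.
  - move=> k; apply: measurable_funM; first exact: (measurable_EFinP _ b).1 (measurable_int _ ib).
    apply: measurable_funTS; apply: continuous_measurable_fun.
    exact: is_derive_continuous (is_derive_weighted_cutoff m k).
  - exact: integrable_norm.
  - move=> t; rewrite /= in_itv /= => tT; rewrite -[expR _]mulr1.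
    apply: cvgM; first exact: cvg_cst.
    by apply: cvgM; [exact: cvg_cst|exact: cutoff_cvg].
  - move=> k t _; rewrite /weighted_cutoff mulrA normrM ler_piMr//.
    by rewrite ger0_norm ?cutoff_ge0 ?cutoff_le1.
have E k : I (fun t => b t * weighted_cutoff m k t) = - I (fun t => C t * dchi k t).
  have cw := is_derive_continuous (is_derive_weighted_cutoff m k).
  have i1 : leb.-integrable `]0, T[ (EFin \o (fun t => m * c t * weighted_cutoff m k t)).
    apply: (integrable_continuous_itvoo) => t; apply: cvgM; last exact: cw.
    by apply: cvgM; [exact: cvg_cst|exact: cc].
  have i2 : leb.-integrable `]0, T[ (EFin \o (fun t => C t * dchi k t)).
    by apply: (integrable_continuous_itvoo) => t; apply: cvgM;
      [exact: cC|exact: continuous_dcutoff].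
  rewrite -(ode _ (test_weighted_cutoff m k)).
  rewrite (is_derive1E (is_derive_weighted_cutoff m k)).
  apply/eqP; rewrite addrC subr_eq addrC -subr_eq opprK; apply/eqP.
  rewrite -RintegralD//; apply: eq_Rintegral => t _; rewrite /C; ring.
rewrite (funext E) in lim2.
have -> : c 0 = C 0 by rewrite /C mulr0 expR0 mulr1.
have := cvg_unique _ lim2 (cvgN lim1).
by move=> /(_ (@Rhausdorff R)) ->; rewrite opprK.
Qed.

End duhamel.

Section cylinder.
Context {R : realType}.
Local Notation bR := (measurableTypeR R).
Local Notation plane := (R * R)%type.
Local Notation leb := (@lebesgue_measure R).
Implicit Types (T : R).

Lemma integrable_cylinder_snd T (h : plane -> \bar R) :
  muOmega.-integrable setT h -> (mucyl T).-integrable setT (fun p => h p.2).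
Proof.
move=> hi; have mI : measurable (`]0, T[ : set bR) by [].
have ms : sigma_finite setT (leb2 : {measure set (bR * bR) -> \bar R}).
  exact: (@sigma_finite_product R _ _ bR bR leb leb).
pose s2 : {sigma_finite_measure set (bR * bR)%type -> \bar R} := sigma_finite_alias ms.
have mh : measurable_fun [set: (bR * (bR * bR))%type] (fun p => h p.2).
  by apply: measurableT_comp => //; exact: measurable_int hi.
have hs : (mrestr (leb \x s2)%E (measurable_cylinder T)).-integrable setT (fun p => h p.2).
  apply: (@restricted_tonelli _ _ bR _ R leb s2 `]0, T[ Omega (measurable_cylinder T)) => //=.
  have ha : muOmega.-integrable setT (abse \o h) by exact: integrable_abse.
  have fin : (\int[muOmega]_y `|h y|)%E \is a fin_num := integrable_fin_num measurableT ha.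
  have -> : (\int[s2]_(y in Omega) `|h y| = (fine (\int[muOmega]_y `|h y|))%:E)%E.
    rewrite (fineK fin) -(integral_mrestr s2 measurable_Omega) //.
    exact: measurable_int ha.
  rewrite integral_cst//=.
  rewrite lebesgue_measure_itv /=; case: ifP => _; rewrite ?mule0 ?ltry// -EFinD -EFinM ltry.
apply/integrableP; split; first exact: mh.
have /integrableP[_ hs2] := hs; apply: le_lt_trans hs2.
rewrite le_eqVlt; apply/orP; left; apply/eqP.
apply: eq_measure_integral => A mA _; rewrite /mucyl /mrestr /=.
apply: (@product_measure12E _ _ bR _ R leb s2); apply: measurableI => //.
exact: measurable_cylinder.
Qed.

Lemma cylinder_weighted_L2 T (h : R * plane -> R) C :
  measurable_fun [set: (bR * (bR * bR))%type] h ->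
  (forall p, cylinder T p -> `|h p| <= C * gweight p.2.1) -> h \in L2cyl T.
Proof.
move=> mh hC; apply/Lfun2P; split => //.
have mh2 : measurable_fun [set: (bR * (bR * bR))%type] (fun p => (h p ^+ 2)%:E).
  by apply: (measurable_EFinP setT _).2; exact: measurable_funX.
have mC := measurable_cylinder T.
apply: (integrable_mrestr leb3 mC mh2).2.
have i1 := integrableZl measurableT (C ^+ 2)
  (integrable_cylinder_snd T integrable_gweight_plane).
have := (integrable_mrestr leb3 mC (measurable_int _ i1)).1 i1.
apply: le_integrable => //; first exact: measurable_funTS.
move=> p Tp; rewrite /= lee_fin ger0_norm ?sqr_ge0// -real_normK ?num_real//.
apply: le_trans (_ : _ <= (C * gweight p.2.1) ^+ 2) _.
  by rewrite lerXn2r ?nnegrE ?hC// (le_trans _ (hC p Tp)).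
apply: le_trans (ler_norm _); rewrite exprMn ler_wpM2l ?sqr_ge0// expr2.
by rewrite ler_piMl ?gweight_le1//; exact/ltW/gweight_gt0.
Qed.

End cylinder.

(** * Moments of a controlled solution *)

Section moment_identity.
Context {R : realType}.
Local Notation bR := (measurableTypeR R).
Local Notation plane := (R * R)%type.
Local Notation leb := (@lebesgue_measure R).
Variables (omega : set plane) (T : R) (T0 : 0 < T) (n : nat) (n0 : (0 < n)%N).
Hypothesis momega : measurable (omega : set (bR * bR)).
Variables (g0 : plane -> R) (u : R * plane -> R) (g : R -> plane -> R).
Hypothesis g0L2 : g0 \in L2Omega.
Hypothesis uL2 : u \in L2cyl T.
Hypothesis sol : grushin_solution omega T g0 u g.
Hypothesis gT : g T = cst 0 %[ae muOmega].

Local Notation c := (fun t => innerL2 (g t) (mode n)).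
(** Projection onto [[0, T]]: the pairing is known to be continuous only there, while [duhamel]
    takes a function continuous on the whole line. *)
Local Notation clamp := (fun t : R => Num.max 0 (Num.min t T)).

Let clamp_itv t : clamp t \in `[0, T].
Proof. by rewrite in_itv /= le_max lexx /= ge_max (ltW T0) ge_min lexx orbT. Qed.

Let clampE t : 0 <= t <= T -> clamp t = t.
Proof. by move=> /andP[t0 tT]; rewrite min_l// max_r. Qed.

Let continuous_clamp : continuous clamp.
Proof.
move=> t; apply: (@continuous_max _ _ (cst 0) (fun t : R => Num.min t T)).
  exact: cvg_cst.
by apply: (@continuous_min _ _ id (cst T)); [exact: cvg_id|exact: cvg_cst].
Qed.

Let continuous_pairing : continuous (fun t => c (clamp t)).
Proof.
have [gC _ _ _] := sol; move=> t.
have [L2t cvgt] := gC _ (clamp_itv t).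
have lim : c s @[s --> within [set` `[0, T]] (nbhs (clamp t))] --> c (clamp t).
  apply: cvg_inner => //; last exact: mode_L2.
  by apply: filterS (withinT _ _) => // s sT; have [] := gC s sT.
apply: (@cvg_comp _ _ _ (fun t => clamp t) c _ _ _ _ lim).
move=> A; rewrite /within /= => /continuous_clamp h.
change (\forall s \near t, A (clamp s)).
by apply: (@filterS _ (nbhs t) _ _ _ _ h) => s; apply; exact: clamp_itv.
Qed.

Local Notation source t z := (\1_omega z * u (t, z)).
Local Notation b := (fun t => innerL2 (fun z => source t z) (mode n)).

Let measurable_window : measurable_fun [set: (bR * (bR * bR))%type]
  (fun p => \1_omega p.2 * mode n p.2 : R).
Proof.
have m1 : measurable_fun [set: bR * bR] (\1_omega : plane -> R).
  exact: (@measurable_indic _ _ R setT).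
have m2 : measurable_fun [set: bR * bR] (mode n : plane -> R).
  by apply: continuous_measurable_plane; exact: continuous_mode.
apply: measurable_funM; first exact: (measurableT_comp m1 (@measurable_snd _ _ _ _)).
exact: (measurableT_comp m2 (@measurable_snd _ _ _ _)).
Qed.

Let window_le (p : R * plane) : `|\1_omega p.2 * mode n p.2| <= gweight p.2.1.
Proof.
rewrite normrM -[leRHS]mul1r ler_pM//; last exact: le_trans (mode_le _ _) (gauss_n_le n0 _).
by rewrite indicE; case: (_ \in _); rewrite ?normr1 ?normr0.
Qed.

Let integrable_source :
  (mucyl T).-integrable setT (fun p => (source p.1 p.2 * mode n p.2)%:E).
Proof.
have wL2 : (fun p => \1_omega p.2 * mode n p.2) \in L2cyl T.
  by apply: (@cylinder_weighted_L2 _ _ _ 1) => // p _; rewrite mul1r.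
have := integrable_mul uL2 wL2; congr (_.-integrable _ _).
by apply/funext => -[t z] /=; congr EFin; ring.
Qed.

Lemma integrable_source_exp :
  (mucyl T).-integrable setT (fun p => (source p.1 p.2 * mode n p.2 * expR (n%:R * p.1))%:E).
Proof.
have wL2 : (fun p => \1_omega p.2 * mode n p.2 * expR (n%:R * p.1)) \in L2cyl T.
  apply: (@cylinder_weighted_L2 _ _ _ (expR (n%:R * T))).
    apply: measurable_funM => //; apply: measurableT_comp => //.
    by apply: measurable_funM.
  move=> [t z] [tT _] /=; move: tT; rewrite /= in_itv /= => /andP[t0 tT].
  rewrite normrM [leRHS]mulrC; apply: ler_pM => //; first exact: (window_le (t, z)).
  by rewrite (gtr0_norm (expR_gt0 _)) ler_expR ler_wpM2l// ltW.
have := integrable_mul uL2 wL2; congr (_.-integrable _ _).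
by apply/funext => -[t z] /=; congr EFin; ring.
Qed.

Let integrable_b : leb.-integrable `]0, T[ (EFin \o b).
Proof.
have [_ ib _] := mucyl_fubini integrable_source.
have mb := measurable_int _ ib; apply: le_integrable ib => //.
  apply: (measurable_EFinP _ _).2; apply: (measurableT_comp _ mb).
  exact: fine_measurable.
(* [fine] sends infinite values to 0, so [b] is dominated by the extended-real integral even at
   times where that one is infinite. *)
move=> t _; rewrite /= /innerL2 /Rintegral; case: (integral _ _ _) => [r| |] /=.
- by [].
- by rewrite leey.
- by rewrite leey.
Qed.

Let ode : distr_ode T (fun t => c (clamp t)) (fun t => n%:R * c (clamp t)) b.
Proof.
have [_ [gV _ _] _ weak] := sol; move=> theta ttheta.
have h : distr_ode T c (fun t => formV (g t) (mode n)) b.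
  exact: weak (mode n) (mode_in_V n0).
rewrite -(h theta ttheta).
rewrite (_ : \int[leb]_(t in `]0, T[) (c (clamp t) * (theta^`())%classic t) =
  \int[leb]_(t in `]0, T[) (c t * (theta^`())%classic t)); last first.
  by apply: eq_Rintegral => t; rewrite inE /= in_itv /= => /andP[t0 tT];
    rewrite clampE// (ltW t0) ltW.
apply: (f_equal (GRing.add _)); rewrite /Rintegral; apply: (f_equal fine).
apply: integral_ae_eq.
have [N [mN N0 sN]] := gV; exists N; split => //; apply: subset_trans sN => t /=.
apply: contra_not => gVt tT; have /gVt Vt : t \in `]0, T[ by [].
rewrite (formV_eigen (eigen_mode n) (mode_in_V n0) Vt).
by move: tT; rewrite /= in_itv /= => /andP[t0 tT]; rewrite clampE// (ltW t0) ltW.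
Qed.

Lemma moment_identity : innerL2 g0 (mode n) =
  - \int[mucyl T]_p (source p.1 p.2 * mode n p.2 * expR (n%:R * p.1)).
Proof.
have [gC _ gi _] := sol.
have inner_ae (h k : plane -> R) : h \in L2Omega -> k \in L2Omega ->
    h = k %[ae muOmega] -> innerL2 h (mode n) = innerL2 k (mode n).
  move=> hL2 kL2 hk; rewrite /innerL2 /Rintegral; congr fine; apply: integral_ae_eq.
  have [N [mN N0 sN]] := hk; exists N; split => //; apply: subset_trans sN => z /=.
  by apply: contra_not => hkz _; rewrite hkz.
have c0 : c (clamp 0) = innerL2 g0 (mode n).
  rewrite clampE ?lexx ?ltW//; apply: inner_ae => //.
  by have [] := gC 0 _; rewrite // in_itv /= lexx ltW.
have cT : c (clamp T) = 0.
  rewrite clampE ?lexx ?ltW//.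
  rewrite /innerL2 /Rintegral (_ : integral _ _ _ = 0%E)//.
  rewrite -[RHS](integral0 muOmega setT); apply: integral_ae_eq.
  have [N [mN N0 sN]] := gT; exists N; split => //; apply: subset_trans sN => z /=.
  by apply: contra_not => gTz _; rewrite gTz// mul0r.
rewrite -c0 (duhamel T0 continuous_pairing integrable_b ode cT); congr (- _).
have [E _ _] := mucyl_fubini integrable_source_exp.
have [_ _ ae] := mucyl_fubini integrable_source.
(* The factor [e^(n t)] leaves the inner integral only where the slice is integrable, which Fubini
   grants for almost every [t]. *)
rewrite /Rintegral E; congr fine; apply: integral_ae_eq.
have [N [mN N0 sN]] := ae; exists N; split => //; apply: subset_trans sN => t /=.
apply: contra_not => it tT; have /it {}it : t \in `]0, T[ by [].
under [RHS]eq_integral do rewrite /= EFinM.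
rewrite integralZr// EFinM; congr (_ * _)%E.
by rewrite /innerL2 /Rintegral fineK//; exact: integrable_fin_num.
Qed.

End moment_identity.

(** * Non-controllability *)

Section finite_linear_combinations.
Context d (T : measurableType d) (R : realType) (mu : {measure set T -> \bar R}).

Lemma Rintegral_sum N (a : nat -> R) (F : nat -> T -> R) :
  (forall n, mu.-integrable setT (EFin \o F n)) ->
  mu.-integrable setT (EFin \o (fun x => \sum_(n < N) a n * F n x)) /\
  \int[mu]_x (\sum_(n < N) a n * F n x) = \sum_(n < N) a n * \int[mu]_x F n x.
Proof.
move=> iF; elim: N => [|N [iN IH]].
  have -> : (fun x => \sum_(n < 0) a n * F n x) = cst 0.
    by apply/funext => x; rewrite big_ord0.
  rewrite big_ord0; split; first exact: integrable0.
  by rewrite /Rintegral integral0.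
have -> : (fun x => \sum_(n < N.+1) a n * F n x) =
    (fun x => \sum_(n < N) a n * F n x + a N * F N x).
  by apply/funext => x; rewrite big_ord_recr.
have iaN : mu.-integrable setT (EFin \o (fun x => a N * F N x)).
  exact: (integrableZl measurableT (a N) (iF N)).
split; first by have := integrableD _ iN iaN; apply.
by rewrite RintegralD// IH RintegralZl// big_ord_recr.
Qed.

End finite_linear_combinations.

(** * Moments of the initial datum *)

Section initial_datum.
Context {R : realType}.
Local Notation bR := (measurableTypeR R).
Local Notation plane := (R * R)%type.
Local Notation leb := (@lebesgue_measure R).
Variables (y0 : R) (hy0 : 0 < y0 < pi).

(** The factor [x] makes [x * gauss_n n x] an exact derivative, so the moments are elementary. The
    ends 1 and 2 give the moduli [e^(-1/2)] and [e^(-2)]; the ends [y0] and [pi] of [block_y] give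
    the angles. *)
Definition block_x (x : R) : R := x * \1_(`[1, 2] : set R) x.
Definition block_y (y : R) : R := \1_(`[y0, pi] : set R) y.
Definition block : plane -> R := tensor block_x block_y.

Let measurable_block_x : measurable_fun [set: bR] block_x.
Proof. by apply: measurable_funM => //; exact: measurable_indic. Qed.

Let measurable_block_y : measurable_fun [set: bR] block_y.
Proof. exact: measurable_indic. Qed.

Lemma block_L2 : block \in L2Omega.
Proof.
apply: (@weighted_L2 _ _ (2 * expR (2 ^+ 2 / 8))).
  apply: measurable_funM.
    exact: (measurableT_comp measurable_block_x (@measurable_fst _ _ _ _)).
  exact: (measurableT_comp measurable_block_y (@measurable_snd _ _ _ _)).
move=> z _; rewrite /block /tensor normrM.
have h1 : `|block_y z.2| <= 1.
  by rewrite /block_y indicE; case: (_ \in _); rewrite ?normr1 ?normr0.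
apply: le_trans (_ : `|block_x z.1| <= _); first by rewrite ler_piMr.
rewrite /block_x indicE; case: (boolP (z.1 \in _)) => [|_]; last first.
  by rewrite mulr0 normr0 mulr_ge0 ?mulr_ge0 ?expR_ge0// ltW// gweight_gt0.
rewrite inE /= in_itv /= => /andP[z1 z2].
have zx : `|z.1| <= 2 by rewrite ger0_norm// (le_trans ler01).
by rewrite mulr1 -[leLHS]mulr1 -mulrA ler_pM// gweight_bound.
Qed.

(** The alternative covers [D] the whole line and [D] the interval []0, pi[], which loses the end
    [b = pi]. *)
Lemma integral_indicator_itv (D : set R) (a b : R) (f F : R -> R) : a < b ->
  measurable (D : set bR) -> 
  D `&` `[a, b] = [set` `[a, b]] \/ D `&` `[a, b] = [set` `[a, b[] ->
  continuous f -> (forall x : R, is_derive x 1 F (f x)) ->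
  (\int[leb]_(x in D) (f x * \1_(`[a, b] : set R) x)%:E = (F b - F a)%:E)%E.
Proof.
move=> ab mD hD cf Ff; rewrite -(FTC_everywhere ab cf Ff).
have -> : (\int[leb]_(x in D) (f x * \1_(`[a, b] : set R) x)%:E =
    \int[leb]_(x in D `&` `[a, b]) (f x)%:E)%E.
  rewrite integral_mkcondr; apply: eq_integral => x _.
  by rewrite patchE indicE; case: ifP => _; rewrite ?mulr1 ?mulr0.
case: hD => -> //.
apply: (@integral_itv_bndo_bndc R (BLeft a) b (EFin \o f)).
apply: (measurable_EFinP _ f).2; apply: measurable_funTS.
exact: continuous_measurable_fun.
Qed.

Lemma innerL2_block n : (0 < n)%N -> n%:R ^+ 2 * innerL2 block (mode n) =
  (expR (- 1 / 2) ^+ n - expR (- 2) ^+ n) * (cos (n%:R * y0) - cos (n%:R * pi)).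
Proof.
move=> n0; have m0 : (n%:R : R) != 0 by rewrite pnatr_eq0 -lt0n.
have /andP[y00 y0pi] := hy0.
have iy : (\int[leb]_(y in `]0%R, pi[) (sin_n n y * block_y y)%:E =
    ((cos (n%:R * y0) - cos (n%:R * pi)) / n%:R)%:E)%E.
  have dF (y : R) : is_derive y 1 (fun y : R => - n%:R^-1 * cos (n%:R * y)) (sin_n n y).
    have h : is_derive y 1 (fun y : R => n%:R * y) (n%:R : R).
      by apply: is_derive_eq; rewrite /GRing.scale /=; ring.
    have h2 : is_derive y 1 (fun y : R => cos (n%:R * y)) (- sin (n%:R * y) * n%:R).
      exact: is_derive1_comp.
    apply: is_derive_eq (is_deriveZ (- n%:R^-1) h2) _.
    by rewrite /GRing.scale /= /sin_n; field.
  have eD : `]0, pi[ `&` `[y0, pi] = [set` `[y0, pi[].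
    apply/seteqP; split => y /=; rewrite !in_itv /=.
      by move=> [/andP[_ ->] /andP[-> _]].
    by move=> /andP[h1 h2]; rewrite h1 h2 (lt_le_trans y00 h1) (ltW h2).
  rewrite (integral_indicator_itv y0pi (measurable_itv _) (or_intror eD)
    (@continuous_sin_n R n) dF).
  by congr EFin; field.
have ix : (\int[leb]_x (block_x x * gauss_n n x)%:E =
    ((gauss_n n 1 - gauss_n n 2) / n%:R)%:E)%E.
  have dF (x : R) : is_derive x 1 (fun x => - n%:R^-1 * gauss_n n x) (x * gauss_n n x).
    apply: is_derive_eq (is_deriveZ (- n%:R^-1) (is_derive_gauss_n n x)) _.
    by rewrite /GRing.scale /= /dgauss_n; field.
  have cF : continuous (fun x : R => x * gauss_n n x).
    by move=> x; apply: cvgM; [exact: cvg_id|exact: continuous_gauss_n].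
  have lt12 : 1 < 2 :> R by rewrite ltr1n.
  rewrite [RHS](_ : _ = (- n%:R^-1 * gauss_n n 2 - - n%:R^-1 * gauss_n n 1)%:E); last first.
    by congr EFin; field.
  rewrite -(integral_indicator_itv lt12 measurableT (or_introl (setTI _)) cF dF).
  by apply: eq_integral => x _; congr EFin; rewrite /block_x; ring.
have [E _] := muOmega_fubini (integrable_mul block_L2 (mode_L2 n0)).
rewrite /innerL2 /Rintegral E.
have iyi : leb.-integrable `]0, pi[ (fun y => (sin_n n y * block_y y)%:E).
  have i1 : leb.-integrable `]0, pi[ (EFin \o (cst 1 : R -> R)).
    by apply: integrable_continuous_itvoo => y; exact: cvg_cst.
  apply: le_integrable i1 => //.
    apply: (measurable_EFinP _ _).2; apply: measurable_funTS; apply: measurable_funM => //.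
    by apply: continuous_measurable_fun; exact: continuous_sin_n.
  move=> y _; rewrite /= lee_fin normrM normr1 mulr_ile1 ?sin_n_le1//.
  by rewrite /block_y indicE; case: (_ \in _); rewrite ?normr1 ?normr0.
have ixi : leb.-integrable setT (fun x => (block_x x * gauss_n n x)%:E).
  apply: le_integrable (@integrable_gweight R) => //.
    apply: (measurable_EFinP _ _).2; apply: measurable_funM => //.
    by apply: continuous_measurable_fun; exact: continuous_gauss_n.
  move=> x _; rewrite /= lee_fin (gtr0_norm (gweight_gt0 _)).
  apply: le_trans (xgauss_n_le n0 x); rewrite normrM (gtr0_norm (gauss_n_gt0 _ _)).
  rewrite ler_wpM2r ?(ltW (gauss_n_gt0 _ _))// /block_x normrM ler_piMr//.
  by rewrite indicE; case: (_ \in _); rewrite ?normr1 ?normr0.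
have -> : (fun x => \int[leb]_(y in `]0%R, pi[) (block (x, y) * mode n (x, y))%:E)%E =
    (fun x => (block_x x * gauss_n n x)%:E *
       ((cos (n%:R * y0) - cos (n%:R * pi)) / n%:R)%:E)%E.
  apply/funext => x; rewrite -iy -integralZl//.
  by apply: eq_integral => y _; rewrite -EFinM; congr EFin; rewrite /block /mode /tensor /=; ring.
rewrite integralZr// ix -EFinM /=.
have G (x w : R) : n%:R * w = - (n%:R / 2) * x ^+ 2 -> gauss_n n x = expR w ^+ n.
  by move=> h; rewrite /gauss_n -h -expRM_natl.
rewrite (G 1 (- 1 / 2)); last by field.
rewrite (G 2 (- 2)); last by field.
by field.
Qed.

End initial_datum.

Section main_lemmas.
Context {R : realType}.
Local Notation bR := (measurableTypeR R).
Local Notation plane := (R * R)%type.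
Local Notation leb := (@lebesgue_measure R).

Lemma le_norm_integral_cylinder T (F G : R * plane -> R) :
  (mucyl T).-integrable setT (EFin \o F) -> (mucyl T).-integrable setT (EFin \o G) ->
  (forall p, cylinder T p -> `|F p| <= G p) ->
  `|\int[mucyl T]_p F p| <= \int[mucyl T]_p G p.
Proof.
move=> iF iG FG; have mC := measurable_cylinder T.
have mF := measurable_int _ iF; have mG := measurable_int _ iG.
have iF' := (integrable_mrestr leb3 mC mF).1 iF.
have iG' := (integrable_mrestr leb3 mC mG).1 iG.
have E (H : R * plane -> R) : measurable_fun setT (EFin \o H : (bR * (bR * bR))%type -> \bar R) ->
    \int[mucyl T]_p H p = \int[leb3]_(p in cylinder T) H p.
  by move=> mH; rewrite /Rintegral (integral_mrestr leb3 mC mH).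
rewrite !E//; apply: le_trans (le_normr_Rintegral mC iF') _.
apply: le_Rintegral => //; exact: integrable_norm.
Qed.

Lemma continuous_gt0_lower_bound (f : R -> R) X : continuous f -> (forall x, 0 < f x) ->
  0 <= X -> exists2 f1, 0 < f1 & forall x, `|x| <= X -> f1 <= f x.
Proof.
move=> cf f0 X0; have XX : - X <= X by lra.
have [c _ hc] := EVT_min XX (continuous_subspaceT cf).
by exists (f c) => // x xX; apply: hc; rewrite in_itv /= -ler_norml.
Qed.

Lemma mode_exp n t (z : plane) :
  mode n z * expR (n%:R * t) = expR (t - z.1 ^+ 2 / 2) ^+ n * sin (n%:R * z.2).
Proof.
rewrite /mode /tensor /gauss_n /sin_n mulrAC -expRD -expRM_natl; congr (expR _ * _).
by field.
Qed.

Lemma open_region (y0 : R) (f : R -> R) : continuous f ->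
  open [set z : plane | 0 < z.2 < pi /\ f z.1 < `|z.2 - y0|].
Proof.
move=> cf.
have -> : [set z : plane | 0 < z.2 < pi /\ f z.1 < `|z.2 - y0|] =
    (fun z => z.2) @^-1` [set` `]0, pi[] `&`
    (fun z => `|z.2 - y0| - f z.1) @^-1` [set r | 0 < r].
  apply/seteqP; split => z /=; rewrite in_itv /= subr_gt0; tauto.
apply: openI.
  by apply: open_comp => [z _|]; [exact: cvg_snd|exact: itv_open].
apply: open_comp => [z _|]; last exact: open_gt.
apply: cvgB; last by apply: continuous_comp; [exact: cvg_fst|exact: cf].
by apply: cvg_norm; apply: cvgB; [exact: cvg_snd|exact: cvg_cst].
Qed.

End main_lemmas.

Theorem theorem3p4 (R : realType) (y0 : R) (f : R -> R)
    (hy0 : 0 < y0 < pi) (f_cont : continuous f) (f_gt0 : forall x, 0 < f x)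
    (T : R) (hT : 0 < T) :
  ~ null_controllable
      [set z : R * R | 0 < z.2 < pi /\ f z.1 < `|z.2 - y0|] T.
Proof.
set omega := [set z : R * R | _].
move=> /(_ _ (block_L2 y0))[u [g [uL2 sol gT]]].
have momega : measurable (omega : set (measurableTypeR R * measurableTypeR R)).
  exact: (open_measurable_plane (@open_region R y0 f f_cont)).
pose rho : R := expR (- 1 / 2); pose s : R := expR (- 2).
pose F n (p : R * (R * R)) := n%:R ^+ 2 *
  (\1_omega p.2 * u (p.1, p.2) * mode n p.2 * expR (n%:R * p.1)).
have iF n : (mucyl T).-integrable setT (EFin \o F n).
  case: n => [|n].
    have -> : F 0%N = cst 0 by apply/funext => p; rewrite /F expr0n mul0r.
    exact: integrable0.
  exact: (integrableZl measurableT (n.+1%:R ^+ 2)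
    (integrable_source_exp (ltn0Sn n) momega uL2)).
(* There is no mode for [n = 0], but both sides vanish there, so the constant coefficient of the
   polynomial does no harm. *)
have moment n : (rho ^+ n - s ^+ n) * (cos (n%:R * y0) - cos (n%:R * pi)) =
    - \int[mucyl T]_p F n p.
  case: n => [|n].
    rewrite !expr0 subrr mul0r.
    have -> : F 0%N = cst 0 by apply/funext => p; rewrite /F expr0n mul0r.
    by rewrite /Rintegral integral0 oppr0.
  rewrite -(innerL2_block hy0)// (moment_identity hT (ltn0Sn n) momega (block_L2 y0) uL2 sol gT).
  rewrite mulrN -RintegralZl//.
  exact: (integrable_source_exp (ltn0Sn n) momega uL2).
pose G (p : R * (R * R)) := `|u p| * gweight p.2.1.
have iG : (mucyl T).-integrable setT (EFin \o G).
  have gL2 : (fun p : R * (R * R) => gweight p.2.1) \in L2cyl T.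
    apply: (@cylinder_weighted_L2 _ _ _ 1).
      exact: (measurableT_comp (@measurable_gweight R) (@measurable_snd _ _ _ _)).
    by move=> p _; rewrite mul1r gtr0_norm// gweight_gt0.
  have := integrable_norm (integrable_mul uL2 gL2).
  congr (_.-integrable _ _); apply/funext => p /=.
  by rewrite normrM (gtr0_norm (gweight_gt0 _)).
pose M := \int[mucyl T]_p G p.
have M0 : 0 <= M.
  by apply: Rintegral_ge0 => p _; rewrite mulr_ge0// ltW// gweight_gt0.
(* If [|w| > rho / 2] then [e^(x^2 / 2) < B], hence [x^2 < 2 * B] and [|x| <= B + 1]; on this
   compact range [f] has a positive minimum. *)
pose B := 2 * expR T / rho.
have B0 : 0 < B by rewrite divr_gt0 ?mulr_gt0 ?expR_gt0.
have [f1 f10 hf1] := continuous_gt0_lower_bound f_cont f_gt0 (ltW (ltr_wpDl (ltW B0) ltr01)).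
(* With this choice the control side is at most [M / (8 * (M + 1)) < 1/8], against the lower bound
   1/4 on the side of the datum. *)
pose e := (8 * expR T * (M + 1))^-1.
have e0 : 0 < e by rewrite invr_gt0 !mulr_gt0 ?expR_gt0// ltr_wpDl.
(* The quotient [rho / s] is [e^(3/2)], which is at least [1 + 3/2]. *)
have hs : 0 < s <= rho / 2.
  rewrite expR_gt0 /= ler_pdivlMr// /s (_ : - 2 = - 1 / 2 + - (3 / 2)); last by field.
  rewrite expRD -mulrA ler_piMr ?expR_ge0// expRN ler_pdivrMl ?expR_gt0// mulr1.
  by apply: le_trans (expR_ge1Dx _); lra.
have hb : rho < expR T by rewrite ltr_expR; lra.
have [N [a [small big]]] := peaking_coefficients hy0 hs hb e0 f10.
have [iS ES] := Rintegral_sum N a iF.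
have bound : `|\int[mucyl T]_p (\sum_(n < N) a n * F n p)| <= \int[mucyl T]_p (e * expR T * G p).
  apply: le_norm_integral_cylinder => //.
    exact: (integrableZl measurableT (e * expR T) iG).
  move=> [t z] [tT [_ zpi]]; move: tT zpi; rewrite /= !in_itv /= => /andP[t0 tT] zpi.
  pose r := expR (t - z.1 ^+ 2 / 2).
  have -> : \sum_(n < N) a n * F n (t, z) = \1_omega z * u (t, z) *
      \sum_(n < N) a n * (n%:R ^+ 2 * (r ^+ n * sin (n%:R * z.2))).
    rewrite big_distrr /=; apply: eq_bigr => n _.
    by rewrite /F /= -mulrA mode_exp; ring.
  (* This is where the factor [r] in the bound on the polynomial becomes a Gaussian weight, square
     integrable and hence integrable against [|u|]. *)
  have rle : r <= expR T * gweight z.1.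
    by rewrite -expRD ler_expR; have := sqr_ge0 z.1; lra.
  have r0 : 0 < r by exact: expR_gt0.
  rewrite normrM normrM /G /=.
  have [zo|zo] := boolP (z \in omega); last first.
    rewrite indicE (negbTE zo) normr0 !mul0r !mulr_ge0 ?expR_ge0 ?(ltW e0)//.
  rewrite indicE zo normr1 mul1r.
  rewrite [leRHS](_ : _ = `|u (t, z)| * (e * (expR T * gweight z.1))); last by ring.
  rewrite ler_wpM2l//; apply: le_trans (_ : e * r <= _); last by rewrite ler_pM2l.
  apply: small => //.
    rewrite ltW//= (le_trans rle)// ler_piMr ?expR_ge0 ?gweight_le1//.
  move=> hr; have [_ fz] : omega z by rewrite inE in zo.
  apply: le_trans (ltW fz); apply: hf1.
  have x2 : z.1 ^+ 2 < 2 * B.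
    have h1 : expR (z.1 ^+ 2 / 2) < B.
      rewrite /B ltr_pdivlMr ?expR_gt0//.
      have : expR (z.1 ^+ 2 / 2) * (rho / 2) < expR (z.1 ^+ 2 / 2) * r by rewrite ltr_pM2l// expR_gt0.
      rewrite /r -expRD (_ : _ + (t - _) = t); last by ring.
      have : expR t < expR T by rewrite ltr_expR.
      lra.
    by have := expR_ge1Dx (z.1 ^+ 2 / 2); lra.
  rewrite -(ler_pXn2r (n := 2)) ?nnegrE ?addr_ge0 ?(ltW B0)// real_normK ?num_real//.
  by apply: le_trans (ltW x2) _; nra.
move: big; under eq_bigr do rewrite moment mulrN.
rewrite sumrN normrN -ES => big.
have := le_trans big bound; rewrite RintegralZl// -/M.
have TN0 : expR T != 0 by rewrite gt_eqF// expR_gt0.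
have M10 : 0 < M + 1 by rewrite ltr_wpDl.
have M1N0 : M + 1 != 0 by rewrite gt_eqF.
have -> : e * expR T * M = M / (8 * (M + 1)) by rewrite /e; field; rewrite M1N0 TN0.
rewrite ler_pdivlMr ?mulr_gt0//; lra.
Qed.
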